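(* Let $\boldsymbol\ell=(\ell_1,\ell_2,\ell_3,2)$ with $\ell_1,\ell_2,\ell_3\geq1$ and let $\lambda=(\mathbf a,\mathbf b,\mathbf c,\mathbf d)=((a_1,\dots,a_{\ell_1}),(b_1,\dots,b_{\ell_2}),(c_1,\dots,c_{\ell_3}),(d_1,d_2))\in\Lambda(\boldsymbol\ell)$. Put $$\lambda^1=((1^2,4),(1^2,4),(1^2,4),(3^2)),\quad \lambda^2=((2,6),(1^3,5),(1^3,5),(4^2)),\quad \lambda^3=((3,9),(2^2,8),(1^5,7),(6^2)).$$ The following conditions are equivalent. (1) $\mathfrak X(\lambda)$ is of finite type, i.e. it has a finite number of $L$-orbits. (2) $\lambda\not\geq\lambda^1$, $\lambda\not\geq\lambda^2$ and $\lambda\not\geq\lambda^3$, for any permutation of $\mathbf a,\mathbf b,\mathbf c$. (3) Up to permuting $\mathbf a,\mathbf b,\mathbf c$ and up to removing the coefficients of $\mathbf a',\mathbf b',\mathbf c'$ which are equal to $0$ (with $\ell_1,\ell_2,\ell_3$ then denoting the resulting lengths), $\lambda$ fits in one of the following cases: (o) $\ell_1=1$; (a) $\min\{d_1,d_2\}\leq 2$; (b) $\min\{d_1,d_2\}=3$ and $\ell_1=2$; (c) $\min\{d_1,d_2\}\in\{4,5\}$, $\ell_1=2$, and $\ell_2=3$; (d) $\ell_1=2$ and one of the following conditions occurs: (d1) $a_1=1$; (d2) $a_1=2$ and $\ell_2=3$; (d3) $\ell_2=2$, or ($\ell_2=3$ and $\min\{b_1,b_2\}=1$); (d4) $\ell_2=3$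 and $\ell_3\leq 5$.
   Context: $\mathbb{K}$ is an algebraically closed field of characteristic zero; $\mathrm{GL}_m=\mathrm{GL}_m(\mathbb{K})$. The notation $i^k$ stands for $k$ consecutive coefficients equal to $i$. For a sequence $\mathbf x$ of nonnegative integers, $|\mathbf x|$ is its sum, and $\mathbf a'=(a_1,\dots,a_{\ell_1-1})$ denotes $\mathbf a$ with its last entry removed (similarly $\mathbf b',\mathbf c'$). For $\boldsymbol\ell=(\ell_1,\ell_2,\ell_3,2)$, $\Lambda(\boldsymbol\ell)$ is the set of nonzero quadruples $\lambda=(\mathbf a,\mathbf b,\mathbf c,\mathbf d)$ of sequences of nonnegative integers of lengths $\ell_1,\ell_2,\ell_3,2$ such that $|\mathbf a|=|\mathbf b|=|\mathbf c|=|\mathbf d|=|\mathbf a'|+|\mathbf b'|+|\mathbf c'|=:|\lambda|$. For $\lambda\in\Lambda(\boldsymbol\ell)$ with $n=|\lambda|$, $\mathfrak X(\lambda)=\mathscr F\!\ell(\mathbf a')\times\mathscr F\!\ell(\mathbf b')\times\mathscr F\!\ell(\mathbf c')\times\mathrm{Gr}(d_1;n)$, where $\mathscr F\!\ell(\mathbf x)$ is the variety of flags $(0=F_0\subset F_1\subset\dots\subset F_k=\mathbb K^{|\mathbf x|})$ with $\dim F_i/F_{i-1}=x_i$, and $\mathrm{Gr}(d;n)$ is the Grassmannian of $d$-dimensional subspaces of $\mathbb K^n=\mathbb K^{|\mathbf a'|}\oplus\mathbb K^{|\mathbf b'|}\oplus\mathbb K^{|\mathbf c'|}$. The group $L=\mathrm{GL}_{|\mathbf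 a'|}\times\mathrm{GL}_{|\mathbf b'|}\times\mathrm{GL}_{|\mathbf c'|}$, embedded block-diagonally in $\mathrm{GL}_n$, acts diagonally on $\mathfrak X(\lambda)$. Order relation: for $\mu=(\mathbf e,\mathbf f,\mathbf g,(h_1,h_2))\in\Lambda(m_1,m_2,m_3,2)$ and $\lambda=(\mathbf a,\mathbf b,\mathbf c,(d_1,d_2))\in\Lambda(\ell_1,\ell_2,\ell_3,2)$, one writes $\mu\leq\lambda$ (equivalently $\lambda\geq\mu$) if $h_i\leq d_i$ for $i=1,2$ and there are subsequences of $\mathbf a,\mathbf b,\mathbf c$ of lengths $m_1,m_2,m_3$ (of the form $(a_{i_1},\dots,a_{i_{m_1}})$ with $1\leq i_1<\dots<i_{m_1}\leq\ell_1$, etc.) which are pointwise bigger than or equal to $\mathbf e,\mathbf f,\mathbf g$, respectively. In (2), the condition is required for every quadruple obtained from $\lambda$ by permuting its first three components. *)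

(* Defs.v *)
From mathcomp Require Import all_boot all_order all_algebra.
From mathcomp Require Import boolp classical_sets cardinality.

Set Implicit Arguments.
Unset Strict Implicit.
Unset Printing Implicit Defensive.

Import GRing.Theory.

(* A quadruple (a, b, c, d) of sequences of nonnegative integers, the last one
   being of length 2. *)
Record quadruple := Quadruple {
  seqa : seq nat;
  seqb : seq nat;
  seqc : seq nat;
  paird : nat * nat
}.

(* x' : the sequence x with its last entry removed. *)
Definition trunc (x : seq nat) : seq nat := take (size x).-1 x.

Definition nonzero (l : quadruple) : bool :=
  has (fun k => k != 0)
    (seqa l ++ seqb l ++ seqc l ++ [:: (paird l).1; (paird l).2]).

Definition weight (l : quadruple) : nat :=
  sumn (trunc (seqa l)) + (sumn (trunc (seqb l)) + sumn (trunc (seqc l))).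

Definition Lambda (l1 l2 l3 : nat) (l : quadruple) : Prop :=
  [/\ [/\ size (seqa l) = l1, size (seqb l) = l2 & size (seqc l) = l3],
      nonzero l
    & [/\ sumn (seqa l) = weight l, sumn (seqb l) = weight l,
          sumn (seqc l) = weight l & (paird l).1 + (paird l).2 = weight l]].

(* Some subsequence of x, of the length of e, is pointwise >= e
   ([all2] is false on sequences of different sizes). *)
Definition dominated (e x : seq nat) : Prop :=
  exists2 s, subseq s x & all2 leq e s.

Definition quadruple_le (m l : quadruple) : Prop :=
  [/\ (paird m).1 <= (paird l).1, (paird m).2 <= (paird l).2
    & [/\ dominated (seqa m) (seqa l), dominated (seqb m) (seqb l)
        & dominated (seqc m) (seqc l)]].

(* Only the first three components are permuted. *)
Definition permuted (m l : quadruple) : Prop :=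
  perm_eq [:: seqa m; seqb m; seqc m] [:: seqa l; seqb l; seqc l]
  /\ paird m = paird l.

Definition lambda1 : quadruple :=
  Quadruple [:: 1; 1; 4] [:: 1; 1; 4] [:: 1; 1; 4] (3, 3).
Definition lambda2 : quadruple :=
  Quadruple [:: 2; 6] [:: 1; 1; 1; 5] [:: 1; 1; 1; 5] (4, 4).
Definition lambda3 : quadruple :=
  Quadruple [:: 3; 9] [:: 2; 2; 8] [:: 1; 1; 1; 1; 1; 7] (6, 6).

(* Removes the zero entries of x', keeping the last entry of x even if it is
   zero. *)
Definition remove0 (x : seq nat) : seq nat :=
  [seq k <- trunc x | k != 0] ++ drop (size x).-1 x.

Definition reduce (l : quadruple) : quadruple :=
  Quadruple (remove0 (seqa l)) (remove0 (seqb l)) (remove0 (seqc l)) (paird l).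

(* Entries are indexed from 0: a_1 is [nth 0 a 0], b_2 is [nth 0 b 1]. *)
Definition in_list (l : quadruple) : Prop :=
  let l1 := size (seqa l) in
  let l2 := size (seqb l) in
  let l3 := size (seqc l) in
  let a1 := nth 0 (seqa l) 0 in
  let b1 := nth 0 (seqb l) 0 in
  let b2 := nth 0 (seqb l) 1 in
  let d := minn (paird l).1 (paird l).2 in
  l1 = 1 \/
  d <= 2 \/
  (d = 3 /\ l1 = 2) \/
  ((d = 4 \/ d = 5) /\ l1 = 2 /\ l2 = 3) \/
  (l1 = 2 /\
    (a1 = 1 \/
     (a1 = 2 /\ l2 = 3) \/
     (l2 = 2 \/ (l2 = 3 /\ minn b1 b2 = 1)) \/
     (l2 = 3 /\ l3 <= 5))).

Local Open Scope ring_scope.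
Local Open Scope classical_set_scope.

(* The image of a subspace U of K^n (column vectors) under a matrix g. *)
Definition mxact (K : fieldType) (n : nat) (g : 'M[K]_n)
    (U : {vspace 'cV[K]_n}) : {vspace 'cV[K]_n} :=
  (linfun (mulmx g) @: U)%VS.

(* Families (F_0, ..., F_k) of subspaces of K^|x|, for x of length k. *)
Definition subspaces (K : fieldType) (x : seq nat) : Type :=
  {ffun 'I_(size x).+1 -> {vspace 'cV[K]_(sumn x)}}.

(* For i : 'I_k, [widen_ord (leqnSn k) i] and [lift ord0 i] are the indices i
   and i.+1 in 'I_k.+1. *)
Definition Fl (K : fieldType) (x : seq nat) : set (subspaces K x) :=
  [set F | [/\ F ord0 = 0%VS, F ord_max = fullv
    & forall i : 'I_(size x),
        let U := F (widen_ord (leqnSn (size x)) i) in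
        let V := F (lift ord0 i) in
        (U <= V)%VS /\ (\dim V - \dim U = nth 0 x i)%N]].

Definition Gr (K : fieldType) (d n : nat) : set {vspace 'cV[K]_n} :=
  [set U | \dim U = d].

Definition flact (K : fieldType) (x : seq nat) (g : 'M[K]_(sumn x))
    (F : subspaces K x) : subspaces K x :=
  [ffun i => mxact g (F i)].

Section MultipleFlagVariety.
Variables (K : fieldType) (l : quadruple).

Let a' := trunc (seqa l).
Let b' := trunc (seqb l).
Let c' := trunc (seqc l).

Definition point : Type :=
  subspaces K a' * subspaces K b' * subspaces K c'
  * {vspace 'cV[K]_(weight l)}.

Definition flag_variety : set point :=
  @Fl K a' `*` @Fl K b' `*` @Fl K c' `*` @Gr K (paird l).1 (weight l).

Definition levi_mx : Type :=
  'M[K]_(sumn a') * 'M[K]_(sumn b') * 'M[K]_(sumn c').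

(* GL_|a'| x GL_|b'| x GL_|c'|. *)
Definition levi : set levi_mx :=
  [set g | [/\ g.1.1 \in unitmx, g.1.2 \in unitmx & g.2 \in unitmx]].

Definition levi_embed (g : levi_mx) : 'M[K]_(weight l) :=
  block_mx g.1.1 0 0 (block_mx g.1.2 0 0 g.2).

Definition levi_act (g : levi_mx) (p : point) : point :=
  (flact g.1.1 p.1.1.1, flact g.1.2 p.1.1.2, flact g.2 p.1.2,
   mxact (levi_embed g) p.2).

Definition levi_orbit (p : point) : set point := [set levi_act g p | g in levi].

Definition finite_type : Prop := finite_set [set levi_orbit p | p in flag_variety].

End MultipleFlagVariety.

(* Main.v *)
(* Fix the three reference flags: the [L]-orbits in X(lam) become the classes of full rank [d_1 x n] matrices [M] under row operations by [GL_(d_1)] and column operations by three parabolic blocks. Writing [M] as the upper right corner of a square matrix, this is conjugation-like equivalence under the units of an incidence algebra [B].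

Finiteness. An object is a matrix with no kernel on its rows; its direct summands are cut out by idempotents of [B], which are conjugate to coordinate projections. The cases of the list are those for which the Tits form (dimension of the group minus dimension of the matrix space) is positive on all relevant dimension vectors. Then an object with scalar endomorphisms has a dense orbit, i.e. it is rigid (every tangent direction is the direction of the group action), and by Ringel's argument so has every indecomposable object. Two rigid objects of the same dimension are equivalent, because the line joining them meets both orbits in cofinite sets. Induction over direct sum decompositions gives finitely many classes.

Infiniteness. The three minimal quadruples are isotropic vectors of the forms of extended type E6, E7, E8 and carry one-parameter families of pairwise Hom-orthogonal objects. A family extends to X(lam) for lam above the quadruple by adding a fixed complement; if [N + 1] extended members were isomorphic, they would give [N + 1] nonzero orthogonal idempotents in an [N x N] matrix algebra. *)

Require Import Defs.
From Stdlib Require Import ZArith Lia.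
From mathcomp Require Import all_boot all_order all_algebra.
From mathcomp Require Import boolp zify.

Set Implicit Arguments.
Unset Strict Implicit.
Unset Printing Implicit Defensive.

Import GRing.Theory.

(** * Coordinate projections and polynomials in a matrix *)

Section RigidObjects.
Local Open Scope ring_scope.

(** In several cases of the list the form is positive only on vectors with at most [d_1] rows and at
    most [d_2] more columns than rows, so both bounds must survive every reduction. The first does
    because all pieces live inside the original index set. The second passes to summands because
    these have no kernel on their rows, and to the subobjects of Ringel's argument because these are
    saturated, so that their cokernels embed into that of the whole. Hence actual index sets [C]
    replace dimension vectors: after conjugation, passing to a summand is restriction to a subset.
    Orbits are handled by linear algebra. Rigidity says that a linear map is onto, and the openness
    of a rigid orbit is the nonvanishing of one polynomial along a line. Inverses, idempotents and
    kernels must be found inside the incidence algebra: the first two are polynomials in a given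
    matrix, the last comes from a row reduction that respects the order of the levels. *)

Definition coord_mx (K : fieldType) (N : nat) (C : {set 'I_N}) : 'M[K]_N :=
  \matrix_(i, j) ((i == j) && (i \in C))%:R.

Section ProjMx.
Variables (K : fieldType) (N : nat).
Implicit Types (C D : {set 'I_N}).
Local Notation P := (@coord_mx K N).

Lemma mul_coord_mx n (x : 'M[K]_(N, n)) C i j :
  (P C *m x) i j = if i \in C then x i j else 0.
Proof.
rewrite mxE (bigD1 i) //= !mxE eqxx /= big1 ?addr0 => [|k /negPf nk].
  by case: ifP; rewrite ?mul1r ?mul0r.
by rewrite mxE eq_sym nk mul0r.
Qed.

Lemma mul_mx_coord n (x : 'M[K]_(n, N)) C i j :
  (x *m P C) i j = if j \in C then x i j else 0.
Proof.
rewrite mxE (bigD1 j) //= !mxE eqxx /= big1 ?addr0 => [|k /negPf nk].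
  by case: ifP; rewrite ?mulr1 ?mulr0.
by rewrite mxE nk mulr0.
Qed.

Lemma coord_mxM C D : P C *m P D = P (C :&: D).
Proof.
apply/matrixP => i j; rewrite mul_coord_mx !mxE inE.
by case: (_ \in C); rewrite ?andbF.
Qed.

Lemma coord_mxT : P setT = 1%:M.
Proof. by apply/matrixP => i j; rewrite !mxE inE andbT. Qed.

Lemma coord_mx0 : P set0 = 0.
Proof. by apply/matrixP => i j; rewrite !mxE inE andbF. Qed.

Lemma coord_mxK C D : D \subset C -> P C *m P D = P D /\ P D *m P C = P D.
Proof. by move=> sDC; rewrite !coord_mxM (setIidPr sDC) (setIidPl sDC). Qed.

Lemma coord_mxU C D : [disjoint C & D] -> P (C :|: D) = P C + P D.
Proof.
move=> dCD; apply/matrixP => i j; rewrite !mxE inE.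
case: eqP => [_|_]; last by rewrite addr0.
have [iC|_] := boolP (i \in C); last by rewrite add0r.
by rewrite (disjointFr dCD iC) addr0.
Qed.

Lemma rank_coord_mx C : \rank (P C) = #|C|.
Proof.
pose A := \matrix_(k < #|C|, j < N) ((enum_val k == j)%:R : K).
have eAA : P C = A^T *m A.
  apply/matrixP => i j; rewrite !mxE.
  have [iC|niC] := boolP (i \in C); last first.
    rewrite andbF big1 // => k _; rewrite !mxE.
    by case: eqP niC => [<-|_]; rewrite ?enum_valP // mul0r.
  rewrite (bigD1 (enum_rank_in iC i)) //= !mxE enum_rankK_in // eqxx mul1r andbT.
  rewrite big1 ?addr0 // => k nk; rewrite !mxE; case: eqP => [e|_]; last by rewrite mul0r.
  by case/eqP: nk; apply: enum_val_inj; rewrite enum_rankK_in.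
have AA : A *m A^T = 1%:M.
  apply/matrixP => k l; rewrite !mxE (bigD1 (enum_val k)) //= !mxE eqxx mul1r.
  rewrite big1 ?addr0 => [|j nj]; last by rewrite !mxE eq_sym (negPf nj) mul0r.
  by rewrite (inj_eq enum_val_inj) eq_sym.
apply/eqP; rewrite eqn_leq; apply/andP; split.
  by rewrite eAA; apply: leq_trans (mxrankM_maxl _ _) (rank_leq_col _).
have e1 : A *m P C *m A^T = 1%:M by rewrite eAA mulmxA AA mul1mx.
rewrite -[leqLHS](mxrank1 K) -e1.
exact: leq_trans (mxrankM_maxl _ _) (mxrankM_maxr _ _).
Qed.

End ProjMx.

Section PolynomialsInMatrix.
Variables (K : fieldType) (N : nat) (b : 'M[K]_N) (Q : 'M[K]_N -> Prop).
Hypotheses (QD : forall x y, Q x -> Q y -> Q (x + y)) (QZ : forall a x, Q x -> Q (a *: x)).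
Hypothesis Qb : forall x, Q x -> Q (x *m b).

(** By Cayley-Hamilton the inverse is a polynomial in [b], the constant coefficient of the
    characteristic polynomial being nonzero. Any linear condition stable under multiplication by [b]
    thus passes from the identity to the inverse; it will be membership in the incidence algebra. *)
Lemma mx_inv_closed c : Q 1%:M -> b *m c = 1%:M -> Q c.
Proof.
case: N b Q QD QZ Qb c => [|n] b' Q' D Z hb c Q1 bc.
  by rewrite (flatmx0 c) -(flatmx0 1%:M).
have b_unit : b' \in unitmx by have [] := mulmx1_unit bc.
have := Cayley_Hamilton b'; set h := char_poly b' => CH.
have h0 : h`_0 != 0.
  by rewrite char_poly_det mulf_neq0 ?signr_eq0 // -unitfE -unitmxE.
pose g := drop_poly 1 h.
have hE : h = g * 'X + (h`_0)%:P.
  rewrite -[LHS](poly_take_drop 1) expr1 addrC; congr (_ + _).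
  by apply/polyP => i; rewrite coef_take_poly coefC; case: i.
have : horner_mx b' g *m b' = - (h`_0)%:M.
  apply/eqP; rewrite -addr_eq0 mulmxE -(horner_mx_C b') -[X in _ * X]horner_mx_X.
  by rewrite -rmorphM -rmorphD -hE; apply/eqP; exact: CH.
move/(congr1 (mulmx^~ c)); rewrite -mulmxA bc mulmx1 mulNmx mul_scalar_mx => e.
have -> : c = - (h`_0)^-1 *: horner_mx b' g by rewrite e scalerN scaleNr opprK scalerA mulVf ?scale1r.
apply: (Z); elim/poly_ind: (g) => [|p a IH].
  by rewrite rmorph0 -(scale0r 1%:M); apply: Z.
rewrite rmorphD rmorphM /= horner_mx_X horner_mx_C; apply: D; first exact: hb.
by rewrite -scalemx1; apply: Z.
Qed.

(** A substitute for Fitting's lemma: [b c] is an idempotent of the same rank as [b]. Write the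
    characteristic polynomial as [X^k q] with [q(0)] nonzero. The kernel of [b] does not grow under
    further powers, so [b q(b) = 0], and [c] is [(q(0) - q) / (q(0) X)] evaluated at [b]. *)
Lemma mx_group_inverse : Q b -> (forall v : 'rV[K]_N, v *m b *m b = 0 -> v *m b = 0) ->
  exists c, [/\ Q (b *m c), b *m c = c *m b & b *m b *m c = b].
Proof.
move=> Qb0 kb.
suff [c [cb Qc e]] : exists c, [/\ b *m c = c *m b, Q (b *m c) & b *m b *m c = b] by exists c.
case: N b Q QD QZ Qb Qb0 kb => [|n] b' Q' D Z hb Q0 kb.
  exists 0; split; try by rewrite [LHS]flatmx0 [RHS]flatmx0.
  by rewrite [X in Q' X]flatmx0 -(flatmx0 b').
have kbn k (x : 'M_n.+1) : x *m b' *m b' ^+ k = 0 -> x *m b' = 0.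
  elim: k => [|k IH] in x *; first by rewrite expr0 mulmx1.
  rewrite exprS -mulmxE mulmxA => /IH h.
  apply/row_matrixP => i; rewrite row_mul row0; apply: kb.
  by rewrite -!row_mul h row0.
have hP p : Q' (b' *m horner_mx b' p).
  elim/poly_ind: p => [|p a IH]; first by rewrite rmorph0 mulmx0 -(scale0r b'); apply: Z.
  rewrite rmorphD rmorphM /= horner_mx_X horner_mx_C mulmxDr mulmxA; apply: D; first exact: hb.
  by rewrite -scalemx1 -scalemxAr mulmx1; apply: Z.
have [k [q q0 hE]] := multiplicity_XsubC (char_poly b') 0.
rewrite monic_neq0 ?char_poly_monic //= in q0.
have comm p : b' *m horner_mx b' p = horner_mx b' p *m b'.
  by rewrite !mulmxE -[X in X * _](horner_mx_X b') -[X in _ = _ * X](horner_mx_X b') -!rmorphM mulrC.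
have bq : b' *m horner_mx b' q = 0.
  rewrite comm; apply: (kbn k); rewrite !mulmxE -mulrA -exprS exprSr mulrA.
  have := Cayley_Hamilton b'; rewrite hE subr0 rmorphM /= rmorphXn /= horner_mx_X => h.
  by rewrite h mul0r.
pose g := drop_poly 1 q.
have qE : q = g * 'X + (q`_0)%:P.
  rewrite -[LHS](poly_take_drop 1) expr1 addrC; congr (_ + _).
  by apply/polyP => i; rewrite coef_take_poly coefC; case: i.
have q00 : q`_0 != 0 by rewrite -horner_coef0.
exists (- (q`_0)^-1 *: horner_mx b' g); split.
- by rewrite -scalemxAr comm scalemxAl.
- by rewrite -scalemxAr; apply: Z.
- suff e : b' *m b' *m horner_mx b' g = - (q`_0 *: b').
    by rewrite -scalemxAr e scalerN scaleNr opprK scalerA mulVf ?scale1r.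
  apply/eqP; rewrite -addr_eq0 -mulmxA comm -mul_mx_scalar -mulmxDr.
  rewrite -(horner_mx_C b') mulmxE -[X in _ * (_ * X + _)](horner_mx_X b').
  by rewrite -rmorphM -rmorphD -qE; apply/eqP; exact: bq.
Qed.

End PolynomialsInMatrix.

(** * Incidence algebras: kernels and idempotents *)

(** Below, [le] relates only indices of one arm and contains the decreasing index order there. The
    algebra then contains every matrix that preserves the arms and is lower triangular on each, so
    echelon forms stay in it. *)
Definition incidence (K : fieldType) (N : nat) (le : rel 'I_N) (b : 'M[K]_N) : Prop :=
  forall s t, ~~ le s t -> b s t = 0.

Section Incidence.
Variables (K : fieldType) (N : nat) (le : rel 'I_N) (arm : 'I_N -> nat).
Hypotheses (le_refl : reflexive le) (le_trans : transitive le).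
Hypothesis le_arm : forall s t, le s t -> arm s = arm t.
Hypothesis arm_le : forall s t : 'I_N, arm s = arm t -> (t <= s)%N -> le s t.
Local Notation inB := (@incidence K N le).
Local Notation P := (@coord_mx K N).
Implicit Types (b p e f : 'M[K]_N) (C : {set 'I_N}).

Lemma incD b (c : 'M[K]_N) : inB b -> inB c -> inB (b + c).
Proof. by move=> hb hc s t st; rewrite mxE hb // hc // addr0. Qed.

Lemma incZ a b : inB b -> inB (a *: b).
Proof. by move=> hb s t st; rewrite mxE hb // mulr0. Qed.

Lemma incN b : inB b -> inB (- b).
Proof. by move=> hb s t st; rewrite mxE hb // oppr0. Qed.

Lemma incB b (c : 'M[K]_N) : inB b -> inB c -> inB (b - c).
Proof. by move=> hb hc; apply/incD/incN. Qed.

Lemma incM b (c : 'M[K]_N) : inB b -> inB c -> inB (b *m c).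
Proof.
move=> hb hc s t st; rewrite mxE big1 // => k _.
have [sk|sk] := boolP (le s k); last by rewrite hb // mul0r.
have [kt|kt] := boolP (le k t); last by rewrite hc // mulr0.
by rewrite (le_trans sk kt) in st.
Qed.

Lemma inc_coord C : inB (P C).
Proof. by move=> s t st; rewrite mxE; case: eqP st => // ->; rewrite le_refl. Qed.

Lemma inc1 : inB 1%:M.
Proof. by rewrite -coord_mxT; apply: inc_coord. Qed.

Lemma inc_commute_arm C b :
  (forall s t, arm s = arm t -> (s \in C) = (t \in C)) -> inB b -> P C *m b = b *m P C.
Proof.
move=> hC hb; apply/matrixP => s t; rewrite mul_coord_mx mul_mx_coord.
have [st|st] := boolP (le s t); last by rewrite hb // !if_same.
by rewrite (hC s t) //; apply: le_arm.
Qed.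

Lemma inc_inv b (c : 'M[K]_N) : inB b -> b *m c = 1%:M -> inB c.
Proof.
move=> hb bc; apply: (mx_inv_closed (Q := inB) _ _ _ inc1 bc) => [x y|a x|x].
- exact: incD.
- exact: incZ.
- by move=> hx; apply: incM.
Qed.

(* The kernel of an element of the algebra is the row space of an idempotent in row echelon form: [C] is the set of pivots. *)
Lemma incidence_kernel p : inB p ->
  exists C f, [/\ inB f, P C *m f = f, f *m P C = P C, f *m p = 0
    & forall v : 'rV[K]_N, v *m p = 0 -> v *m f = v].
Proof.
move=> hp.
pose piv (c : 'I_N) (w : 'rV[K]_N) := [/\ w *m p = 0, w 0 c = 1
  & forall t, w 0 t != 0 -> arm t = arm c /\ (t <= c)%N].
pose C := [set i | `[< exists w, piv i w >]].
have CP i : reflect (exists w, piv i w) (i \in C) by rewrite inE; apply: asboolP.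
(* Pivots are cleared from the highest index down: subtracting a multiple of the vector with pivot
   [c0] changes no coordinate above [c0], so what is already cleared stays zero. *)
have red (c : 'I_N) : c \in C -> forall k, exists2 w, piv c w &
    forall c' : 'I_N, c' \in C -> c' != c -> (N <= c' + k)%N -> w 0 c' = 0.
  move=> /CP [w0 pw0]; elim => [|k [w [wp wc ws] IH]].
    by exists w0 => // c'; rewrite addn0 leqNgt ltn_ord.
  have [kN|] := ltnP k N; last first.
    by move=> Nk; exists w => // c' cC ne _; apply: IH => //; apply: leq_trans Nk (leq_addl _ _).
  have c0lt : (N - k.+1 < N)%N by rewrite ltn_subrL (leq_ltn_trans _ kN).
  pose c0 := Ordinal c0lt.
  have c0P (c' : 'I_N) : (N <= c' + k.+1)%N -> c' = c0 \/ (c0 < c')%N.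
    move=> h; have [e|ne] := eqVneq (c' : nat) c0; first by left; apply: val_inj.
    by right; move: ne => /=; lia.
  have c0P' (c' : 'I_N) : (c0 < c')%N -> (N <= c' + k)%N by rewrite /=; lia.
  have [/andP[c0C nc0]|] := boolP ((c0 \in C) && (c0 != c)); last first.
    rewrite negb_and negbK => h; exists w => // c' cC nc /c0P[e|/c0P']; last exact: IH.
    by move: h; rewrite -e cC (negPf nc).
  have [w00|w0n] := eqVneq (w 0 c0) 0.
    exists w => // c' cC nc /c0P[->//|/c0P']; exact: IH.
  have [ea lec] := ws _ w0n.
  have c0c : (c0 < c)%N by rewrite ltn_neqAle lec andbT -val_eqE in nc0 *.
  have /CP[u [up uc us]] := c0C.
  have ugt (t : 'I_N) : (c0 < t)%N -> u 0 t = 0.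
    by move=> h; apply/eqP; apply: contraTT h => /us[_]; rewrite -leqNgt.
  exists (w - w 0 c0 *: u); first split.
  - by rewrite mulmxBl wp -scalemxAl up scaler0 subr0.
  - by rewrite !mxE ugt // mulr0 subr0.
  - move=> t; rewrite !mxE; have [->|/ws[]//] := eqVneq (w 0 t) 0.
    rewrite sub0r oppr_eq0 mulf_eq0 (negPf w0n) /= => /us[-> le0].
    by split=> //; apply: leq_trans le0 (ltnW c0c).
  - move=> c' cC nc /c0P[->|lt0]; first by rewrite !mxE uc mulr1 subrr.
    by rewrite !mxE ugt // mulr0 subr0 IH // c0P'.
have [w wP] : exists w : 'I_N -> 'rV[K]_N, forall c : 'I_N, c \in C ->
    piv c (w c) /\ forall c', c' \in C -> c' != c -> w c 0 c' = 0.
  apply: (@fin_all_exists _ (fun _ => 'rV[K]_N)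
    (fun (c : 'I_N) w => c \in C -> piv c w /\ forall c', c' \in C -> c' != c -> w 0 c' = 0)) => c.
  have [cC|ncC] := boolP (c \in C); last by exists 0.
  have [w pw hw] := red _ cC N; exists w => _; split=> // c' c'C ne.
  by apply: hw => //; apply: leq_addl.
pose f : 'M[K]_N := \matrix_(i, j) if i \in C then w i 0 j else 0.
have fC : f *m P C = P C.
  apply/matrixP => i j; rewrite mul_mx_coord !mxE.
  have [iC|niC] := boolP (i \in C); last by rewrite andbF if_same.
  have [[_ w1 _] wn] := wP _ iC; rewrite andbT.
  have [<-|ne] := eqVneq i j; first by rewrite iC w1.
  by case: ifP => // jC; rewrite wn // eq_sym.
exists C, f; split=> //.
- move=> s t st; rewrite mxE; case: ifP => // sC; have [[_ _ ws] _] := wP _ sC.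
  by apply/eqP; apply: contraNT st => /ws[e h]; apply: arm_le.
- by apply/matrixP => i j; rewrite mul_coord_mx !mxE; case: (i \in C).
- apply/row_matrixP => i; rewrite row_mul row0.
  have -> : row i f = if i \in C then w i else 0.
    by apply/rowP => j; rewrite !mxE; case: ifP => //; rewrite mxE.
  by case: ifP => [/wP[[]]//|_]; rewrite mul0mx.
- have fp : f *m p = 0.
    apply/row_matrixP => i; rewrite row_mul row0.
    have -> : row i f = if i \in C then w i else 0.
      by apply/rowP => j; rewrite !mxE; case: ifP => //; rewrite mxE.
    by case: ifP => [/wP[[]]//|_]; rewrite mul0mx.
  move=> v vp; apply/eqP; rewrite eq_sym -subr_eq0; set v' := v - _.
  have v'p : v' *m p = 0 by rewrite mulmxBl vp -mulmxA fp mulmx0 subr0.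
  have v'C : v' *m P C = 0 by rewrite mulmxBl -mulmxA fC subrr.
  apply/eqP/rowP => s0; rewrite [RHS]mxE; apply/eqP; apply: contraT => ns0.
  (* Take the last nonzero coordinate of [v']. The part of [v'] in its arm, rescaled, shows that
     this coordinate is a pivot, but [v'] vanishes on all pivots. *)
  case: (@arg_maxnP _ s0 (fun s => v' 0 s != 0) (fun s => s : nat) ns0) => s ns smax.
  have sC : s \in C.
    apply/CP; pose Q := [set t | arm t == arm s].
    exists ((v' 0 s)^-1 *: (v' *m P Q)); split.
    + rewrite -scalemxAl -mulmxA (@inc_commute_arm Q) ?mulmxA ?v'p ?mul0mx ?scaler0 //.
      by move=> t t' e; rewrite !inE e.
    + by rewrite mxE mul_mx_coord inE eqxx mulVf.
    + move=> t; rewrite mxE mul_mx_coord inE.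
      have [->|_] := eqVneq (arm t) (arm s); last by rewrite mulr0 eqxx.
      by rewrite mulf_eq0 negb_or => /andP[_ /smax].
  by have := congr1 (fun x : 'rV_N => x 0 s) v'C; rewrite mul_mx_coord sC [RHS]mxE => e; rewrite e eqxx in ns.
Qed.

(** The echelon idempotent [f] with the row space of [e] links [e] to a coordinate projection:
    [e f = e] and [f e = f], while [f P C = P C] and [P C f = f]. In either pair the difference has
    square zero, so 1 plus the difference is a unit, and it conjugates one idempotent into the
    other. *)
Lemma incidence_idempotent C0 (e : 'M[K]_N) : inB e -> e *m e = e ->
    P C0 *m e = e -> e *m P C0 = e ->
  exists C u v, [/\ inB u /\ inB v, u *m v = 1%:M /\ v *m u = 1%:M,
    P C0 *m u = u *m P C0, u *m e *m v = P C & C \subset C0].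
Proof.
set D := P C0 => he ee De eD.
have [C [f [hf Cf fC fk kf]]] := incidence_kernel (incB inc1 he).
have fe : f *m e = f by apply/eqP; rewrite eq_sym -subr_eq0 -{1}[f]mulmx1 -mulmxBr fk.
have ef : e *m f = e.
  apply/row_matrixP => i; rewrite row_mul kf //.
  by rewrite -row_mul mulmxBr mulmx1 ee subrr row0.
have ff : f *m f = f by rewrite -{2}Cf mulmxA fC.
have fD : f *m D = f by rewrite -fe -mulmxA eD.
have DC : D *m P C = P C *m D by rewrite !coord_mxM setIC.
have CD : P C *m D = P C by rewrite -{1}fC -mulmxA -DC mulmxA fD fC.
have Df : D *m f = f by rewrite -Cf mulmxA DC CD.
pose u := 1%:M + (f - P C); pose u' := 1%:M - (f - P C).
pose g := 1%:M + (f - e); pose g' := 1%:M - (f - e).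
have sq (x : 'M[K]_N) : x *m x = 0 ->
    (1%:M + x) *m (1%:M - x) = 1%:M /\ (1%:M - x) *m (1%:M + x) = 1%:M.
  move=> xx; rewrite !mulmxDl !mulmxBr !mulmxDr !mulNmx !mulmx1 !mul1mx xx.
  by split; rewrite ?subr0 ?addr0 ?addrK ?subrK.
have [uu' u'u] : u *m u' = 1%:M /\ u' *m u = 1%:M.
  apply: sq; rewrite mulmxBl !mulmxBr ff fC Cf coord_mxM setIid.
  by rewrite subrr.
have [gg' g'g] : g *m g' = 1%:M /\ g' *m g = 1%:M.
  apply: sq; rewrite mulmxBl !mulmxBr ff fe ef ee.
  by rewrite !subrr.
have hn : inB (f - P C) by apply/incB/inc_coord.
have hn' : inB (f - e) by apply/incB.
exists C, (u *m g), (g' *m u'); split.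
- by split; apply: incM; first [apply: incD => //; apply: inc1 | apply: incB => //; apply: inc1].
- by split; [rewrite mulmxA -(mulmxA u) gg' mulmx1 | rewrite mulmxA -(mulmxA g') u'u mulmx1].
- rewrite mulmxA [D *m u](_ : _ = u *m D); last first.
    by rewrite mulmxDr mulmxDl mulmxBr mulmxBl mulmx1 mul1mx fD Df DC.
  rewrite -!mulmxA; congr (_ *m _).
  by rewrite mulmxDr mulmxDl mulmxBr mulmxBl mulmx1 mul1mx fD Df De eD.
- have ge : g *m e = f *m g.
    rewrite mulmxDl mulmxDr mulmxBl mulmxBr mulmx1 mul1mx fe ff ee.
    by rewrite subrr addr0 addrCA subrr addr0.
  have uf : u *m f = P C *m u.
    rewrite mulmxDl mulmxDr mulmxBl mulmxBr mulmx1 mul1mx Cf ff coord_mxM setIid.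
    by rewrite subrr addr0 addrCA subrr addr0.
  rewrite -!mulmxA [g *m _]mulmxA ge -!mulmxA [g *m _]mulmxA gg' mul1mx mulmxA uf.
  by rewrite -mulmxA uu' mulmx1.
- apply/fintype.subsetP => i iC; have := congr1 (fun x : 'M_N => x i i) CD.
  rewrite mul_mx_coord !mxE eqxx iC /=; case: ifP => // _ /eqP.
  by rewrite eq_sym oner_eq0.
Qed.
End Incidence.

(** * Rigidity of bricks and of indecomposable objects *)

Section Support.
Variables (K : fieldType) (m n : nat).

Definition supp_mx (A : {set 'I_m * 'I_n}) : {vspace 'M[K]_(m, n)} :=
  <<[seq delta_mx x.1 x.2 | x <- enum A]>>%VS.

Lemma supp_mxP (A : {set 'I_m * 'I_n}) (z : 'M[K]_(m, n)) :
  reflect (forall s t, (s, t) \notin A -> z s t = 0) (z \in supp_mx A).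
Proof.
apply: (iffP idP) => [/coord_span -> s t stA|h].
  rewrite summxE big1 // => i _; rewrite mxE.
  have hi : (i < size [seq delta_mx x.1 x.2 : 'M[K]_(m, n) | x <- enum A])%N by rewrite size_map -cardE.
  have /mapP[[s' t'] /=] := mem_nth 0 hi.
  rewrite mem_enum => xA ->; rewrite mxE.
  have [es|_] := eqVneq s s'; last by rewrite mulr0.
  have [et|_] := eqVneq t t'; last by rewrite mulr0.
  by rewrite es et xA in stA.
rewrite (matrix_sum_delta z); apply: memv_suml => s _; apply: memv_suml => t _.
have [stA|stA] := boolP ((s, t) \in A); last by rewrite h // scale0r mem0v.
by apply/memvZ/memv_span/mapP; exists (s, t); rewrite ?mem_enum.
Qed.

Lemma dim_supp_mx A : \dim (supp_mx A) = #|A|.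
Proof.
rewrite /supp_mx; set X := map _ _.
have sX : size X = #|A| by rewrite size_map -cardE.
suff fX : free X by rewrite -sX; apply/eqP.
rewrite -[X]/(tval (in_tuple X)); apply/freeP => k hk i.
have inj : injective (fun x : 'I_m * 'I_n => delta_mx x.1 x.2 : 'M[K]_(m, n)).
  move=> [s t] [s' t'] /= /matrixP/(_ s t); rewrite !mxE !eqxx /=.
  have [<-|_] := eqVneq s s'; last by move/eqP; rewrite oner_eq0.
  by have [<-|_] := eqVneq t t'; last by move/eqP; rewrite oner_eq0.
have Xu : uniq X by rewrite map_inj_uniq // enum_uniq.
have /mapP[[s t] _ /= ei] := mem_nth 0 (ltn_ord i).
have := congr1 (fun x : 'M_(m, n) => x s t) hk; rewrite /= summxE mxE (bigD1 i) //= mxE ei mxE !eqxx mulr1.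
rewrite big1 ?addr0 // => j nj; have /mapP[[s' t'] _ /= ej] := mem_nth 0 (ltn_ord j).
rewrite mxE ej mxE; have [es|_] := eqVneq s s'; last by rewrite mulr0.
have [et|_] := eqVneq t t'; last by rewrite mulr0.
case/eqP: nj; apply: val_inj; apply/eqP.
by rewrite -(nth_uniq 0 _ _ Xu) ?ltn_ord // ei ej es et.
Qed.

End Support.

Lemma mulmx_kernel_factor (F : fieldType) n p q (A : 'M[F]_(n, p)) (B : 'M[F]_(n, q)) :
  kermx A *m B = 0 -> A *m (pinvmx A *m B) = B.
Proof.
move=> kB; have /submxP[x xE] : (1%:M - A *m pinvmx A <= kermx A)%MS.
  by apply/sub_kermxP; rewrite mulmxBl mul1mx mulmxKpV // subrr.
apply/eqP; rewrite eq_sym -subr_eq0 mulmxA -{1}[B]mul1mx -mulmxBl xE -mulmxA kB.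
by rewrite mulmx0.
Qed.

Section Rigid.
Variables (K : closedFieldType) (N : nat) (le : rel 'I_N) (arm : 'I_N -> nat).
Hypotheses (le_refl : reflexive le) (le_trans : transitive le).
Hypothesis le_arm : forall s t, le s t -> arm s = arm t.
Hypothesis arm_le : forall s t : 'I_N, arm s = arm t -> (t <= s)%N -> le s t.
Variable U : {set 'I_N}.
Hypothesis armU : forall s t, arm s = arm t -> (s \in U) = (t \in U).
Local Notation inB := (@incidence K N le).
Local Notation P := (@coord_mx K N).

Definition le_pairs (C : {set 'I_N}) : {set 'I_N * 'I_N} :=
  [set x | [&& x.1 \in C, x.2 \in C & le x.1 x.2]].

Variable d2 : nat.
(* Positivity of the Tits form, restricted to the dimension vectors [C] that fit under [(d1, d2)]. *)
Hypothesis tits : forall C, C != set0 -> (#|C :\: U| <= #|C :&: U| + d2)%N ->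
  (#|C :&: U| * #|C :\: U| < #|le_pairs C|)%N.

(* The index set [C] plays the role of the dimension vector; a general object is, up to equivalence, supported on coordinates. *)
Definition mx_object (C : {set 'I_N}) (m : 'M[K]_N) : Prop :=
  m = P (C :&: U) *m m *m P (C :\: U) /\
  forall u : 'rV_N, u *m P (C :&: U) = u -> u *m m = 0 -> u = 0.

Definition endo (m e b : 'M[K]_N) : Prop :=
  [/\ inB b, e *m b = b, b *m e = b & e *m m *m b = b *m m].

Definition indecomposable (m e : 'M[K]_N) : Prop :=
  forall b, endo m e b -> b *m b = b -> b = 0 \/ b = e.

(* The orbit map of the unit group at [e m e] is a submersion. *)
Definition rigid (C : {set 'I_N}) (m e : 'M[K]_N) : Prop :=
  forall z, z = P (C :&: U) *m z *m P (C :\: U) -> e *m z *m e = z ->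
  exists b, [/\ inB b, e *m b = b, b *m e = b & z = e *m m *m b - b *m m].

Variables (C : {set 'I_N}) (m : 'M[K]_N).
Hypothesis C_d2 : (#|C :\: U| <= #|C :&: U| + d2)%N.
Hypothesis m_obj : mx_object C m.

(* [e] is the projection onto a direct summand, or more generally onto a subobject: the relation [e m e = e m] says that the image of [e] is stable, and the last clause saturates it in the [U]-part. *)
Definition subobject (e : 'M[K]_N) : Prop :=
  [/\ inB e, e *m e = e, P C *m e = e /\ e *m P C = e, e *m m *m e = e *m m
    & forall u : 'rV_N, u *m P (C :&: U) = u -> u *m m *m e = u *m m -> u *m e = u].

Let U0 := C :&: U.
Let V0 := C :\: U.

Lemma inc_commute_U b : inB b -> P U *m b = b *m P U /\ P (~: U) *m b = b *m P (~: U).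
Proof.
move=> hb; split; apply: (inc_commute_arm le_arm _ hb) => s t st; first exact: armU.
by rewrite !inE (armU st).
Qed.

Lemma corner_commute b : inB b -> P C *m b = b -> b *m P C = b ->
  P U0 *m b = b *m P U0 /\ P V0 *m b = b *m P V0.
Proof.
move=> hb Cb bC; have [cU cV] := inc_commute_U hb.
have cap (W : {set 'I_N}) : P W *m b = b *m P W -> P (C :&: W) *m b = b *m P (C :&: W).
  move=> cW; rewrite -{2}coord_mxM mulmxA bC setIC -coord_mxM -mulmxA Cb.
  exact: cW.
by split; [apply: cap | rewrite /V0 setDE; apply: cap].
Qed.

(** Saturation says that a row vector of the image of [e] that lies in the image of [m] already
    comes from the [U]-part of [e]. So the cokernel of the subobject embeds into the cokernel of
    [m], whose dimension is [|V0| - |U0|], at most [d2]. *)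
Lemma subobject_rank e : subobject e ->
  (\rank (e *m P (~: U)) <= \rank (e *m P U) + d2)%N.
Proof.
move=> [he ee [Ce eC] eme sat].
have [cU cV] := inc_commute_U he.
have [mE inj] := m_obj; rewrite -/U0 in inj.
have rU : \rank (P U0 *m m) = #|U0|.
  rewrite -(rank_coord_mx K U0); apply/mxrank_injP/eqP/row_matrixP => i.
  rewrite row0; apply: inj; last first.
    have : (row i (P U0 :&: kermx m)%MS <= kermx m)%MS.
      by apply: submx_trans (row_sub _ _) (capmxSr _ _).
    by move/sub_kermxP.
  have /submxP[w ->] : (row i (P U0 :&: kermx m)%MS <= P U0)%MS.
    by apply: submx_trans (row_sub _ _) (capmxSl _ _).
  by rewrite -mulmxA coord_mxM setIid.
set X := e *m P (~: U); set Y := P U0 *m m.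
have XV : (X <= P V0)%MS.
  by rewrite /X -eC -mulmxA coord_mxM -setDE submxMl.
have YV : (Y <= P V0)%MS by rewrite /Y mE !mulmxA submxMl.
have capXY : (X :&: Y <= e *m P U *m m)%MS.
  apply/rV_subP => v; rewrite sub_capmx => /andP[/submxP[x vx] /submxP[y vy]].
  pose u := y *m P U0.
  have uU : u *m P U0 = u by rewrite /u -mulmxA coord_mxM setIid.
  have vu : v = u *m m by rewrite vy mulmxA.
  have ve : v *m e = v by rewrite vx /X -cV -!mulmxA ee.
  have ue : u *m e = u by apply: sat => //; rewrite -vu.
  have -> : v = u *m (e *m P U *m m).
    rewrite -cU !mulmxA -[u *m P U](_ : u = _) ?ue //.
    by rewrite /u -mulmxA coord_mxM -setIA setIid.
  exact: submxMl.
have := mxrank_sum_cap X Y; rewrite rU.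
have := mxrankS capXY; have := mxrankM_maxl (e *m P U) m.
have : (\rank (X + Y)%MS <= #|V0|)%N.
  by rewrite -(rank_coord_mx K V0); apply: mxrankS; rewrite addsmx_sub XV.
move=> h1 h2 h3 h4; rewrite -(leq_add2r #|U0|) -h4.
apply: leq_trans (leq_add h1 (leq_trans h3 h2)) _.
by rewrite addnC -addnA leq_add2l addnC.
Qed.

(** A dimension count for [b -> e m b - b m] on the corner of [e]. Its kernel consists of
    endomorphisms, here a line, and positivity of the form makes the source larger than the target,
    so the map is onto. Conjugating [e] to a coordinate projection turns both dimensions into
    numbers of pairs of indices. *)
Lemma brick_rigid e : subobject e -> e != 0 ->
  (forall b, endo m e b -> exists c, b = c *: e) -> rigid C m e.
Proof.
move=> se e0 brick z zE eze.
have [he ee [Ce eC] eme _] := se.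
have [C' [u [v [[hu hv] [uv vu] cu ue sC']]]] :=
  incidence_idempotent le_refl le_trans le_arm arm_le he ee Ce eC.
have eE : e = v *m P C' *m u by rewrite -ue -!mulmxA vu mulmx1 !mulmxA vu mul1mx.
have [uU uV] := inc_commute_U hu; have [vU vV] := inc_commute_U hv.
have rk A : P A *m u = u *m P A -> \rank (e *m P A) = #|C' :&: A|.
  move=> cA; rewrite -(rank_coord_mx K) -coord_mxM eE.
  have uf : row_free u by apply/row_freeP; exists v.
  have vf : row_full v by apply/row_fullP; exists u.
  by rewrite -(mulmxA (v *m P C')) -cA !mulmxA mxrankMfree // -mulmxA (eqmxMfull _ vf).
have C'0 : C' != set0.
  by apply: contra_neq e0 => C'0; rewrite eE C'0 coord_mx0 mulmx0 mul0mx.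
have hq : (#|C' :&: U| * #|C' :\: U| < #|le_pairs C'|)%N.
  by apply: tits => //; rewrite setDE -!rk //; apply: subobject_rank.
pose S : 'End('M[K]_N) := linfun (mulmxr u \o mulmx v).
pose f : 'End('M[K]_N) := linfun (mulmx (e *m m)) - linfun (mulmxr m).
have SE x : S x = v *m x *m u by rewrite lfunE.
have fE x : f x = e *m m *m x - x *m m by rewrite add_lfunE opp_lfunE !lfunE.
have S0 : (lker S == 0)%VS.
  apply/lker0P => x y; rewrite !SE => /(congr1 (fun w => u *m w *m v)).
  by rewrite !mulmxA uv !mul1mx -!mulmxA uv !mulmx1.
have dS W : \dim (S @: W) = \dim W by apply: limg_dim_eq; rewrite (eqP S0) capv0.
pose WB := (S @: supp_mx K (le_pairs C'))%VS.
pose WE := (S @: supp_mx K (finset.setX (C' :&: U) (C' :\: U)))%VS.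
have WBP b : b \in WB -> [/\ inB b, e *m b = b & b *m e = b].
  move=> /memv_imgP[x /supp_mxP xs ->]; rewrite SE.
  have hx : inB x by move=> s t /negPf st; apply: xs; rewrite inE /= st !andbF.
  have xC : P C' *m x = x.
    apply/matrixP => s t; rewrite mul_coord_mx; case: ifPn => // sC.
    by rewrite xs // inE /= (negPf sC).
  have Cx : x *m P C' = x.
    apply/matrixP => s t; rewrite mul_mx_coord; case: ifPn => // tC.
    by rewrite xs // inE /= (negPf tC) andbF.
  split; first by do 2!apply: (incM le_trans) => //.
    by rewrite eE -!mulmxA (mulmxA u) uv mul1mx (mulmxA (P C')) xC.
  by rewrite eE !mulmxA -[v *m x *m u *m v]mulmxA uv mulmx1 -[v *m x *m P C']mulmxA Cx.
have WEP y : y = P U0 *m y *m P V0 -> e *m y *m e = y -> y \in WE.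
  move=> yE eye; apply/memv_imgP; exists (u *m y *m v); last first.
    by rewrite SE !mulmxA vu mul1mx -mulmxA vu mulmx1.
  have y1 : u *m y *m v = P C' *m (u *m y *m v) *m P C'.
    by rewrite -ue -{1}eye !mulmxA -!(mulmxA _ v u) vu !mulmx1.
  have y2 : u *m y *m v = P U *m (u *m y *m v) *m P (~: U).
    have yU : P U *m y = y by rewrite yE !mulmxA coord_mxM /U0 setIC -setIA setIid.
    have yV : y *m P (~: U) = y.
      by rewrite yE -!mulmxA coord_mxM /V0 setDE -setIA setIid.
    by rewrite !mulmxA uU -!mulmxA -vV (mulmxA y) yV (mulmxA (P U)) yU.
  apply/supp_mxP => s t; rewrite inE /= !inE => st.
  have [/andP[sC tC]|] := boolP ((s \in C') && (t \in C')).
    rewrite sC tC /= !andbT in st; rewrite y2 mul_mx_coord mul_coord_mx inE.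
    by move: st; case: (t \in U); case: (s \in U).
  rewrite negb_and y1 mul_mx_coord mul_coord_mx => /orP[/negPf->|/negPf->] //.
  by rewrite if_same.
have fWB : (f @: WB <= WE)%VS.
  apply/subvP => _ /memv_imgP[b /WBP[hb eb be] ->]; rewrite fE.
  have [mE _] := m_obj.
  have [eU eV] := corner_commute he Ce eC.
  have [bU bV] : P U0 *m b = b *m P U0 /\ P V0 *m b = b *m P V0.
    by apply: corner_commute => //; [rewrite -eb mulmxA Ce eb|rewrite -be -mulmxA eC be].
  apply: WEP.
    rewrite mulmxBr mulmxBl {1 2}mE; congr (_ - _); last first.
      by rewrite !mulmxA bU -!mulmxA.
    by rewrite !mulmxA eU -!mulmxA bV.
  rewrite mulmxBr mulmxBl !mulmxA ee -(mulmxA _ b e) be; congr (_ - _).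
  by rewrite eb -be -!mulmxA (mulmxA e) eme.
have kerf : (WB :&: lker f <= <[e]>)%VS.
  apply/subvP => b; rewrite memv_cap memv_ker fE subr_eq0 => /andP[/WBP[hb eb be] /eqP bm].
  by apply/vlineP; apply: brick; split.
have eqW : (f @: WB == WE)%VS.
  rewrite eqEdim fWB /=; have := limg_ker_dim f WB.
  have := dimvS kerf; rewrite dim_vline e0 !dS !dim_supp_mx cardsX.
  by move=> h1 h2; rewrite -ltnS (leq_trans hq) // -h2 -add1n leq_add2r.
have : z \in (f @: WB)%VS by rewrite (eqP eqW); apply: WEP.
by case/memv_imgP => b /WBP[hb eb be] zb; exists b; split=> //; rewrite zb fE.
Qed.

Lemma endoD e a b : endo m e a -> endo m e b -> endo m e (a + b).
Proof.
move=> [ha ea ae am] [hb eb be bm]; split; first exact: incD.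
- by rewrite mulmxDr ea eb.
- by rewrite mulmxDl ae be.
- by rewrite mulmxDr mulmxDl am bm.
Qed.

Lemma endoZ e k b : endo m e b -> endo m e (k *: b).
Proof.
move=> [hb eb be bm]; split; first exact: incZ.
- by rewrite -scalemxAr eb.
- by rewrite -scalemxAl be.
- by rewrite -scalemxAr -scalemxAl bm.
Qed.

Lemma endoM e a b : endo m e a -> endo m e b -> endo m e (a *m b).
Proof.
move=> [ha ea ae am] [hb eb be bm]; split; first exact: incM.
- by rewrite mulmxA ea.
- by rewrite -mulmxA be.
- by rewrite mulmxA am -(mulmxA a b) -bm !mulmxA ae.
Qed.

Lemma endo_id e : subobject e -> endo m e e.
Proof. by case=> he ee _ eme _; split. Qed.

(** The eigenvector is taken inside the row space of [e], so that [b - c e] has smaller rank than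
    [e]. *)
Lemma endo_eigenvector e b : e != 0 -> e *m e = e -> e *m b = b -> b *m e = b ->
  exists c, exists2 v : 'rV[K]_N, v != 0 & v *m e = v /\ v *m b = c *: v.
Proof.
move=> e0 ee eb be; pose R := row_base e; pose b' := R *m b *m pinvmx R.
have Rb : R *m b = b' *m R.
  rewrite mulmxKpV // -be mulmxA (submx_trans (submxMl _ _)) //.
  by rewrite (eq_row_base e).
have Re : R *m e = R.
  have /submxP[x xE] : (R <= e)%MS by rewrite (eq_row_base e).
  by rewrite xE -mulmxA ee.
have /closed_rootP[c cP] : size (char_poly b') != 1 by rewrite size_char_poly eqSS mxrank_eq0.
have /eigenvalueP[w wb w0] : eigenvalue b' c by rewrite eigenvalue_root_char.
exists c, (w *m R); first by rewrite mulmx_free_eq0 ?row_base_free.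
by split; [rewrite -mulmxA Re | rewrite -(mulmxA w) Rb (mulmxA w) wb scalemxAl].
Qed.

(* Ringel's argument: a nonzero endomorphism [phi] of minimal rank that is not invertible has square zero, so its image embeds into an indecomposable summand [g] of its kernel. As [g] is rigid by induction, the inclusion of [g] splits, which contradicts indecomposability. *)
Lemma indecomposable_rigid e : subobject e -> e != 0 -> indecomposable m e -> rigid C m e.
Proof.
have [n] := ubnP (\rank e); elim: n e => // n IH e; rewrite ltnS => re se e0 ind.
apply: brick_rigid => // b hb; apply: contrapT => nb.
have [he ee [Ce eC] eme sat] := se.
have [k hk kmin] : exists2 k, exists phi, [/\ endo m e phi, phi != 0,
    (\rank phi < \rank e)%N & \rank phi = k] &
    forall psi, endo m e psi -> psi != 0 -> (\rank psi < \rank e)%N -> (k <= \rank psi)%N.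
  pose Q k := `[< exists phi, [/\ endo m e phi, phi != 0,
    (\rank phi < \rank e)%N & \rank phi = k] >].
  have exQ : exists k, Q k.
    have [_ eb be _] := hb.
    (* Subtracting an eigenvalue from an endomorphism that is not a multiple of [e] leaves a nonzero
       one that kills a vector of the image of [e]. *)
    have [c [v v0 [ve vb]]] := endo_eigenvector e0 ee eb be.
    have h : endo m e (b - c *: e).
      by rewrite -scaleNr; apply: endoD => //; apply/endoZ/endo_id.
    exists (\rank (b - c *: e)); apply/asboolP; exists (b - c *: e); split=> //.
      by apply/eqP => /eqP; rewrite subr_eq0 => /eqP bE; apply: nb; exists c.
    have [_ eh _ _] := h; rewrite -{1}eh -(mxrank_mul_ker e (b - c *: e)).
    rewrite -[ltnLHS]addn0 ltn_add2l lt0n mxrank_eq0; apply: contraNneq v0 => cap0.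
    have : (v <= e :&: kermx (b - c *: e))%MS.
      rewrite sub_capmx -{1}ve submxMl; apply/sub_kermxP.
      by rewrite mulmxBr vb -scalemxAr ve subrr.
    by rewrite cap0 submx0.
  case: (ex_minnP exQ) => k /asboolP hk kmin; exists k => // psi h1 h2 h3.
  by apply: kmin; apply/asboolP; exists psi.
have [phi [hphi phi0 rphi kE]] := hk; rewrite -{}kE {k hk} in kmin.
have [iphi ephi phie phim] := hphi.
(* If the square were nonzero, minimality would give it the rank of [phi]; the group inverse would
   then yield an idempotent endomorphism of that rank, neither 0 nor [e]. *)
have phi2 : phi *m phi = 0.
  apply/eqP; apply: contraT => pp0.
  have rpp : \rank (phi *m phi) = \rank phi.
    apply/eqP; rewrite eqn_leq mxrankM_maxl kmin //; first exact: endoM.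
    exact: leq_ltn_trans (mxrankM_maxl _ _) rphi.
  have ker (v : 'rV[K]_N) : v *m phi *m phi = 0 -> v *m phi = 0.
    move/mxrank_injP: rpp => /eqP cap0 /sub_kermxP vk.
    by apply/eqP; rewrite -submx0 -cap0 sub_capmx submxMl.
  have [c [hc cc ppc]] := mx_group_inverse (@endoD e) (@endoZ e)
    (fun x hx => endoM hx hphi) hphi ker.
  case: (ind _ hc) => [|pc0|pce].
  - by rewrite -(mulmxA phi c) (mulmxA c phi) -cc !mulmxA ppc.
  - by move: phi0; rewrite -ppc -mulmxA pc0 mulmx0 eqxx.
  - by move: rphi; rewrite ltnNge -pce mxrankM_maxl.
(* Adding [1 - e] removes the complement of [e] from the kernel: [f0] becomes an idempotent onto the
   kernel of [phi] inside the image of [e]. *)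
have hp : inB (phi + (1%:M - e)).
  by apply: incD => //; apply: incB => //; apply: inc1.
have [_ [f0 [if0 _ _ f0p f0k]]] := incidence_kernel le_arm arm_le hp.
have phi_f0 : f0 *m phi = 0.
  move/(congr1 (mulmx^~ e)): f0p; rewrite mul0mx -mulmxA mulmxDl mulmxBl mul1mx ee.
  by rewrite subrr addr0 phie.
have f0e : f0 *m e = f0.
  move: f0p; rewrite mulmxDr phi_f0 add0r mulmxBr mulmx1 => /eqP.
  by rewrite subr_eq0 => /eqP.
have kf0 n' (x : 'M[K]_(n', N)) : x *m e = x -> x *m phi = 0 -> x *m f0 = x.
  move=> xe xp; apply/row_matrixP => i; rewrite row_mul f0k // -row_mul.
  by rewrite mulmxDr mulmxBr mulmx1 xe subrr xp addr0 row0.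
have f00 : f0 *m f0 = f0 by apply: kf0.
(* Multiplication by [e] moves [f0] into the corner of [e] without changing its row space. *)
pose f := e *m f0.
have hf : inB f by apply: incM.
have ef : e *m f = f by rewrite mulmxA ee.
have fe : f *m e = f by rewrite -mulmxA f0e.
have ff : f *m f = f by rewrite -{1}[f *m f]mulmxA (mulmxA f0) f0e f00.
have fphi : f *m phi = 0 by rewrite -mulmxA phi_f0 mulmx0.
have kf n' (x : 'M[K]_(n', N)) : x *m e = x -> x *m phi = 0 -> x *m f = x.
  by move=> xe xp; rewrite mulmxA xe kf0.
clearbody f.
have fm : f *m m *m f = f *m m.
  have eme' : f *m m *m e = f *m m by rewrite -fe -(mulmxA f e m) -(mulmxA f (e *m m)) eme.
  by apply: kf => //; rewrite -fe -(mulmxA f e m) -(mulmxA f (e *m m)) phim mulmxA fphi mul0mx.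
have pf : phi *m f = phi by apply: kf.
(* A summand [g] of the kernel of smallest rank on which [phi] projects nontrivially. In any
   splitting of [g] one part still receives a nonzero projection, so minimality makes [g]
   indecomposable. *)
have [k [g [hg pg0 gk gmin]]] : exists k g, [/\ endo m f g /\ g *m g = g, phi *m g != 0,
    \rank g = k & forall h, endo m f h -> h *m h = h -> phi *m h != 0 -> (k <= \rank h)%N].
  pose Q k := `[< exists g, [/\ endo m f g /\ g *m g = g, phi *m g != 0 & \rank g = k] >].
  have exQ : exists k, Q k.
    exists (\rank f); apply/asboolP; exists f; split; [|by rewrite pf|by []].
    by split; first split.
  case: (ex_minnP exQ) => k /asboolP [g [hg pg gk]] kmin'; exists k, g; split=> // h h1 h2 h3.
  by apply: kmin'; apply/asboolP; exists h.
have [[ig fg gf gm] gg] := hg.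
have eg : e *m g = g by rewrite -fg mulmxA ef.
have ge : g *m e = g by rewrite -gf -mulmxA fe.
have rfe : (\rank f < \rank e)%N.
  have : (\rank f + \rank phi <= \rank e)%N.
    have := mxrank_mul_ker e phi; rewrite ephi => <-; rewrite addnC leq_add2l mxrankS //.
    by rewrite sub_capmx -{1}fe submxMl; apply/sub_kermxP.
  by apply: leq_trans; rewrite -[ltnLHS]addn0 ltn_add2l lt0n mxrank_eq0.
have rge : (\rank g < \rank e)%N by rewrite (leq_ltn_trans _ rfe) // -gf mxrankM_maxr.
have gphi : g *m phi = 0 by rewrite -gf -mulmxA fphi mulmx0.
have comm_U x : inB x -> e *m x = x -> x *m e = x ->
    P U0 *m x = x *m P U0 /\ P V0 *m x = x *m P V0.
  move=> hx ex xe; apply: corner_commute => //; first by rewrite -ex mulmxA Ce ex.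
  by rewrite -xe -mulmxA eC.
have gmg : g *m m *m g = g *m m by rewrite -gm -mulmxA gg.
have sg : subobject g.
  split=> //.
  - split; first by rewrite -{1}eg mulmxA Ce eg.
    by rewrite -{1}ge -mulmxA eC ge.
  - move=> u uU ug; have [_ inj] := m_obj; rewrite -/U0 in inj uU.
    have ue : u *m e = u by apply: sat => //; rewrite -ug -mulmxA ge.
    have up : u *m phi = 0.
      apply: inj; first by rewrite -mulmxA -(comm_U phi _ _ _).1 // mulmxA uU.
      by rewrite -mulmxA -phim !mulmxA ue -ug -(mulmxA (u *m m)) gphi mulmx0.
    have uf : u *m f = u.
      exact: kf.
    apply/eqP; rewrite -subr_eq0; apply/eqP/inj.
      by rewrite mulmxBl -mulmxA -(comm_U g _ _ _).1 // mulmxA uU.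
    by rewrite mulmxBl -mulmxA -gm !mulmxA uf ug subrr.
have g0 : g != 0 by apply: contra_neq pg0 => ->; rewrite mulmx0.
have indg : indecomposable m g.
  move=> h hh h2; have [ih gh hg' hm] := hh.
  have hendo : endo m f h.
    split=> //; first by rewrite -gh mulmxA fg.
      by rewrite -hg' -mulmxA gf.
    by rewrite -hm -gm -(mulmxA _ g h) gh.
  have [->|h0] := eqVneq h 0; first by left.
  have [->|hng] := eqVneq h g; first by right.
  have g'g' : (g - h) *m (g - h) = g - h.
    by rewrite mulmxBr !mulmxBl gg hg' gh h2 subrr subr0.
  have g'endo : endo m f (g - h).
    by rewrite -scaleN1r; apply: endoD => //; apply: endoZ.
  have rk : (\rank g = \rank h + \rank (g - h)%R)%N.
    apply/eqP; rewrite eqn_leq; apply/andP; split.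
      have {1}-> : g = h + (g - h) by rewrite addrC subrK.
      exact: mxrank_add.
    have gE : (g :=: h + (g - h)%R)%MS.
      apply/eqmxP; rewrite addsmx_sub; apply/andP; split; last first.
        rewrite -{1}hg' submxMl /=.
        have -> : g - h = (1%:M - h) *m g by rewrite mulmxBl mul1mx hg'.
        exact: submxMl.
      have {1}-> : g = h + (g - h) by rewrite addrC subrK.
      exact: addmx_sub_adds.
    have cap0 : (h :&: (g - h)%R)%MS = 0.
      apply/eqP/rowV0P => v; rewrite sub_capmx => /andP[/submxP[x vx] /submxP[y vy]].
      have vh : v *m h = v by rewrite vx -mulmxA h2.
      by rewrite -vh vy -mulmxA mulmxBl h2 gh subrr mulmx0.
    by rewrite -mxrank_sum_cap cap0 mxrank0 addn0 gE.
  have small (x y : 'M[K]_N) : \rank g = (\rank x + \rank y)%N -> y != 0 -> (\rank x < \rank g)%N.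
    by move=> -> y0; rewrite -[ltnLHS]addn0 ltn_add2l lt0n mxrank_eq0.
  have [ph0|ph0] := eqVneq (phi *m h) 0.
    have : (k <= \rank (g - h)%R)%N.
      by apply: gmin => //; rewrite mulmxBr ph0 subr0.
    by rewrite -gk leqNgt (small _ h) // addnC.
  have := gmin h hendo h2 ph0.
  by rewrite -gk leqNgt (small _ (g - h)) // subr_eq0 eq_sym.
have rig : rigid C m g by apply: IH => //; apply: leq_trans rge re.
pose psi := phi *m g.
have hpsi : endo m e psi.
  split; first exact: incM.
  - by rewrite mulmxA ephi.
  - by rewrite -mulmxA ge.
  - by rewrite mulmxA phim -(mulmxA phi g) -gm !mulmxA pf.
have [ipsi epsi psie psim] := hpsi.
have rpsi : \rank psi = \rank phi.
  apply/eqP; rewrite eqn_leq mxrankM_maxl kmin //.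
  by apply: leq_ltn_trans rge; apply: mxrankM_maxr.
(* [del] measures the failure of the projection [g] to be an endomorphism of [e]. It vanishes on
   [f], which is the kernel of [psi] because [psi] and [phi] have equal rank, so it factors through
   [psi]. Rigidity of [g] makes the second factor a tangent direction, given by [b1], and
   [r := g - psi b1] is then an idempotent endomorphism of [e] with the image of [g]. *)
pose del := e *m m *m g - g *m m.
have fdel : f *m del = 0.
  by rewrite mulmxBr !mulmxA fe gm fg subrr.
have edel : e *m del = del by rewrite mulmxBr !mulmxA ee eg.
have delg : del *m g = del.
  by rewrite mulmxBl gmg -(mulmxA _ g g) gg.
have [z0 delE] : exists z0, del = psi *m z0.
  exists (pinvmx psi *m del); rewrite mulmx_kernel_factor //.
  have ker : (kermx psi <= kermx phi)%MS.
    have /mxrank_leqif_sup/geq_leqif <- : (kermx phi <= kermx psi)%MS.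
      by apply/sub_kermxP; rewrite mulmxA mulmx_ker mul0mx.
    by rewrite !mxrank_ker rpsi.
  set k0 := kermx psi in ker *.
  have kp : k0 *m e *m phi = 0 by rewrite -mulmxA ephi; apply/sub_kermxP.
  rewrite -edel mulmxA -(kf _ (k0 *m e)) // -?(mulmxA _ e e) ?ee //.
  by rewrite -(mulmxA _ f) fdel mulmx0.
have [mE _] := m_obj.
have delV : P U0 *m del *m P V0 = del.
  rewrite mulmxBr mulmxBl; congr (_ - _).
    rewrite -(mulmxA e) -!mulmxA (mulmxA (P U0)) (comm_U e _ _ _).1 // -mulmxA.
    by rewrite -(comm_U g _ _ _).2 // {2}mE !mulmxA.
  by rewrite (mulmxA (P U0)) (comm_U g _ _ _).1 // {2}mE !mulmxA.
(* The factor [z0] is cut down to the shape that rigidity of [g] requires; its product with [psi] is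
   still [del]. *)
pose z := P U0 *m (g *m z0 *m g) *m P V0.
have zU : z = P U0 *m z *m P V0.
  by rewrite /z !mulmxA coord_mxM setIid -!mulmxA coord_mxM setIid.
have gzg : g *m z *m g = z.
  have [gU gV] := comm_U g ig eg ge.
  rewrite /z (mulmxA g) (mulmxA g) -gU -(mulmxA _ (P V0) g) gV !mulmxA.
  by rewrite -(mulmxA (P U0) g g) gg -(mulmxA _ g g) gg.
have psig : psi *m g = psi by rewrite -mulmxA gg.
have fpsi : f *m psi = 0 by rewrite mulmxA fphi mul0mx.
have gpsi : g *m psi = 0 by rewrite mulmxA gphi mul0mx.
clearbody psi.
have psiz : psi *m z = del.
  have [pU _] := comm_U psi ipsi epsi psie.
  rewrite /z !(mulmxA psi) -pU -(mulmxA (P U0)) !(mulmxA psi) psig -delE delg.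
  exact: delV.
have [b1 [ib1 gb1 b1g zE]] := rig z zU gzg.
have eb1 : e *m b1 = b1 by rewrite -gb1 mulmxA eg.
have b1e : b1 *m e = b1 by rewrite -b1g -mulmxA ge.
have delE' : del = e *m m *m (psi *m b1) - psi *m b1 *m m.
  by rewrite -psiz zE mulmxBr !mulmxA psig psim.
pose r := g - psi *m b1.
have hr : inB r by apply: incB => //; apply: incM.
have fr : f *m r = g.
  by rewrite mulmxBr fg mulmxA fpsi mul0mx subr0.
have rg : r *m g = r by rewrite mulmxBl gg -mulmxA b1g.
have gr : g *m r = g by rewrite mulmxBr gg mulmxA gpsi mul0mx subr0.
have rr : r *m r = r by rewrite -{1}rg -mulmxA gr rg.
have rend : endo m e r.
  split=> //.
  - by rewrite mulmxBr eg mulmxA epsi.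
  - by rewrite mulmxBl ge -mulmxA b1e.
  - apply/eqP; rewrite -subr_eq0 mulmxBr mulmxBl opprB [psi *m b1 *m m - _]addrC addrACA.
    by rewrite -/del [X in _ + X]addrC -[X in _ + X]opprB -delE' subrr.
case: (ind _ rend rr) => [r0|rE].
  by move: g0; rewrite -gr r0 mulmx0 eqxx.
by move: rge; rewrite ltnNge -rE -rg mxrankM_maxr.
Qed.

End Rigid.

(** * Equivalence of rigid objects and finiteness of the classes *)

Section Equivalence.
Variables (K : closedFieldType) (N : nat) (le : rel 'I_N) (arm : 'I_N -> nat).
Hypotheses (le_refl : reflexive le) (le_trans : transitive le).
Hypothesis le_arm : forall s t, le s t -> arm s = arm t.
Variable U : {set 'I_N}.
Hypothesis armU : forall s t, arm s = arm t -> (s \in U) = (t \in U).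
Local Notation inB := (@incidence K N le).
Local Notation P := (@coord_mx K N).

Definition mx_equiv (C : {set 'I_N}) (m m' : 'M[K]_N) : Prop :=
  exists b b', [/\ inB b /\ inB b', P C *m b = b /\ b *m P C = b,
    P C *m b' = b' /\ b' *m P C = b', b *m b' = P C /\ b' *m b = P C & b *m m = m' *m b].

Lemma mx_equiv_refl C m : P C *m m = m -> m *m P C = m -> mx_equiv C m m.
Proof.
move=> Cm mC; exists (P C), (P C); rewrite coord_mxM setIid Cm mC.
by split=> //; split; apply: inc_coord.
Qed.

Lemma mx_equiv_sym C m m' : P C *m m = m -> m' *m P C = m' -> mx_equiv C m m' -> mx_equiv C m' m.
Proof.
move=> Cm mC [b [b' [hb bC b'C [bb' b'b] bm]]]; exists b', b; split=> //; first by case: hb.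
by rewrite -mC -bb' (mulmxA m') -bm !mulmxA b'b Cm.
Qed.

Lemma mx_equiv_trans C m m' m'' : mx_equiv C m m' -> mx_equiv C m' m'' -> mx_equiv C m m''.
Proof.
move=> [b [b' [[hb hb'] [bC Cb] [b'C Cb'] [bb' b'b] bm]]].
move=> [a [a' [[ha ha'] [aC Ca] [a'C Ca'] [aa' a'a] am]]].
exists (a *m b), (b' *m a'); split.
- by split; apply: (incM le_trans).
- by rewrite mulmxA aC -mulmxA Cb.
- by rewrite mulmxA b'C -mulmxA Ca'.
- by rewrite !mulmxA -(mulmxA a) bb' Ca aa' -(mulmxA b') a'a Cb' b'b.
- by rewrite -mulmxA bm mulmxA am mulmxA.
Qed.

Section Line.
Variables (C : {set 'I_N}) (m m' : 'M[K]_N).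
Let U0 := C :&: U.
Let V0 := C :\: U.
Hypotheses (mE : m = P U0 *m m *m P V0) (mE' : m' = P U0 *m m' *m P V0).
Hypothesis rig : rigid le U C m (P C).

Let del := m' - m.
Let W := supp_mx K (le_pairs le C).

Lemma le_pairs_supp b : b \in W <-> [/\ inB b, P C *m b = b & b *m P C = b].
Proof.
split=> [/supp_mxP bs|[hb Cb bC]].
  split.
  - by move=> s t /negPf st; apply: bs; rewrite inE /= st !andbF.
  - apply/matrixP => s t; rewrite mul_coord_mx; case: ifPn => // sC.
    by rewrite bs // inE /= (negPf sC).
  - apply/matrixP => s t; rewrite mul_mx_coord; case: ifPn => // tC.
    by rewrite bs // inE /= (negPf tC) andbF.
apply/supp_mxP => s t; rewrite inE /= !negb_and => /or3P[sC|tC|/hb//].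
  by rewrite -Cb mul_coord_mx (negPf sC).
by rewrite -bC mul_mx_coord (negPf tC).
Qed.

(* A linear solution operator [z |-> b] of [z = m b - b m] turns [m b = b (m + t del)] into a linear system whose matrix [1 - t S] is invertible for almost all [t]; Cramer's rule makes the solution polynomial in [t]. *)
Lemma rigid_line : exists2 p : {poly K}, p != 0 &
  forall t, p.[t] != 0 -> mx_equiv C (m + t *: del) m.
Proof.
pose f : 'End('M[K]_N) := linfun (mulmx m) - linfun (mulmxr m).
have fE x : f x = m *m x - x *m m by rewrite add_lfunE opp_lfunE !lfunE.
(* [S] is a linear section of [b -> m b - b m] with values in [W]. Composing with the projection
   onto [W] before inverting keeps the choice linear. *)
pose F := (f \o projv W)%VF.
pose S := (projv W \o F^-1)%VF.
have SW z : S z \in W by rewrite comp_lfunE memv_proj.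
have Cm : P C *m m = m by rewrite mE !mulmxA coord_mxM setIA setIid.
have mC : m *m P C = m.
  by rewrite mE -!mulmxA coord_mxM (setIidPl (subsetDl _ _)).
have fS z : z = P U0 *m z *m P V0 -> m *m S z - S z *m m = z.
  move=> zE; rewrite -fE.
  have -> : f (S z) = F (F^-1%VF z) by rewrite !comp_lfunE.
  apply: limg_lfunVK; have [|b [hb Cb bC zb]] := rig zE.
    rewrite {1}zE !mulmxA coord_mxM setIA setIid -!mulmxA coord_mxM.
    by rewrite (setIidPl (subsetDl _ _)) mulmxA -zE.
  have bW : b \in W by apply/le_pairs_supp.
  by rewrite zb Cm -fE -(projv_id bW) -[f _]comp_lfunE memv_img ?memvf.
have delE : del = P U0 *m del *m P V0 by rewrite mulmxBr mulmxBl -mE -mE'.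
pose pC n k (X : 'M[K]_(n, k)) : 'M[{poly K}]_(n, k) := map_mx polyC X.
pose ev t n k (X : 'M[{poly K}]_(n, k)) : 'M[K]_(n, k) := map_mx (horner_eval t) X.
have evC t n k (X : 'M[K]_(n, k)) : ev t _ _ (pC _ _ X) = X.
  by apply/matrixP => i j; rewrite !mxE horner_evalE hornerC.
pose ZZ := lin_mx (mulmxr del \o S).
pose A := 1%:M - 'X *: pC _ _ ZZ.
pose Y := - 'X *: (pC _ _ (mxvec del) *m \adj A).
(* The solution multiplied by [det A], completed by the identity outside [C], so that the
   determinant of the whole square matrix tests invertibility in the corner. At [t = 0] both
   determinants are 1. *)
pose Bp := \det A *: pC _ _ (P C) - vec_mx (Y *m pC _ _ (lin_mx S)) + pC _ _ (1%:M - P C).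
have evA t : ev t _ _ A = 1%:M - t *: ZZ.
  by rewrite /ev map_mxB map_mx1 map_mxZ /= horner_evalE hornerX -/(ev t _ _ _) evC.
pose y t := ev t _ _ Y.
have yE t : y t = - t *: (mxvec del *m \adj (1%:M - t *: ZZ)).
  rewrite /y /ev map_mxZ map_mxM map_mx_adj -/(ev t _ _ A) evA -/(ev t _ _ (pC _ _ _)) evC.
  by rewrite /= horner_evalE hornerN hornerX.
pose D t := \det (1%:M - t *: ZZ).
have DE t : (\det A).[t] = D t.
  by rewrite -horner_evalE -det_map_mx -/(ev t _ _ A) evA.
have evB t : ev t _ _ Bp = D t *: P C - S (vec_mx (y t)) + (1%:M - P C).
  rewrite /ev map_mxD map_mxB map_mxZ map_vec_mx map_mxM -/(ev t _ _ Y) -/(y t).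
  rewrite -!/(ev t _ _ (pC _ _ _)) !evC /= horner_evalE DE; congr (_ - _ + _).
  by rewrite -{1}[y t]vec_mxK mul_vec_lin mxvecK.
have dBE t : (\det Bp).[t] = \det (D t *: P C - S (vec_mx (y t)) + (1%:M - P C)).
  by rewrite -horner_evalE -det_map_mx -/(ev t _ _ Bp) evB.
exists (\det A * \det Bp).
  suff h : (\det A * \det Bp).[0] = 1.
    by apply: contra_eq_neq h => ->; rewrite horner0 eq_sym oner_neq0.
  have y0 : y 0 = 0 by rewrite yE oppr0 scale0r.
  have D0 : D 0 = 1 by rewrite /D scale0r subr0 det1.
  have S0 : S (vec_mx (y 0)) = 0 by rewrite y0 linear0 linear0.
  by rewrite hornerM dBE DE S0 D0 scale1r subr0 addrC subrK det1 mulr1.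
move=> t; rewrite hornerM mulf_eq0 negb_or DE dBE => /andP[Dt Bt].
set z := vec_mx (y t) in Bt; set mt := m + t *: del.
pose b := D t *: P C - S z.
have zE : z - t *: (S z *m del) = - (t * D t) *: del.
  have zy : mxvec z = y t by rewrite vec_mxK.
  have Sy : mxvec (S z *m del) = y t *m ZZ by rewrite -zy mul_vec_lin.
  apply: (can_inj mxvecK); rewrite linearB /= linearZ /= Sy zy.
  rewrite -{1}[y t]mulmx1 scalemxAr -mulmxBr yE -scalemxAl -mulmxA mul_adj_mx.
  by rewrite mul_mx_scalar scalerA mulNr -linearZ.
have [hS CS SC] := (le_pairs_supp (S z)).1 (SW z).
have [SU SV] := corner_commute le_arm armU hS CS SC.
have zU : z = P U0 *m z *m P V0.
  have {1 2}-> : z = t *: (S z *m del) - (t * D t) *: del by rewrite -scaleNr -zE addrC subrK.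
  rewrite (mulmxBr (P U0)) mulmxBl -!scalemxAr -!scalemxAl -delE; congr (_ *: _ - _).
  by rewrite mulmxA SU -!mulmxA (mulmxA (P U0)) -delE.
have hb : inB b by apply: incB => //; apply/incZ/inc_coord.
have Cb : P C *m b = b by rewrite mulmxBr CS -scalemxAr coord_mxM setIid.
have bC : b *m P C = b by rewrite mulmxBl SC -scalemxAl coord_mxM setIid.
pose B := b + (1%:M - P C).
have hB : inB B by apply: incD => //; apply: incB; [apply: inc1 | apply: inc_coord].
have Bu : B \in unitmx by rewrite unitmxE unitfE.
have Bc := mulmxV Bu; have cB := mulVmx Bu; set c := invmx B in Bc cB.
have hc : inB c := inc_inv le_refl le_trans hB Bc.
have CC : P C *m P C = P C by rewrite coord_mxM setIid.
have PD : P C *m (1%:M - P C) = 0 by rewrite mulmxBr mulmx1 CC subrr.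
have DP : (1%:M - P C) *m P C = 0 by rewrite mulmxBl mul1mx CC subrr.
have bc : b *m c = P C.
  move/(congr1 (mulmx (P C))): Bc; by rewrite mulmx1 mulmxA mulmxDr Cb PD addr0.
have cb : c *m b = P C.
  move/(congr1 (mulmx^~ (P C))): cB; by rewrite mul1mx -mulmxA mulmxDl bC DP addr0.
exists b, (P C *m c *m P C); split=> //.
- split=> //; apply: (incM le_trans); last exact: inc_coord.
  by apply: (incM le_trans) => //; exact: inc_coord.
- by split; [rewrite !mulmxA CC | rewrite -mulmxA CC].
- split; first by rewrite !mulmxA bC bc CC.
  by rewrite -!mulmxA Cb cb CC.
- rewrite mulmxBl mulmxBr -scalemxAr -scalemxAl mC.
  have Cd : P C *m del = del.
    by rewrite delE !mulmxA coord_mxM setIA setIid.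
  have -> : P C *m mt = mt by rewrite mulmxDr -scalemxAr Cm Cd.
  rewrite (mulmxDr (S z)) -(scalemxAr t) scalerDr scalerA [D t * t]mulrC.
  have -> : m *m S z = z + S z *m m by rewrite -{2}(fS z zU) subrK.
  set X := S z *m m; set V := t *: (S z *m del); set Q := (t * D t) *: del.
  have -> : z = V - Q by rewrite /Q -scaleNr -zE addrC subrK.
  rewrite -addrA; congr (_ + _); rewrite !opprD opprK [- X - V]addrC addrA.
  by rewrite [Q - V]addrC.
Qed.

End Line.

Lemma rigid_equiv C m m' : m = P (C :&: U) *m m *m P (C :\: U) ->
  m' = P (C :&: U) *m m' *m P (C :\: U) ->
  rigid le U C m (P C) -> rigid le U C m' (P C) -> mx_equiv C m m'.
Proof.
move=> mE mE' rm rm'.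
have [p p0 pP] := rigid_line mE mE' rm; have [q q0 qP] := rigid_line mE' mE rm'.
(* The second line starts at [m'] and runs back to [m], so the common point has parameter [1 - t] on
   it. *)
have q'0 : q \Po (1 - 'X) != 0.
  apply: contraNneq q0 => /(congr1 (fun r => r \Po (1 - 'X))).
  rewrite -comp_polyA comp_poly0 comp_polyB comp_polyX comp_polyC.
  by rewrite opprB addrCA subrr addr0 comp_polyXr => ->.
have /closed_nonrootP[t] : p * (q \Po (1 - 'X)) != 0 by rewrite mulf_neq0.
rewrite /root hornerM horner_comp hornerD hornerN hornerX hornerC mulf_eq0 negb_or.
move=> /andP[/pP e1 /qP e2].
have tE : m' + (1 - t) *: (m - m') = m + t *: (m' - m).
  by rewrite scalerBl scale1r addrA [m' + (m - m')]addrCA subrr addr0 -scalerN opprB.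
have cor (x : 'M_N) : x = P (C :&: U) *m x *m P (C :\: U) -> P C *m x = x /\ x *m P C = x.
  move=> ->; rewrite !mulmxA coord_mxM setIA setIid; split=> //.
  by rewrite -!mulmxA coord_mxM (setIidPl (subsetDl _ _)).
have [Cm mC] := cor _ mE; have [Cm' mC'] := cor _ mE'.
rewrite tE in e2; apply: mx_equiv_trans e2; apply: mx_equiv_sym => //.
by rewrite mulmxDr -scalemxAr mulmxBr Cm Cm'.
Qed.

Section FiniteClasses.
Hypothesis arm_le : forall s t : 'I_N, arm s = arm t -> (t <= s)%N -> le s t.
Variable d2 : nat.
Hypothesis tits : forall C, C != set0 -> (#|C :\: U| <= #|C :&: U| + d2)%N ->
  (#|C :&: U| * #|C :\: U| < #|le_pairs le C|)%N.

Lemma mx_object_card C (m : 'M[K]_N) : mx_object U C m -> (#|C :&: U| <= #|C :\: U|)%N.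
Proof.
move=> [mE inj]; rewrite -!(rank_coord_mx K).
have rk : \rank (P (C :&: U) *m m) = \rank (P (C :&: U)).
  apply/mxrank_injP/rowV0P => v; rewrite sub_capmx => /andP[/submxP[w wE] /sub_kermxP vm].
  by apply: inj => //; rewrite wE -mulmxA coord_mxM setIid.
by rewrite -rk mE !mulmxA; apply: mxrankM_maxr.
Qed.

(** Conjugating [e] to the coordinate projection on [C'] conjugates [m] to a matrix commuting with
    that projection, hence to a block sum over [C'] and its complement in [C]. *)
Lemma decomposed_object C (e m : 'M[K]_N) : mx_object U C m -> endo le m (P C) e ->
    e *m e = e -> e != 0 -> e != P C ->
  exists (C' : {set 'I_N}) (x y : 'M[K]_N), [/\ C' \proper C /\ C' != set0, mx_object U C' x,
    mx_object U (C :\: C') y & mx_equiv C m (x + y)].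
Proof.
move=> [mE inj] [he Ce eC em] ee e0 eC1.
have Cm : P C *m m = m by rewrite mE !mulmxA coord_mxM setIA setIid.
have mC : m *m P C = m.
  by rewrite mE -!mulmxA coord_mxM (setIidPl (subsetDl _ _)).
rewrite Cm in em.
have [C' [u [v [[hu hv] [uv vu] cu ue sC']]]] :=
  incidence_idempotent le_refl le_trans le_arm arm_le he ee Ce eC.
have cv : P C *m v = v *m P C.
  by rewrite -[LHS]mul1mx -vu -mulmxA (mulmxA u) -cu -!mulmxA uv mulmx1.
have eE : e = v *m P C' *m u by rewrite -ue -!mulmxA vu mulmx1 !mulmxA vu mul1mx.
have C'0 : C' != set0.
  by apply: contra_neq e0 => C'0; rewrite eE C'0 coord_mx0 mulmx0 mul0mx.
have C'C : C' \proper C.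
  rewrite finset.properEneq sC' andbT; apply: contra_neq eC1 => C'C.
  by rewrite eE C'C -cv -mulmxA vu mulmx1.
have uvK k (x : 'M_(k, N)) : x *m u *m v = x by rewrite -mulmxA uv mulmx1.
have vuK k (x : 'M_(k, N)) : x *m v *m u = x by rewrite -mulmxA vu mulmx1.
pose m1 := u *m m *m v.
have [uU uV] := inc_commute_U le_arm armU hu; have [vU vV] := inc_commute_U le_arm armU hv.
have capU (A B : {set 'I_N}) : P (A :&: B) = P B *m P A by rewrite coord_mxM setIC.
have mU : P U *m m = m by rewrite mE !mulmxA coord_mxM setIC -setIA setIid.
have mV : m *m P (~: U) = m by rewrite mE -!mulmxA coord_mxM setDE -setIA setIid.
have Um1 : P U *m m1 = m1 by rewrite !mulmxA uU -(mulmxA u) mU.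
have m1V : m1 *m P (~: U) = m1 by rewrite -mulmxA -vV mulmxA -(mulmxA u) mV.
have Cm1 : P C *m m1 = m1 by rewrite !mulmxA cu -(mulmxA u) Cm.
have m1C : m1 *m P C = m1 by rewrite -mulmxA -cv mulmxA -(mulmxA u) mC.
have m1C' : P C' *m m1 = m1 *m P C'.
  by rewrite -ue /m1 !mulmxA !vuK -(mulmxA u e) -em (mulmxA u).
have inj1 (w : 'rV_N) : w *m P (C :&: U) = w -> w *m m1 = 0 -> w = 0.
  move=> wC wm.
  have wm' : w *m u *m m = 0.
    by move/(congr1 (mulmx^~ u)): wm; rewrite mul0mx !mulmxA vuK.
  have : w *m u = 0.
    apply: inj => //; rewrite setIC -coord_mxM mulmxA -(mulmxA w) -uU -!mulmxA -cu.
    by rewrite (mulmxA (P U)) (mulmxA w) coord_mxM setIC wC.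
  by move/(congr1 (mulmx^~ v)); rewrite uvK mul0mx.
have m1E : m1 = u *m m *m v by [].
clearbody m1.
have part (A : {set 'I_N}) : A \subset C -> P A *m m1 = m1 *m P A ->
    mx_object U A (P A *m m1 *m P A).
  move=> sA Am1; split.
    have AA : P A *m P A = P A by rewrite coord_mxM setIid.
    have -> : P A *m m1 *m P A = m1 *m P A by rewrite Am1 -mulmxA AA.
    rewrite setDE [A :&: ~: U]setIC -!coord_mxM -!mulmxA.
    have cA : P A *m P (~: U) = P (~: U) *m P A by rewrite !coord_mxM setIC.
    rewrite (mulmxA (P A) (P (~: U))) cA -(mulmxA (P (~: U))) AA.
    by rewrite (mulmxA m1) m1V (mulmxA (P U)) Um1 mulmxA Am1 -mulmxA AA.
  move=> w wA; rewrite Am1 -(mulmxA m1) coord_mxM setIid -Am1 mulmxA.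
  have -> : w *m P A = w by rewrite -{1}wA -mulmxA coord_mxM setIAC setIid.
  by apply: inj1; rewrite -{1}wA -mulmxA coord_mxM (setIidPl (finset.setSI _ sA)).
have DE : P C = P C' + P (C :\: C').
  rewrite -coord_mxU; last by rewrite finset.disjoints_subset setDE finset.setCI finset.setCK finset.subsetUr.
  by congr P; apply/setP => i; rewrite !inE; case: (boolP (i \in C')) => // /(fintype.subsetP sC') ->.
have m1D : P (C :\: C') *m m1 = m1 *m P (C :\: C').
  by move: Cm1; rewrite -{2}m1C DE mulmxDl mulmxDr m1C' => /addrI.
have CC : P C *m P C = P C by rewrite coord_mxM setIid.
exists C', (P C' *m m1 *m P C'), (P (C :\: C') *m m1 *m P (C :\: C')); split=> //.
- exact: part.
- by apply: part; rewrite ?finset.subsetDl.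
- rewrite m1C' m1D -!mulmxA !coord_mxM !setIid -mulmxDr -DE m1C.
  exists (P C *m u), (v *m P C); split.
  + by split; apply: (incM le_trans) => //; apply: inc_coord.
  + by split; [rewrite mulmxA CC | rewrite -mulmxA -cu mulmxA CC].
  + by split; [rewrite mulmxA cv -mulmxA CC | rewrite -mulmxA CC].
  + split; first by rewrite !mulmxA uvK CC.
    by rewrite mulmxA -(mulmxA v) CC -cv -mulmxA vu mulmx1.
  + by rewrite m1E cu -!mulmxA Cm -cu (mulmxA v) -cv -!mulmxA vu mulmx1 mC.
Qed.

Lemma mx_object_corner C (m : 'M[K]_N) : mx_object U C m -> P C *m m = m /\ m *m P C = m.
Proof.
case=> -> _; rewrite !mulmxA coord_mxM setIA setIid; split=> //.
by rewrite -!mulmxA coord_mxM (setIidPl (subsetDl _ _)).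
Qed.

Lemma mx_equiv_sum (C C' : {set 'I_N}) (m1 m2 x y : 'M[K]_N) : C' \subset C ->
    P C' *m m1 = m1 -> P (C :\: C') *m m2 = m2 -> m1 *m P C' = m1 -> m2 *m P (C :\: C') = m2 ->
    x *m P C' = x -> y *m P (C :\: C') = y ->
  mx_equiv C' m1 x -> mx_equiv (C :\: C') m2 y -> mx_equiv C (m1 + m2) (x + y).
Proof.
move=> sC' Cm1 Cm2 m1C m2C xC yC [b [b' [[hb hb'] [bC Cb] [b'C Cb'] [bb' b'b] bm]]].
move=> [a [a' [[ha ha'] [aC Ca] [a'C Ca'] [aa' a'a] am]]].
set D := C :\: C' in Cm2 m2C yC aC Ca a'C Ca' aa' a'a *.
have DE : P C = P C' + P D.
  rewrite -coord_mxU; last by rewrite finset.disjoints_subset /D setDE finset.setCI finset.setCK finset.subsetUr.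
  by congr P; apply/setP => i; rewrite !inE; case: (boolP (i \in C')) => // /(fintype.subsetP sC') ->.
have [CD DC] : P C' *m P D = 0 /\ P D *m P C' = 0.
  by rewrite !coord_mxM -(coord_mx0 K N); split; congr P; apply/setP => i; rewrite /D !inE; case: (i \in C') => //=; rewrite andbF.
have z1 n k (s : 'M_(n, N)) (t : 'M_(N, k)) : s *m P C' = s -> P D *m t = t -> s *m t = 0.
  by move=> <- <-; rewrite mulmxA -(mulmxA s) CD mulmx0 mul0mx.
have z2 n k (s : 'M_(n, N)) (t : 'M_(N, k)) : s *m P D = s -> P C' *m t = t -> s *m t = 0.
  by move=> <- <-; rewrite mulmxA -(mulmxA s) DC mulmx0 mul0mx.
have [CP PC] := coord_mxK K sC'; have [DP PD] := coord_mxK K (finset.subsetDl C C').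
have corl (s t : 'M_N) : P C' *m s = s -> P D *m t = t -> P C *m (s + t) = s + t.
  by move=> es et; rewrite mulmxDr -{1}es mulmxA CP es -{1}et mulmxA DP et.
have corr (s t : 'M_N) : s *m P C' = s -> t *m P D = t -> (s + t) *m P C = s + t.
  by move=> es et; rewrite mulmxDl -{1}es -mulmxA PC es -{1}et -mulmxA PD et.
exists (b + a), (b' + a'); split.
- by split; apply: incD.
- by split; [exact: corl | exact: corr].
- by split; [exact: corl | exact: corr].
- rewrite !mulmxDl !mulmxDr (z1 _ _ b a') // (z2 _ _ a b') // (z1 _ _ b' a) // (z2 _ _ a' b) //.
  by rewrite !addr0 !add0r bb' b'b aa' a'a DE.
- rewrite !mulmxDl !mulmxDr (z1 _ _ b m2) // (z2 _ _ a m1) // (z1 _ _ x a) // (z2 _ _ y b) //.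
  by rewrite !addr0 !add0r bm am.
Qed.

(** Induction on the size of [C]. Indecomposable objects are rigid and form at most one class; the
    others are sums of representatives found for proper subsets of [C]. *)
Lemma finite_classes (C : {set 'I_N}) : (#|C :\: U| <= #|C :&: U| + d2)%N ->
  exists l : seq 'M[K]_N, forall m, mx_object U C m ->
    exists m', [/\ m' \in l, P C *m m' = m', m' *m P C = m' & mx_equiv C m m'].
Proof.
have [n] := ubnP #|C|; elim: n C => // n IH C; rewrite ltnS => Cn Cd.
have [C0|C0] := eqVneq C set0.
  exists [:: 0] => m [mE _]; have m0 : m = 0.
    by rewrite mE C0 finset.set0I coord_mx0 !mul0mx.
  exists 0; rewrite mem_seq1 eqxx m0 mulmx0 mul0mx; split=> //.
  by apply: mx_equiv_refl; rewrite ?mulmx0 ?mul0mx.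
have [L LP] : exists L : {set 'I_N} -> seq 'M[K]_N, forall D : {set 'I_N}, D \proper C ->
    (#|D :\: U| <= #|D :&: U| + d2)%N -> forall m, mx_object U D m ->
    exists m', [/\ m' \in L D, P D *m m' = m', m' *m P D = m' & mx_equiv D m m'].
  apply: (@fin_all_exists _ (fun _ => seq 'M[K]_N) (fun (D : {set 'I_N}) L => D \proper C ->
    (#|D :\: U| <= #|D :&: U| + d2)%N -> forall m, mx_object U D m ->
    exists m', [/\ m' \in L, P D *m m' = m', m' *m P D = m' & mx_equiv D m m'])) => D.
  have [DC|] := boolP (D \proper C); last by exists [::].
  have [Dd|] := boolP (#|D :\: U| <= #|D :&: U| + d2)%N; last by exists [::].
  have [l lP] := IH D (leq_trans (proper_card DC) Cn) Dd.
  by exists l.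
have [l0 l0P] : exists l0 : seq 'M[K]_N, forall m, mx_object U C m -> rigid le U C m (P C) ->
    exists m', [/\ m' \in l0, P C *m m' = m', m' *m P C = m' & mx_equiv C m m'].
  have [[m0 [om0 rm0]]|no] := pselect (exists m0, mx_object U C m0 /\ rigid le U C m0 (P C)).
    have [c1 c2] := mx_object_corner om0.
    exists [:: m0] => m om rm; exists m0; rewrite mem_seq1; split=> //.
    by apply: rigid_equiv => //; [case: om | case: om0].
  by exists [::] => m om rm; case: no; exists m.
pose sums (D : {set 'I_N}) := [seq x + y | x <- L D, y <- L (C :\: D)].
exists (l0 ++ flatten [seq sums D | D <- enum {set 'I_N}]) => m om.
have [Cm mC] := mx_object_corner om.
have CC : P C *m P C = P C by rewrite coord_mxM setIid.
have [indec|] := pselect (indecomposable le m (P C)).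
  suff /(l0P m om)[m' [m'l c1 c2 eq]] : rigid le U C m (P C).
    by exists m'; rewrite mem_cat m'l.
  apply: (indecomposable_rigid le_refl le_trans le_arm arm_le armU tits Cd om) => //.
    split=> //; first exact: inc_coord.
    - by rewrite Cm mC.
    - by move=> u uU _; rewrite -uU -mulmxA coord_mxM setIAC setIid.
  by rewrite -mxrank_eq0 rank_coord_mx cards_eq0.
move=> ndec.
have [e [he ee e0 e1]] : exists e, [/\ endo le m (P C) e, e *m e = e, e != 0 & e != P C].
  apply: contrapT => no; apply: ndec => b hb bb.
  have [->|b0] := eqVneq b 0; first by left.
  have [->|b1] := eqVneq b (P C); first by right.
  by case: no; exists b.
have [C' [x [y [[C'C C'0] ox oy eq]]]] := decomposed_object om he ee e0 e1.
have sC' := proper_sub C'C.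
have DC : C :\: C' \proper C.
  rewrite finset.properEneq finset.subsetDl andbT; apply: contra_neq C'0 => DC.
  apply/setP => i; rewrite inE; apply/negP => iC'.
  by have := fintype.subsetP sC' _ iC'; rewrite -DC inE iC'.
have cU : (#|C :&: U| = #|C' :&: U| + #|(C :\: C') :&: U|)%N.
  rewrite -(cardsID C' (C :&: U)) setIAC (setIidPr sC').
  have -> // : (C :&: U) :\: C' = (C :\: C') :&: U.
  by apply/setP => i; rewrite !inE andbA.
have cV : (#|C :\: U| = #|C' :\: U| + #|(C :\: C') :\: U|)%N.
  rewrite -(cardsID C' (C :\: U)).
  have -> : (C :\: U) :\: C' = (C :\: C') :\: U by rewrite !setDDl setUC.
  have -> // : (C :\: U) :&: C' = C' :\: U.
  by rewrite setIC setIDA (setIidPl sC').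
(* Each summand has at least as many columns as rows, so the excess of either one is bounded by the
   excess for [C], and the bound by [d2] is inherited. *)
have := mx_object_card ox; have := mx_object_card oy => hy hx.
have [x' [x'l cx xc ex]] := LP C' C'C ltac:(lia) x ox.
have [y' [y'l cy yc ey]] := LP _ DC ltac:(lia) y oy.
have [cx1 cx2] := mx_object_corner ox; have [cy1 cy2] := mx_object_corner oy.
have eqs : mx_equiv C (x + y) (x' + y') by apply: (mx_equiv_sum sC').
have [CP PC] := coord_mxK K sC'; have [DP PD] := coord_mxK K (proper_sub DC).
exists (x' + y'); split.
- rewrite mem_cat; apply/orP; right; apply/flattenP; exists (sums C').
    by apply/mapP; exists C'; rewrite ?mem_enum.
  by apply/allpairsP; exists (x', y').
- by rewrite mulmxDr -{1}cx mulmxA CP cx -{1}cy mulmxA DP cy.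
- by rewrite mulmxDl -{1}xc -mulmxA PC xc -{1}yc -mulmxA PD yc.
- exact: mx_equiv_trans eq eqs.
Qed.

End FiniteClasses.
End Equivalence.

End RigidObjects.

(** * Positivity of the Tits form *)

Definition sumsq (e : seq nat) : nat := sumn [seq k ^ 2 | k <- e].

Lemma sumn_le_sumsq e : sumn e <= sumsq e.
Proof.
elim: e => //= k e IH; have kk : k <= k ^ 2 by rewrite -mulnn; nia.
by rewrite /sumsq /= leq_add.
Qed.

(** Cauchy-Schwarz. The induction step is multiplied by [p.+1], which turns the mixed term into
    twice a product of two naturals. *)
Lemma sumn_sqr_le e : sumn e ^ 2 <= size e * sumsq e.
Proof.
elim: e => //= k e; rewrite {2}/sumsq /= -/(sumsq e).
have := sumn_le_sumsq e; rewrite -!mulnn.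
move: (sumn e) (sumsq e) (size e) => E S [|p] ES IH; first nia.
suff : p.+1 * (2 * k * E) <= p.+1 * (p.+1 * (k * k) + S) by rewrite leq_pmul2l //; nia.
have e1 : p.+1 * (2 * k * E) = 2 * (p.+1 * k) * E by rewrite !mulnA [p.+1 * 2]mulnC.
have e2 : p.+1 * (p.+1 * (k * k) + S) = p.+1 * k * (p.+1 * k) + p.+1 * S.
  by rewrite mulnDr mulnA mulnACA.
rewrite e1 e2; apply: leq_trans (leq_add (leqnn _) IH).
by move: (p.+1 * k) => m; have [] := nat_Cauchy m E; rewrite -!mulnn mulnA.
Qed.

(* The list (o)-(d4), in terms of the nonzero entries of the truncated sequences. *)
Definition tits_list (r1 r2 r3 : seq nat) (d : nat) : Prop :=
  size r1 = 0 \/ d <= 2 \/ (d = 3 /\ size r1 = 1) \/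
  ((d = 4 \/ d = 5) /\ size r1 = 1 /\ size r2 = 2) \/
  (size r1 = 1 /\ (nth 0 r1 0 = 1 \/ (nth 0 r1 0 = 2 /\ size r2 = 2) \/
     (size r2 = 1 \/ (size r2 = 2 /\ minn (nth 0 r2 0) (nth 0 r2 1) = 1)) \/
     (size r2 = 2 /\ size r3 <= 4))).

(* The delimiter [%Z] belongs to MathComp's [int]. *)
Delimit Scope Z_scope with ZZ.

Section TitsInequality.
Local Open Scope Z_scope.

(** This is [(E - a) (E - a - 1) >= 0] for integers. It is sharper than a square for the quadratic
    polynomials below whose real minimum lies at a half-integer. *)
Lemma Zpronic (a E : Z) : (2 * a + 1) * E <= E * E + a * (a + 1).
Proof. assert (E <= a \/ a + 1 <= E) by lia. nia. Qed.

Variables (E F G S1 S2 S3 h : Z).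
Hypotheses (E0 : 0 <= E) (F0 : 0 <= F) (G0 : 0 <= G) (h0 : 0 <= h).
Hypotheses (ES : E <= S1) (FS : F <= S2) (GS : G <= S3).
Hypothesis nz : 0 < h + E + F + G.

(** Twice the Tits form with [h] rows: [(E E + S1) / 2] is the dimension of a parabolic subgroup of
    [GL_E] whose block sizes have squares summing to [S1]. *)
Definition tits_pos : Prop :=
  2 * h * (E + F + G) < 2 * h * h + (E * E + S1) + (F * F + S2) + (G * G + S3).

(** Completing the square in [h]: the worst value is [h = n / 2] with [n = E + F + G]. *)
Lemma tits_by_square : 0 < E + F + G ->
    (E + F + G) * (E + F + G) < 2 * ((E * E + S1) + (F * F + S2) + (G * G + S3)) -> tits_pos.
Proof.
intros n0 H; unfold tits_pos.
assert (0 <= (2 * h - (E + F + G)) * (2 * h - (E + F + G))) by apply Z.square_nonneg.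
nia.
Qed.

Lemma tits_n0 : E + F + G = 0 -> tits_pos.
Proof. intros n0; unfold tits_pos; nia. Qed.

Lemma tits_o : E = 0 -> tits_pos.
Proof.
intros e; assert (E + F + G = 0 \/ 0 < E + F + G) as [?|?] by lia; [now apply tits_n0|].
apply tits_by_square; trivial; subst.
assert (0 <= (F - G) * (F - G)) by apply Z.square_nonneg; nia.
Qed.

(** The form sees [h] only through [h (n - h)], so either factor may be the small one. For [k = 2]
    each arm contributes at least -2, and the total -6 exceeds [- 2 k k = -8]. *)
Lemma tits_small k : k = h \/ k = E + F + G - h -> k <= 2 -> tits_pos.
Proof.
intros hk k2; assert (e : h * (E + F + G - h) = k * (E + F + G - k)) by (destruct hk; subst; ring).
unfold tits_pos.
assert (2 * (k * (E + F + G - k)) < (E * E + S1) + (F * F + S2) + (G * G + S3)); [|nia].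
assert (E + F + G = 0 \/ 0 < E + F + G) as [?|?] by lia.
  assert (E = 0 /\ F = 0 /\ G = 0) as (-> & -> & ->) by lia. nia.
pose proof (@Zpronic 1 E); pose proof (@Zpronic 1 F); pose proof (@Zpronic 1 G).
assert (k < 0 \/ k = 0 \/ k = 1 \/ k = 2) as [? | [-> | [-> | ->]]] by lia; try nia.
Qed.

(** The three arms contribute at least -4, -6 and -6, against -18. *)
Lemma tits_b : S1 = E * E ->
  forall k, k = h \/ k = E + F + G - h -> k = 3 -> tits_pos.
Proof.
intros e1 k hk ->; assert (e : h * (E + F + G - h) = 3 * (E + F + G - 3)) by (destruct hk; subst; nia).
unfold tits_pos.
pose proof (@Zpronic 1 E); pose proof (@Zpronic 2 F); pose proof (@Zpronic 2 G); nia.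
Qed.

Lemma tits_c f1 f2 : S1 = E * E -> F = f1 + f2 -> S2 = f1 * f1 + f2 * f2 ->
  forall k, k = h \/ k = E + F + G - h -> k = 4 \/ k = 5 -> tits_pos.
Proof.
intros e1 eF e2 k hk k45.
assert (e : h * (E + F + G - h) = k * (E + F + G - k)) by (destruct hk; subst; ring).
unfold tits_pos.
assert (0 <= (f1 - f2) * (f1 - f2)) by apply Z.square_nonneg.
(* The real minimum of [f1 f1 + f2 f2 + f1 f2 - k F] is -16/3 at [F = 8/3] for [k = 4] and -25/3 at
   [F = 10/3] for [k = 5]; integrality improves these to -5 and -8. The arms then add up to -8 - 10
   - 12, against -32, and to -12 - 16 - 20, against -50. *)
destruct k45 as [->| ->].
  assert (0 <= (3 * F - 8) * (3 * F - 8)) by apply Z.square_nonneg.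
  assert (0 <= (E - 2) * (E - 2)) by apply Z.square_nonneg.
  pose proof (@Zpronic 3 G).
  assert (-5 <= f1 * f1 + f2 * f2 + f1 * f2 - 4 * F) by (subst F; nia).
  assert (F * F = f1 * f1 + f2 * f2 + 2 * (f1 * f2)) by (subst F; ring). nia.
assert (0 <= (3 * F - 10) * (3 * F - 10)) by apply Z.square_nonneg.
pose proof (@Zpronic 2 E); pose proof (@Zpronic 4 G).
assert (-8 <= f1 * f1 + f2 * f2 + f1 * f2 - 5 * F) by (subst F; nia).
assert (F * F = f1 * f1 + f2 * f2 + 2 * (f1 * f2)) by (subst F; ring). nia.
Qed.

(** For [E = 1] the two sides of [tits_by_square] differ by at least [(F - G)^2 + 3]. *)
Lemma tits_d1 : E <= 1 -> S1 = E * E -> tits_pos.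
Proof.
intros e1 e2; assert (E = 0 \/ E = 1) as [?|e] by lia; [now apply tits_o|].
apply tits_by_square; [lia|]; subst.
assert (0 <= (F - G) * (F - G)) by apply Z.square_nonneg; nia.
Qed.

(** For [E = 2] the difference is at least [(G - F - 1)^2 + (F - 3)^2 + 2]. *)
Lemma tits_d2 : E <= 2 -> S1 = E * E -> F * F <= 2 * S2 -> tits_pos.
Proof.
intros e1 e2 e3; assert (E <= 1 \/ E = 2) as [?|e] by lia; [now apply tits_d1|].
apply tits_by_square; [lia|]; subst.
assert (0 <= (G - F - 1) * (G - F - 1)) by apply Z.square_nonneg.
assert (0 <= (F - 3) * (F - 3)) by apply Z.square_nonneg; nia.
Qed.

(** The difference is at least [(E + F - G)^2 + 2 (E - F)^2 + 2 G]. *)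
Lemma tits_d3 : S1 = E * E -> S2 = F * F -> tits_pos.
Proof.
intros e1 e2; assert (E + F + G = 0 \/ 0 < E + F + G) as [?|?] by lia; [now apply tits_n0|].
apply tits_by_square; trivial; subst.
assert (0 <= (E - F) * (E - F)) by apply Z.square_nonneg.
assert (0 <= (E + F - G) * (E + F - G)) by apply Z.square_nonneg.
assert (0 < G \/ G = 0) as [?| ->] by lia; nia.
Qed.

(** With [D = E - F] the difference is at least [(E + F - G - 1)^2 + 2 D (D + 1) + 3], and
    [D (D + 1)] is nonnegative for integers. *)
Lemma tits_d3' f : 0 <= f -> S1 = E * E -> F = f + 1 -> S2 = f * f + 1 -> tits_pos.
Proof.
intros f0 e1 eF e2; apply tits_by_square; [lia|]; subst.
assert (0 <= (E + (f + 1) - G - 1) * (E + (f + 1) - G - 1)) by apply Z.square_nonneg.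
pose proof (@Zpronic 0 (E - (f + 1))). pose proof (@Zpronic (-1) (E - (f + 1))). nia.
Qed.

(** By Cauchy-Schwarz an arm with [k] levels weighs [k / (2 (k + 1))], and here 1/4 + 1/3 + 2/5 =
    59/60 is below 1. A fifth level in the third arm would give 1/4 + 1/3 + 5/12 = 1, the isotropic
    case of extended E8. *)
Lemma tits_d4 : S1 = E * E -> F * F <= 2 * S2 -> G * G <= 4 * S3 -> tits_pos.
Proof.
intros e1 e2 e3; assert (E + F + G = 0 \/ 0 < E + F + G) as [?|?] by lia; [now apply tits_n0|].
apply tits_by_square; trivial; subst.
assert (0 <= (3 * E - F - G) * (3 * E - F - G)) by apply Z.square_nonneg.
assert (0 <= (5 * F - 4 * G) * (5 * F - 4 * G)) by apply Z.square_nonneg.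
assert (0 < G \/ G = 0) as [?| ->] by lia.
  nia.
assert (0 < F \/ F = 0) as [?| ->] by lia; nia.
Qed.

End TitsInequality.

Lemma all2_leq_nth i (e r : seq nat) : all2 leq e r -> nth 0 e i <= nth 0 r i.
Proof.
elim: e r i => [|k e IH] [|k' r] //= [|i] //.
  by case/andP.
by case/andP => _ /IH h; apply: h.
Qed.

Lemma tits_of_list (r1 r2 r3 e1 e2 e3 : seq nat) (d1 d2 h : nat) :
    all2 leq e1 r1 -> all2 leq e2 r2 -> all2 leq e3 r3 ->
    let n := sumn e1 + sumn e2 + sumn e3 in
    h <= d1 -> n <= h + d2 -> 0 < h + n -> tits_list r1 r2 r3 (minn d1 d2) ->
  2 * h * n < 2 * (h * h) + (sumn e1 * sumn e1 + sumsq e1) + (sumn e2 * sumn e2 + sumsq e2)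
    + (sumn e3 * sumn e3 + sumsq e3).
Proof.
move=> le1 le2 le3 n hd1 hd2 hn tl.
have ES := sumn_le_sumsq e1; have FS := sumn_le_sumsq e2; have GS := sumn_le_sumsq e3.
have E2 := sumn_sqr_le e1; have F2 := sumn_sqr_le e2; have G2 := sumn_sqr_le e3.
rewrite -!mulnn in E2 F2 G2.
have sz1 : size e1 = size r1 by move: le1; rewrite all2E => /andP[/eqP].
have sz2 : size e2 = size r2 by move: le2; rewrite all2E => /andP[/eqP].
have sz3 : size e3 = size r3 by move: le3; rewrite all2E => /andP[/eqP].
have one e : size e = 1 -> sumsq e = sumn e * sumn e.
  by case: e => [|k []] //= _; rewrite /sumsq /= !addn0 mulnn.
have two e : size e = 2 -> exists f1 f2, [/\ sumn e = f1 + f2, sumsq e = f1 * f1 + f2 * f2,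
    nth 0 e 0 = f1 & nth 0 e 1 = f2].
  case: e => [|f1 [|f2 []]] //= _; exists f1, f2; rewrite /sumsq /= !addn0.
  by rewrite !mulnn.
pose ez := Z.of_nat (sumn e1); pose fz := Z.of_nat (sumn e2); pose gz := Z.of_nat (sumn e3).
pose s1 := Z.of_nat (sumsq e1); pose s2 := Z.of_nat (sumsq e2); pose s3 := Z.of_nat (sumsq e3).
pose hz := Z.of_nat h.
suff : tits_pos ez fz gz s1 s2 s3 hz.
  rewrite /tits_pos /ez /fz /gz /s1 /s2 /s3 /hz /n; lia.
have E0 : (0 <= ez)%ZZ by rewrite /ez; lia.
have F0 : (0 <= fz)%ZZ by rewrite /fz; lia.
have G0 : (0 <= gz)%ZZ by rewrite /gz; lia.
have h0 : (0 <= hz)%ZZ by rewrite /hz; lia.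
have zES : (ez <= s1)%ZZ by rewrite /ez /s1; lia.
have zFS : (fz <= s2)%ZZ by rewrite /fz /s2; lia.
have zGS : (gz <= s3)%ZZ by rewrite /gz /s3; lia.
have nz : (0 < hz + ez + fz + gz)%ZZ by rewrite /hz /ez /fz /gz; move: hn; rewrite /n; lia.
(* [d1] bounds [h] and [d2] bounds [n - h]; the form being symmetric in these two, [k] is the one
   bounded by the minimum. *)
have kP m : minn d1 d2 = m -> exists k, (k = hz \/ k = ez + fz + gz - hz)%ZZ /\ (k <= Z.of_nat m)%ZZ.
  have [le|lt] := leqP d1 d2 => <-; first by exists hz; split; [left|rewrite /hz; lia].
  exists (ez + fz + gz - hz)%ZZ; split; first by right.
  by rewrite /ez /fz /gz /hz; move: hd2; rewrite /n; lia.
have small k : (k = hz \/ k = ez + fz + gz - hz)%ZZ -> (k <= 2)%ZZ -> tits_pos ez fz gz s1 s2 s3 hz.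
  by move=> hk k2; eapply tits_small; eassumption.
have sq1 : size r1 = 1 -> s1 = (ez * ez)%ZZ.
  by rewrite -sz1 => /one e; rewrite /s1 /ez e; lia.
case: tl => [r10|[d2'|[[d3 r11]|[[d45 [r11 r22]]|[r11 tl]]]]].
- have e10 : ez = 0%ZZ by move: r10; rewrite -sz1 /ez => /size0nil ->.
  by eapply tits_o; eassumption.
- have [k [hk km]] := kP _ erefl; apply: (small k hk).
  by apply: Z.le_trans km _; lia.
- have [k [hk km]] := kP _ d3.
  have [k2|k3] : (k <= 2)%ZZ \/ (k = 3)%ZZ by lia.
    exact: (small k).
  by eapply tits_b; try eassumption; exact: sq1.
- have [k [hk km]] := kP _ erefl.
  have k5 : (k <= 5)%ZZ by case: d45 => e; rewrite e in km; lia.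
  have [k2|[k3|k4]] : (k <= 2)%ZZ \/ (k = 3)%ZZ \/ (k = 4 \/ k = 5)%ZZ by lia.
  + exact: (small k).
  + by eapply tits_b; try eassumption; exact: sq1.
  + have [f1 [f2 [eF eS _ _]]] := two _ (etrans sz2 r22).
    eapply (@tits_c ez fz gz s1 s2 s3 hz) with (f1 := Z.of_nat f1) (f2 := Z.of_nat f2);
      try eassumption; try exact: sq1; rewrite /fz /s2 ?eF ?eS; lia.
have e1E : sumn e1 = nth 0 e1 0.
  by move: (etrans sz1 r11); case: (e1) => [|k []] //= _; rewrite addn0.
have le1' := all2_leq_nth 0 le1.
have sq1' := sq1 r11.
case: tl => [a1|[[a1 r22]|[[r21|[r22 b1]]|[r22 r34]]]].
- have E1 : (ez <= 1)%ZZ by rewrite /ez e1E; lia.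
  by eapply tits_d1; eassumption.
- have E1 : (ez <= 2)%ZZ by rewrite /ez e1E; lia.
  have FF : (fz * fz <= 2 * s2)%ZZ by rewrite /fz /s2; rewrite sz2 r22 in F2; lia.
  by eapply tits_d2; eassumption.
- have F1 : s2 = (fz * fz)%ZZ by rewrite /s2 /fz one; [lia|rewrite sz2].
  by eapply tits_d3; eassumption.
- have [f1 [f2 [eF eS n0 n1]]] := two _ (etrans sz2 r22).
  have l0 := all2_leq_nth 0 le2; have l1 := all2_leq_nth 1 le2; rewrite n0 in l0; rewrite n1 in l1.
  (* If one entry vanishes, the arm has in effect a single level and the bound of [tits_d3]
     applies. *)
  have : f1 = 0 \/ f2 = 0 \/ f1 = 1 \/ f2 = 1 by move: b1 l0 l1; case: leqP; lia.
  case=> [f0|[f0|[f0|f0]]]; rewrite f0 in eF eS.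
  + by eapply tits_d3; try eassumption; rewrite /fz /s2 eF eS; lia.
  + by eapply tits_d3; try eassumption; rewrite /fz /s2 eF eS; lia.
  + by eapply (@tits_d3' ez fz gz s1 s2 s3 hz) with (f := Z.of_nat f2); try eassumption;
      rewrite /fz /s2 ?eF ?eS; lia.
  + by eapply (@tits_d3' ez fz gz s1 s2 s3 hz) with (f := Z.of_nat f1); try eassumption;
      rewrite /fz /s2 ?eF ?eS; lia.
- have FF : (fz * fz <= 2 * s2)%ZZ by rewrite /fz /s2; rewrite sz2 r22 in F2; lia.
  have GG : (gz * gz <= 4 * s3)%ZZ.
    rewrite /gz /s3; suff : sumn e3 * sumn e3 <= 4 * sumsq e3 by lia.
    by apply: leq_trans G2 _; rewrite leq_mul2r sz3 r34 orbT.
  by eapply tits_d4; eassumption.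
Qed.

Lemma card_pairs (T : finType) (A : {set T}) (R : rel T) :
  #|[set p | [&& p.1 \in A, p.2 \in A & R p.1 p.2]]| = \sum_(s in A) \sum_(t in A) R s t.
Proof.
rewrite -sum1_card big_mkcond pair_big_dep /= [RHS]big_mkcond /=; apply: eq_bigr => -[s t] _.
by rewrite inE /=; do 2!case: (_ \in A) => //=; case: R.
Qed.

(** A level of size 0 admits only the count 0, which changes neither sum: this is the removal of
    zero coefficients. *)
Lemma all2_leq_filter (e x : seq nat) : all2 leq e x ->
  exists e', [/\ all2 leq e' [seq k <- x | k != 0], sumn e' = sumn e & sumsq e' = sumsq e].
Proof.
elim: e x => [|k e IH] [|m x] //= ; first by exists [::].
case/andP => km /IH[e' [h1 h2 h3]]; case: m km => [|m] km.
  by move: km; rewrite leqn0 => /eqP ->; exists e'; split.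
exists (k :: e'); split; first by rewrite /= km h1.
  by rewrite /= h2.
by rewrite /sumsq /= -/(sumsq e) -/(sumsq e') h3.
Qed.

(** [e] counts the elements of [A] on each level. Adding the count of pairs to its transpose gives
    every pair once and the ties twice, and the ties number [sumsq e]. *)
Lemma level_profile (T : finType) (A : {set T}) (f : T -> nat) (x : seq nat) :
    (forall s, s \in A -> f s < size x) ->
    (forall j, #|[set s in A | f s == j]| <= nth 0 x j) ->
  exists e, [/\ all2 leq e [seq k <- x | k != 0], sumn e = #|A| &
    2 * (\sum_(s in A) \sum_(t in A) (f t <= f s)) = #|A| * #|A| + sumsq e].
Proof.
move=> fx cx; pose c j := \sum_(s in A) (f s == j).
have cE j : c j = #|[set s in A | f s == j]|.
  rewrite /c -sum1_card [RHS]big_mkcond [LHS]big_mkcond; apply: eq_bigr => s _.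
  by rewrite inE; case: (s \in A) => //=; case: eqP.
pose e0 := [seq c j | j <- iota 0 (size x)].
have le0 : all2 leq e0 x.
  rewrite all2E size_map size_iota eqxx /=; apply/(all_nthP (0, 0)) => i.
  rewrite size_zip size_map size_iota minnn => ix.
  by rewrite nth_zip ?size_map ?size_iota //= (nth_map 0) ?size_iota // nth_iota // cE.
have [e [h1 h2 h3]] := all2_leq_filter le0.
have one s : s \in A -> \sum_(0 <= j < size x) (f s == j) = 1.
  move=> /fx fs; rewrite (bigD1_seq (f s)) ?mem_index_iota ?iota_uniq //= eqxx.
  by rewrite big1 // => j /negPf; rewrite eq_sym => ->.
have iotaE : iota 0 (size x) = index_iota 0 (size x) by rewrite /index_iota subn0.
exists e; split=> //.
  rewrite h2 sumnE big_map iotaE exchange_big /= -sum1_card.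
  by apply: eq_bigr => s /one.
have diag : \sum_(s in A) \sum_(t in A) (f s == f t) = sumsq e.
  rewrite h3 /sumsq sumnE !big_map iotaE.
  transitivity (\sum_(0 <= j < size x) \sum_(s in A) \sum_(t in A) (f s == j) * (f t == j)).
    rewrite [RHS]exchange_big /=; apply: eq_bigr => s sA; rewrite [RHS]exchange_big /=.
    apply: eq_bigr => t tA; have := fx _ sA => fs.
    rewrite (bigD1_seq (f s)) ?mem_index_iota ?iota_uniq //= eqxx mul1n eq_sym.
    by rewrite big1 ?addn0 // => j /negPf; rewrite eq_sym => ->.
  apply: eq_bigr => j _; rewrite -mulnn /c big_distrl /=; apply: eq_bigr => s _.
  by rewrite big_distrr.
have sym : \sum_(s in A) \sum_(t in A) (f t <= f s) = \sum_(s in A) \sum_(t in A) (f s <= f t).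
  by rewrite exchange_big.
rewrite mul2n -addnn {2}sym -diag -!sum1_card big_distrl /= -!big_split /=.
apply: eq_bigr => s _; rewrite mul1n -!big_split /=; apply: eq_bigr => t _.
by case: ltngtP.
Qed.

From mathcomp Require Import finmap classical_sets cardinality.

(** * Flags, parabolic stabilizers and orbits *)

Section FlagVarieties.
Local Open Scope ring_scope.

(** The block that contains [i] when the integers from 0 on are cut into consecutive blocks of
    lengths [x]; beyond the last block the value is [size x]. *)
Fixpoint level (x : seq nat) (i : nat) : nat :=
  if x is k :: y then if (i < k)%N then 0 else (level y (i - k)).+1 else 0.

Lemma level_homo x : {homo level x : i j / (i <= j)%N}.
Proof.
elim: x => //= k x IH i j ij; have [//|ki] := ltnP i k.
have [jk|kj] := ltnP j k; first lia.
by rewrite ltnS; apply: IH; lia.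
Qed.

Lemma level_lt x i j : (i < sumn x)%N -> (level x i < j)%N = (i < sumn (take j x))%N.
Proof.
elim: x i j => //= k x IH i [|j] /= hi; first by rewrite ltn0.
have [ki|ki] := ltnP i k; first by rewrite ltn0Sn; lia.
by rewrite ltnS IH; lia.
Qed.

Lemma level_size x i : (i < sumn x)%N -> (level x i < size x)%N.
Proof. by move=> ix; rewrite level_lt // take_size. Qed.

Lemma sumn_take_le x i j : (i <= j)%N -> (sumn (take i x) <= sumn (take j x))%N.
Proof. by elim: x i j => // k x IH [|i] [|j] //= ij; rewrite leq_add2l IH. Qed.

Lemma card_ord_lt m p : (p <= m)%N -> #|[set i : 'I_m | i < p]%N| = p.
Proof.
move=> pm; rewrite -[RHS]card_ord -cardsT.
rewrite -(@card_imset _ _ (fun i : 'I_p => widen_ord pm i)); last first.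
  by move=> i j [ij]; apply: val_inj.
apply: eq_card => i; rewrite inE; apply/idP/imsetP => [ip|[j _ ->] //=].
by exists (Ordinal ip) => //; apply: val_inj.
Qed.

Lemma card_level x j : #|[set i : 'I_(sumn x) | level x i == j]| = nth 0%N x j.
Proof.
have [xj|jx] := leqP (size x) j.
  rewrite nth_default //; apply/eqP; rewrite cards_eq0; apply/eqP/setP => i.
  rewrite !inE; apply/negP => /eqP e; have := level_size (ltn_ord i).
  by rewrite e ltnNge xj.
have tk p : (sumn (take p x) <= sumn x)%N.
  by rewrite -[X in (_ <= sumn X)%N](cat_take_drop p x) sumn_cat leq_addr.
have -> : [set i : 'I_(sumn x) | level x i == j] =
    [set i : 'I_(sumn x) | i < sumn (take j.+1 x)]%N :\: [set i : 'I_(sumn x) | i < sumn (take j x)]%N.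
  by apply/setP => i; rewrite !inE -!level_lt // ltnS -leqNgt eqn_leq andbC.
rewrite cardsD (finset.setIidPr _); last first.
  by apply/fintype.subsetP => i; rewrite !inE => /leq_trans; apply; apply: sumn_take_le.
by rewrite !card_ord_lt // (take_nth 0%N) // sumn_rcons addKn.
Qed.

Section Flags.
Variables (K : fieldType) (x : seq nat).
Local Notation n := (sumn x).
Local Notation k := (size x).

Definition std_flag : subspaces K x :=
  [ffun j : 'I_k.+1 => supp_mx K [set i : 'I_n * 'I_1 | i.1 < sumn (take j x)]%N].

Lemma std_flagP (j : 'I_k.+1) (v : 'cV[K]_n) :
  reflect (forall i : 'I_n, (j <= level x i)%N -> v i 0 = 0) (v \in std_flag j).
Proof.
rewrite ffunE; apply: (iffP (supp_mxP _ _)) => h i; last first.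
  by move=> t; rewrite inE /= ord1 -level_lt // -leqNgt; apply: h.
by move=> ji; apply: h; rewrite inE /= -level_lt // -leqNgt.
Qed.

Lemma dim_std_flag (j : 'I_k.+1) : \dim (std_flag j) = sumn (take j x).
Proof.
rewrite ffunE dim_supp_mx.
have -> : [set i : 'I_n * 'I_1 | i.1 < sumn (take j x)]%N
    = finset.setX [set i : 'I_n | i < sumn (take j x)]%N finset.setT.
  by apply/setP => i; rewrite !inE andbT.
rewrite cardsX cardsT card_ord muln1 card_ord_lt //.
by apply: leq_trans (sumn_take_le x (leq_ord j)) _; rewrite take_size.
Qed.

Lemma std_flag_Fl : @Fl K x std_flag.
Proof.
split.
- by apply/eqP; rewrite -dimv_eq0 dim_std_flag take0.
- apply/eqP; rewrite eqEdim subvf dimvf dim_std_flag /= take_size /dim /=.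
  by rewrite muln1.
- move=> i; split; last first.
    by rewrite !dim_std_flag /= /bump /= add1n (take_nth 0%N) // sumn_rcons addKn.
  apply/subvP => v /std_flagP h; apply/std_flagP => t ti; apply: h.
  by apply: leq_trans ti; rewrite /= /bump add1n leqnSn.
Qed.

End Flags.

Lemma mxactP (K : fieldType) n (g : 'M[K]_n) (U : {vspace 'cV[K]_n}) v :
  reflect (exists2 u, u \in U & v = g *m u) (v \in mxact g U).
Proof. by apply: (iffP memv_imgP) => -[u uU ->]; exists u; rewrite ?lfunE. Qed.

Lemma mxactM (K : fieldType) n (g h : 'M[K]_n) (U : {vspace 'cV[K]_n}) : mxact (g *m h) U = mxact g (mxact h U).
Proof.
apply/vspaceP => v; apply/mxactP/mxactP => [[u uU ->]|[w /mxactP[u uU ->] ->]].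
  by exists (h *m u); rewrite ?mulmxA //; apply/mxactP; exists u.
by exists u; rewrite // mulmxA.
Qed.

Lemma mxact1 (K : fieldType) n (U : {vspace 'cV[K]_n}) : mxact 1%:M U = U.
Proof.
apply/vspaceP => v; apply/mxactP/idP => [[u uU ->]|vU]; first by rewrite mul1mx.
by exists v; rewrite ?mul1mx.
Qed.

Lemma dim_mxact (K : fieldType) n (g : 'M[K]_n) (U : {vspace 'cV[K]_n}) : g \in unitmx -> \dim (mxact g U) = \dim U.
Proof.
move=> gu; apply: limg_dim_eq; apply/eqP; rewrite -subv0; apply/subvP => v.
rewrite memv_cap memv_ker lfunE /= memv0 => /andP[_ /eqP gv].
by rewrite -[v](mulKmx gu) gv mulmx0.
Qed.

Section StdFlagStabilizer.
Variables (K : fieldType) (x : seq nat).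
Local Notation n := (sumn x).
Local Notation k := (size x).

Lemma std_flag_stab (g : 'M[K]_n) : g \in unitmx ->
  flact g (std_flag K x) = std_flag K x <->
  (forall s t : 'I_n, (level x t < level x s)%N -> g s t = 0).
Proof.
move=> gu; split=> [gF s t ts|h].
  have ht : (level x t < k)%N := level_size (ltn_ord t).
  have htS : ((level x t).+1 < k.+1)%N by [].
  have := congr1 (fun F : subspaces K x => F (Ordinal htS)) gF; rewrite ffunE => e.
  have /std_flagP/(_ s) : g *m delta_mx t 0 \in std_flag K x (Ordinal htS).
    rewrite -e; apply/mxactP; exists (delta_mx t 0) => //.
    apply/std_flagP => i /= ti; rewrite mxE; case: eqP ti => [->|//] /=.
    by rewrite ltnn.
  by rewrite -colE mxE; apply.
apply/ffunP => j; rewrite [LHS]ffunE; apply/eqP; rewrite eqEdim dim_mxact // leqnn andbT.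
apply/subvP => v /mxactP[u /std_flagP uj ->]; apply/std_flagP => i ji.
rewrite mxE big1 // => t _; case: (leqP j (level x t)) => jt; first by rewrite uj // mulr0.
by rewrite h ?mul0r // (leq_trans jt).
Qed.

(** A basis adapted to the flag, extended at each step by a basis of a complement of [U] in [V]. Its
    vectors become the columns of the transporter in [flag_transitive]. *)
Lemma flag_basis (F : subspaces K x) : @Fl K x F -> forall j : 'I_k.+1,
  exists X : seq 'cV[K]_n, [/\ free X, size X = sumn (take j x) &
    forall i : 'I_k.+1, (i <= j)%N -> F i = <<take (sumn (take i x)) X>>%VS].
Proof.
move=> [F0 Fn FS] [j]; elim: j => [|j IH] hj.
  exists [::]; split=> [||i]; rewrite ?nil_free ?take0 //= leqn0 => /eqP i0.
  by rewrite (_ : i = ord0) ?F0 ?span_nil //; apply: val_inj.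
have jk : (j < k)%N by [].
have [X [Xf Xs XF]] := IH (ltnW hj).
have [/= UV dUV] := FS (Ordinal jk).
set U := F _ in UV dUV; set V := F _ in UV dUV.
have UE : U = <<X>>%VS.
  have -> : U = F (Ordinal (ltnW hj)) by congr (F _); apply: val_inj.
  by rewrite (XF _ (leqnn _)) -Xs take_size.
have dX : \dim U = sumn (take j x) by rewrite UE (eqP Xf).
have sz : size (X ++ vbasis (V :\: U)%VS) = sumn (take j.+1 x).
  rewrite size_cat size_tuple Xs /= (take_nth 0%N) // sumn_rcons; congr (_ + _)%N.
  rewrite -dUV -{2}(addv_diff_cap V U) (capv_idPr UV) dimv_disjoint_sum ?addnK //.
  by apply/eqP; rewrite -subv0 -(capv_diff V U) capvS.
exists (X ++ vbasis (V :\: U)%VS); split=> //.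
- rewrite cat_free Xf (basis_free (vbasisP _)) (span_basis (vbasisP _)) /=.
  by apply/directv_addP; rewrite -UE capvC capv_diff.
- move=> i; rewrite leq_eqVlt => /orP[/eqP ij|ij].
    have -> : F i = V by congr (F _); apply: val_inj; rewrite /= /bump add1n -ij.
    rewrite ij take_oversize ?sz //.
    by rewrite span_cat (span_basis (vbasisP _)) -UE addvC addv_diff; apply/esym/addv_idPl.
  rewrite XF // takel_cat // Xs; exact: sumn_take_le.
Qed.

Lemma flag_transitive (F : subspaces K x) : @Fl K x F ->
  exists2 g : 'M[K]_n, g \in unitmx & flact g (std_flag K x) = F.
Proof.
move=> FF; have [X [Xf Xs XF]] := flag_basis FF ord_max.
rewrite /= take_size in Xs; have Xs' : size X == n by apply/eqP.
pose X' : n.-tuple 'cV[K]_n := Tuple Xs'.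
pose g : 'M[K]_n := \matrix_(i, t) X'`_t i 0.
have gE (u : 'cV_n) : g *m u = \sum_(t < n) u t 0 *: X'`_t.
  apply/matrixP => i j; rewrite !ord1 mxE summxE; apply: eq_bigr => t _.
  by rewrite !mxE mulrC.
have gu : g \in unitmx.
  rewrite -unitmx_tr -row_free_unit -kermx_eq0; apply/rowV0P => v /sub_kermxP vg.
  have /freeP/(_ (fun t => v 0 t)) h : free X' by [].
  apply/rowP => t; rewrite mxE; apply: h.
  rewrite (eq_bigr (fun t => v^T t 0 *: X'`_t)) => [|t' _]; last by rewrite mxE.
  by rewrite -gE -[g]trmxK -trmx_mul vg trmx0.
exists g => //; apply/ffunP => j; rewrite ffunE (XF j (leq_ord j)).
apply/eqP; rewrite eqEdim dim_mxact // dim_std_flag; apply/andP; split; last first.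
  by apply: leq_trans (dim_span _) _; rewrite size_take_min geq_minl.
apply/subvP => v /mxactP[u /std_flagP uj ->]; rewrite gE.
apply: memv_suml => t _; have [jt|tj] := leqP j (level x t); first by rewrite uj // scale0r mem0v.
apply/memvZ/memv_span; rewrite level_lt // in tj.
have -> : X'`_t = (take (sumn (take j x)) X)`_t by rewrite nth_take.
by apply: mem_nth; rewrite size_take_min leq_min tj Xs ltn_ord.
Qed.

End StdFlagStabilizer.

Section RowImage.
Variables (K : fieldType) (d n : nat).
Implicit Types M : 'M[K]_(d, n).

(** The span of the rows of [M], as column vectors: the action of [g] becomes right multiplication
    by [g^T]. *)
Definition row_image M : {vspace 'cV[K]_n} := (linfun (mulmx M^T) @: fullv)%VS.

Lemma row_imageP M v : reflect (exists u : 'cV_d, v = M^T *m u) (v \in row_image M).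
Proof.
by apply: (iffP memv_imgP) => [[u _ ->]|[u ->]]; exists u; rewrite ?lfunE ?memvf.
Qed.

Lemma mxact_row_image M (p : 'M[K]_n) (y : 'M[K]_d) : y \in unitmx ->
  mxact p (row_image M) = row_image (y *m M *m p^T).
Proof.
move=> yu; apply/vspaceP => v.
apply/mxactP/row_imageP => [[_ /row_imageP[u ->] ->]|[u ->]].
  by exists (invmx y^T *m u); rewrite !trmx_mul trmxK -!mulmxA mulKVmx ?unitmx_tr.
exists (M^T *m (y^T *m u)); last by rewrite !trmx_mul trmxK -!mulmxA.
by apply/row_imageP; exists (y^T *m u).
Qed.

Lemma dim_row_image M : row_free M -> \dim (row_image M) = d.
Proof.
move=> Mf; rewrite limg_dim_eq ?dimvf /dim /= ?muln1 //.
apply/eqP; rewrite -subv0; apply/subvP => v; rewrite memv_cap memv_ker lfunE /= memv0.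
move=> /andP[_ /eqP/(congr1 trmx)]; rewrite trmx_mul trmxK trmx0 => /eqP.
by rewrite mulmx_free_eq0 // -(inj_eq trmx_inj) trmx0 trmxK.
Qed.

Lemma Gr_row_image (W : {vspace 'cV[K]_n}) : \dim W = d ->
  exists2 M, row_free M & W = row_image M.
Proof.
move=> dW; have sX : size (vbasis W) == d by rewrite size_tuple dW.
pose X : d.-tuple 'cV[K]_n := Tuple sX.
have Xf : free X by apply: basis_free (vbasisP W).
have XW : W = <<X>>%VS by rewrite (span_basis (vbasisP W)).
pose M : 'M[K]_(d, n) := \matrix_(i, j) X`_i j 0.
have ME (u : 'cV_d) : M^T *m u = \sum_(t < d) u t 0 *: X`_t.
  apply/matrixP => i j; rewrite !ord1 mxE summxE; apply: eq_bigr => t _.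
  by rewrite !mxE mulrC.
exists M.
  rewrite -kermx_eq0; apply/rowV0P => v /sub_kermxP vM.
  have /freeP/(_ (fun t => v 0 t)) h := Xf.
  apply/rowP => t; rewrite mxE; apply: h.
  rewrite (eq_bigr (fun t => v^T t 0 *: X`_t)) => [|t' _]; last by rewrite mxE.
  by rewrite -ME -trmx_mul vM trmx0.
apply/vspaceP => v; rewrite XW; apply/idP/row_imageP => [/coord_span ->|[u ->]].
  by exists (\col_t coord X t v); rewrite ME; apply: eq_bigr => t _; rewrite mxE.
by rewrite ME; apply: memv_suml => t _; apply/memvZ/memv_span/mem_nth; rewrite size_tuple.
Qed.

End RowImage.

Section IndexOrder.
Variables (d : nat) (x y z : seq nat).
Local Notation n := (sumn x + (sumn y + sumn z))%N.

(* The coordinates of the [d] rows have arm [0]; those of the three flags have arms [1], [2], [3], and a level. *)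
Definition index_type (s : 'I_(d + n)) : nat * nat :=
  match split s with
  | inl _ => (0, 0)
  | inr t => match split t with
    | inl i => (1, level x i)
    | inr t' => match split t' with inl i => (2, level y i) | inr i => (3, level z i) end
    end
  end%N.

Definition index_arm s := (index_type s).1.

(** The levels are compared in reverse because the stabilizers of the standard flags, which are
    upper block triangular, act on the columns of [M] through their transposes. *)
Definition index_le (s t : 'I_(d + n)) : bool :=
  (index_arm s == index_arm t) && ((index_type t).2 <= (index_type s).2)%N.

Definition index_U : {set 'I_(d + n)} := [set s | index_arm s == 0%N].

Lemma index_type0 i : index_type (lshift _ i) = (0, 0)%N.
Proof. by rewrite /index_type (unsplitK (inl i)). Qed.

Lemma index_type1 i : index_type (rshift _ (lshift _ i)) = (1, level x i)%N.
Proof. by rewrite /index_type (unsplitK (inr _)) (unsplitK (inl i)). Qed.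

Lemma index_type2 i : index_type (rshift _ (rshift _ (lshift _ i))) = (2, level y i)%N.
Proof. by rewrite /index_type (unsplitK (inr _)) (unsplitK (inr _)) (unsplitK (inl i)). Qed.

Lemma index_type3 i : index_type (rshift _ (rshift _ (rshift _ i))) = (3, level z i)%N.
Proof. by rewrite /index_type (unsplitK (inr _)) (unsplitK (inr _)) (unsplitK (inr i)). Qed.

Definition index_typeE := (index_type0, index_type1, index_type2, index_type3).

Lemma index_le_refl : reflexive index_le.
Proof. by move=> s; rewrite /index_le eqxx leqnn. Qed.

Lemma index_le_trans : transitive index_le.
Proof.
move=> t s r /andP[/eqP e1 l1] /andP[/eqP e2 l2].
by rewrite /index_le e1 e2 eqxx (leq_trans l2).
Qed.

Lemma index_le_arm s t : index_le s t -> index_arm s = index_arm t.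
Proof. by case/andP=> /eqP. Qed.

Lemma index_ind (Q : 'I_(d + n) -> Prop) :
  (forall i, Q (lshift _ i)) -> (forall i, Q (rshift _ (lshift _ i))) ->
  (forall i, Q (rshift _ (rshift _ (lshift _ i)))) ->
  (forall i, Q (rshift _ (rshift _ (rshift _ i)))) -> forall s, Q s.
Proof.
move=> h0 h1 h2 h3 s; case: (split_ordP s) => [i ->//|s' ->].
by case: (split_ordP s') => [i ->//|s'' ->]; case: (split_ordP s'') => [i ->|i ->].
Qed.

Lemma index_arm_le (s t : 'I_(d + n)) : index_arm s = index_arm t -> (t <= s)%N -> index_le s t.
Proof.
elim/index_ind: s => i; elim/index_ind: t => j; rewrite /index_le /index_arm !index_typeE //=.
all: by rewrite ?leq_add2l => _ ij; apply: level_homo.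
Qed.

Lemma index_armU s t : index_arm s = index_arm t -> (s \in index_U) = (t \in index_U).
Proof. by rewrite !inE => ->. Qed.

Section IndexMatrices.
Variable K : closedFieldType.

Definition diag3 (p : 'M[K]_(sumn x) * 'M[K]_(sumn y) * 'M[K]_(sumn z)) : 'M[K]_n :=
  block_mx p.1.1 0 0 (block_mx p.1.2 0 0 p.2).

Definition flag_tri (w : seq nat) (p : 'M[K]_(sumn w)) : Prop :=
  forall s t : 'I_(sumn w), (level w s < level w t)%N -> p s t = 0.

Lemma index_incidence (b : 'M[K]_(d + n)) : incidence index_le b <->
  exists q p, [/\ b = block_mx q 0 0 (diag3 p), flag_tri p.1.1, flag_tri p.1.2 & flag_tri p.2].
Proof.
split=> [hb|[q [p [-> h1 h2 h3]]]].
  pose p := (ulsubmx (drsubmx b), ulsubmx (drsubmx (drsubmx b)), drsubmx (drsubmx (drsubmx b))).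
  have tri s t : index_arm s = index_arm t -> ((index_type s).2 < (index_type t).2)%N -> b s t = 0.
    by move=> e lt; apply: hb; rewrite /index_le e eqxx -ltnNge.
  have arm s t : index_arm s != index_arm t -> b s t = 0.
    by move=> ne; apply: hb; rewrite /index_le (negPf ne).
  exists (ulsubmx b), p; split.
  - apply/matrixP; elim/index_ind=> i; elim/index_ind=> j;
      rewrite ?(block_mxEul, block_mxEur, block_mxEdl, block_mxEdr) ?mxE //;
      by apply: arm; rewrite /index_arm !index_typeE.
  - by move=> s t st; rewrite !mxE; apply: tri; rewrite /index_arm ?index_typeE.
  - by move=> s t st; rewrite !mxE; apply: tri; rewrite /index_arm ?index_typeE.
  - by move=> s t st; rewrite !mxE; apply: tri; rewrite /index_arm ?index_typeE.
move=> s t; elim/index_ind: s => i; elim/index_ind: t => j;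
  rewrite /index_le /index_arm !index_typeE /= -?ltnNge
    ?(block_mxEul, block_mxEur, block_mxEdl, block_mxEdr) ?mxE //.
- exact: h1.
- exact: h2.
- exact: h3.
Qed.

Definition row_block (M : 'M[K]_(d, n)) : 'M[K]_(d + n) := block_mx 0 M 0 0.

Lemma coord_mx_U : coord_mx K index_U = block_mx 1%:M 0 0 0 /\
  coord_mx K (~: index_U) = block_mx 0 0 0 1%:M.
Proof.
split; apply/matrixP => s t; elim/index_ind: s => i; elim/index_ind: t => j;
  rewrite ?(block_mxEul, block_mxEur, block_mxEdl, block_mxEdr) !mxE !inE
    /index_arm ?index_typeE /= ?andbT ?andbF ?(inj_eq (@rshift_inj _ _))
    ?(inj_eq (@lshift_inj _ _)) ?eq_lrshift ?eq_rlshift //.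
Qed.

Lemma row_block_object (m : 'M[K]_(d + n)) : mx_object index_U finset.setT m <->
  exists2 M, row_free M & m = row_block M.
Proof.
rewrite /mx_object finset.setTI finset.setTD; have [-> ->] := coord_mx_U.
split=> [[mE inj]|[M Mf ->]].
  have mB : m = row_block (ursubmx m).
    by rewrite {1}mE -{1}[m]submxK !mulmx_block !(mul0mx, mulmx0, mul1mx, mulmx1, addr0, add0r).
  exists (ursubmx m) => //; rewrite -kermx_eq0; apply/rowV0P => v /sub_kermxP vM.
  have : row_mx v (0 : 'rV_n) = 0.
    apply: inj; first by rewrite mul_row_block !(mul0mx, mulmx0, mulmx1, addr0).
    by rewrite mB mul_row_block vM !(mul0mx, mulmx0, addr0) row_mx0.
  by move/(congr1 lsubmx); rewrite row_mxKl linear0.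
split; first by rewrite !mulmx_block !(mul0mx, mulmx0, mul1mx, mulmx1, addr0, add0r).
move=> u; rewrite -[u]hsubmxK !mul_row_block !(mul0mx, mulmx0, mulmx1, addr0) => /eq_row_mx[_ <-].
rewrite -[RHS]row_mx0 => /eq_row_mx[_ /eqP]; rewrite mulmx_free_eq0 // => /eqP ->.
by rewrite row_mx0.
Qed.

End IndexMatrices.
End IndexOrder.

Lemma flactM (K : fieldType) (x : seq nat) (g h : 'M[K]_(sumn x)) F :
  flact (g *m h) F = flact g (flact h F).
Proof. by apply/ffunP => j; rewrite !ffunE mxactM. Qed.

Lemma flact1 (K : fieldType) (x : seq nat) (F : subspaces K x) : flact 1%:M F = F.
Proof. by apply/ffunP => j; rewrite !ffunE mxact1. Qed.

Section Orbits.
Variables (K : closedFieldType) (l : quadruple).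
Let x := trunc (seqa l).
Let y := trunc (seqb l).
Let z := trunc (seqc l).
Let d := (paird l).1.
Local Notation n := (sumn x + (sumn y + sumn z))%N.

Lemma levi_embedM (g h : levi_mx K l) :
  levi_embed g *m levi_embed h = levi_embed (g.1.1 *m h.1.1, g.1.2 *m h.1.2, g.2 *m h.2).
Proof.
by rewrite /levi_embed !mulmx_block !(mul0mx, mulmx0, addr0, add0r).
Qed.

Lemma levi_embed1 : levi_embed ((1%:M, 1%:M, 1%:M) : levi_mx K l) = 1%:M.
Proof. by rewrite /levi_embed -!scalar_mx_block. Qed.

Lemma levi_embed_unit (g : levi_mx K l) : levi g -> levi_embed g \in unitmx.
Proof.
case=> g1 g2 g3; pose h : levi_mx K l := (invmx g.1.1, invmx g.1.2, invmx g.2).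
have : levi_embed g *m levi_embed h = 1%:M.
  by rewrite levi_embedM /= !mulmxV // levi_embed1.
by case/mulmx1_unit.
Qed.

Lemma levi_orbit_act (g : levi_mx K l) p : levi g -> levi_orbit (levi_act g p) = levi_orbit p.
Proof.
case=> g1 g2 g3; apply/seteqP; split=> _ [h [h1 h2 h3] <-].
  exists (h.1.1 *m g.1.1, h.1.2 *m g.1.2, h.2 *m g.2).
    by split; rewrite /= unitmx_mul; apply/andP.
  by rewrite /levi_act /= !flactM -levi_embedM mxactM.
exists (h.1.1 *m invmx g.1.1, h.1.2 *m invmx g.1.2, h.2 *m invmx g.2).
  by split; rewrite /= unitmx_mul unitmx_inv; apply/andP.
by rewrite /levi_act /= -!flactM -mxactM levi_embedM /= !mulmxKV.
Qed.

Definition flag_point (M : 'M[K]_(d, n)) : Defs.point K l :=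
  (std_flag K x, std_flag K y, std_flag K z, row_image M).

Lemma flag_point_variety M : row_free M -> flag_variety (flag_point M).
Proof.
move=> Mf; split; last exact: dim_row_image.
by split; [split|]; apply: std_flag_Fl.
Qed.

Lemma flag_variety_point (p : Defs.point K l) : flag_variety p ->
  exists2 M, row_free M & levi_orbit p = levi_orbit (flag_point M).
Proof.
case: p => [[[F1 F2] F3] W] [[[/= h1 h2] /= h3] /= hW].
have [g1 g1u <-] := flag_transitive h1; have [g2 g2u <-] := flag_transitive h2.
have [g3 g3u <-] := flag_transitive h3.
pose g : levi_mx K l := (g1, g2, g3).
have gu : levi_embed g \in unitmx by apply: levi_embed_unit.
pose W' := mxact (invmx (levi_embed g)) W.
have W'W : mxact (levi_embed g) W' = W by rewrite /W' -mxactM mulmxV // mxact1.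
have [M Mf WM] : exists2 M : 'M[K]_(d, n), row_free M & W' = row_image M.
  by apply: Gr_row_image; rewrite dim_mxact ?unitmx_inv.
exists M => //; rewrite -[RHS](levi_orbit_act (g := g)) //; congr levi_orbit.
by rewrite /levi_act /flag_point /= -WM; congr (_, _); rewrite -[LHS]W'W.
Qed.

Lemma flag_tri_stab w (g : 'M[K]_(sumn w)) : g \in unitmx ->
  flact g (std_flag K w) = std_flag K w <-> flag_tri g^T.
Proof.
by move=> gu; rewrite std_flag_stab //; split=> h s t st; have := h t s st; rewrite mxE.
Qed.

Lemma diag3_levi (p : levi_mx K l) : diag3 p = levi_embed p.
Proof. by []. Qed.

(** The block [q] only changes the basis of the subspace. The transpose of [p'], taken from the
    inverse [b'], is an element of [L] that fixes the three standard flags. *)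
Lemma equiv_orbit (M : 'M[K]_(d, n)) m' :
  mx_equiv (@index_le d x y z) finset.setT (row_block M) m' ->
  levi_orbit (flag_point M) = levi_orbit (flag_point (ursubmx m')).
Proof.
rewrite /mx_equiv coord_mxT => -[b [b' [[hb hb'] _ _ [bb' b'b] bm]]].
have [q [p [bE _ _ _]]] := (index_incidence b).1 hb.
have [q' [p' [b'E t1 t2 t3]]] := (index_incidence b').1 hb'.
have m'E : m' = row_block (q *m M *m diag3 p').
  rewrite -[m']mulmx1 -bb' mulmxA -bm bE b'E !mulmx_block.
  by rewrite !(mul0mx, mulmx0, addr0, add0r).
rewrite m'E block_mxKur.
move: bb'; rewrite bE b'E mulmx_block !(mul0mx, mulmx0, addr0, add0r) scalar_mx_block.
move=> /eq_block_mx[qq' _ _].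
rewrite !diag3_levi levi_embedM -levi_embed1 => /eq_block_mx[pp1 _ _ /eq_block_mx[pp2 _ _ pp3]].
pose g : levi_mx K l := (p'.1.1^T, p'.1.2^T, p'.2^T).
have gl : levi g.
  by split; rewrite unitmx_tr; [case/mulmx1_unit: pp1|case/mulmx1_unit: pp2|case/mulmx1_unit: pp3].
have [g1 g2 g3] := gl.
rewrite -[LHS](levi_orbit_act (g := g)) //; congr levi_orbit.
rewrite /levi_act /flag_point /=.
have -> : flact g.1.1 (std_flag K x) = std_flag K x by apply/flag_tri_stab; rewrite ?trmxK.
have -> : flact g.1.2 (std_flag K y) = std_flag K y by apply/flag_tri_stab; rewrite ?trmxK.
have -> : flact g.2 (std_flag K z) = std_flag K z by apply/flag_tri_stab; rewrite ?trmxK.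
rewrite (@mxact_row_image _ _ _ M _ q); last by case/mulmx1_unit: qq'.
by rewrite /levi_embed !tr_block_mx !trmx0 !trmxK.
Qed.

(** A group element relating the two points fixes the standard flags, so its inverse transpose is
    block triangular in the required sense; matrices of full row rank with the same row span differ
    by a unit [q]. *)
Lemma orbit_equiv (M M' : 'M[K]_(d, n)) : row_free M -> row_free M' ->
  levi_orbit (flag_point M) = levi_orbit (flag_point M') ->
  exists b b', [/\ incidence (@index_le d x y z) b, incidence (@index_le d x y z) b',
    b *m b' = 1%:M, b' *m b = 1%:M & b *m row_block M = row_block M' *m b].
Proof.
move=> Mf M'f eO.
have : levi_orbit (flag_point M) (flag_point M').
  rewrite eO; exists (1%:M, 1%:M, 1%:M); first by split; apply: unitmx1.
  by rewrite /levi_act /= !flact1 levi_embed1 mxact1.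
case=> g [g1 g2 g3] [] s1 s2 s3 sW.
have gu : levi_embed g \in unitmx by apply: levi_embed_unit.
have dWW : row_image (M *m (levi_embed g)^T) = row_image M'.
  by have := mxact_row_image M (levi_embed g) (unitmx1 K d); rewrite mul1mx => <-.
have [q qE] : exists q, q *m M *m (levi_embed g)^T = M'.
  have /submxP[q qE] : (M' <= M *m (levi_embed g)^T)%MS.
    apply/row_subP => i; rewrite -[row i M']trmxK.
    have /row_imageP[u] : (row i M')^T \in row_image (M *m (levi_embed g)^T).
      by rewrite dWW; apply/row_imageP; exists (delta_mx i 0); rewrite -colE tr_row.
    by move=> ->; rewrite trmx_mul trmxK submxMl.
  by exists q; rewrite qE mulmxA.
have qu : q \in unitmx.
  rewrite -row_free_unit -kermx_eq0; apply/rowV0P => v /sub_kermxP vq.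
  by apply/eqP; rewrite -(mulmx_free_eq0 v M'f) -qE !mulmxA vq !mul0mx.
pose p : levi_mx K l := ((invmx g.1.1)^T, (invmx g.1.2)^T, (invmx g.2)^T).
have inv w (h : 'M[K]_(sumn w)) : h \in unitmx -> flact h (std_flag K w) = std_flag K w ->
    flag_tri (invmx h)^T.
  move=> hu hs; apply/flag_tri_stab; first by rewrite unitmx_inv.
  by rewrite -{1}hs -flactM mulVmx // flact1.
pose b : 'M[K]_(d + n) := block_mx q 0 0 (diag3 p).
have hb : incidence (@index_le d x y z) b.
  by apply/index_incidence; exists q, p; split=> //; apply: inv.
have pg : (levi_embed g)^T *m diag3 p = 1%:M.
  rewrite diag3_levi.
  have -> : (levi_embed g)^T = levi_embed ((g.1.1^T, g.1.2^T, g.2^T) : levi_mx K l).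
    by rewrite /levi_embed !tr_block_mx !trmx0.
  by rewrite levi_embedM /= -!trmx_mul !mulVmx // !trmx1 levi_embed1.
pose b' : 'M[K]_(d + n) := block_mx (invmx q) 0 0 (levi_embed g)^T.
have b'b : b' *m b = 1%:M.
  by rewrite mulmx_block !(mul0mx, mulmx0, addr0, add0r) pg mulVmx // -scalar_mx_block.
have bb' := mulmx1C b'b.
have hb' : incidence (@index_le d x y z) b'.
  exact: (inc_inv (@index_le_refl d x y z) (@index_le_trans d x y z) hb bb').
exists b, b'; split=> //.
rewrite /row_block !mulmx_block !(mul0mx, mulmx0, addr0, add0r) -qE.
by rewrite -(mulmxA (q *m M)) pg mulmx1.
Qed.

Lemma finite_type_of_classes :
  (exists s : seq 'M[K]_(d + n), forall m, mx_object (@index_U d x y z) finset.setT m ->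
    exists m', [/\ m' \in s, coord_mx K finset.setT *m m' = m', m' *m coord_mx K finset.setT = m'
      & mx_equiv (@index_le d x y z) finset.setT m m']) ->
  finite_type K l.
Proof.
move=> [s sP].
apply: (@sub_finite_set _ _ [set levi_orbit (flag_point (ursubmx m)) | m in [set` s]]).
  move=> _ [p pV <-]; have [M Mf ->] := flag_variety_point pV.
  have [|m' [m's _ _ eq]] := sP (row_block M); first by apply/row_block_object; exists M.
  by exists m' => //; rewrite (equiv_orbit eq).
by apply: finite_image; apply: finite_seq.
Qed.

End Orbits.

End FlagVarieties.

(** * The Tits form of the flag problem *)

Lemma perm_eq3 (T : eqType) (a b c a' b' c' : T) :
  perm_eq [:: a; b; c] [:: a'; b'; c'] ->
  (a, b, c) = (a', b', c') \/ (a, b, c) = (a', c', b') \/ (a, b, c) = (b', a', c') \/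
  (a, b, c) = (b', c', a') \/ (a, b, c) = (c', a', b') \/ (a, b, c) = (c', b', a').
Proof.
have p2 (u v u' v' : T) : perm_eq [:: u; v] [:: u'; v'] -> (u, v) = (u', v') \/ (u, v) = (v', u').
  move=> p; have := perm_mem p u; rewrite !inE eqxx /= => /esym/orP[/eqP e|/eqP e]; subst u.
    by left; move: p; rewrite perm_cons => /(@perm_small_eq _ _ [:: _] isT)[->].
  right; have : perm_eq [:: v'; v] [:: v'; u'] by rewrite (permPl p) (perm_catC [:: u'] [:: v']).
  by rewrite perm_cons => /(@perm_small_eq _ _ [:: _] isT)[->].
move=> p; have := perm_mem p a; rewrite !inE eqxx /= => /esym/or3P[] /eqP e; subst a.
- by move: p; rewrite perm_cons => /p2[] [-> ->]; tauto.
- have : perm_eq [:: b'; b; c] [:: b'; a'; c'].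
    by rewrite (permPl p) (perm_catCA [:: a'] [:: b'] [:: c']).
  by rewrite perm_cons => /p2[] [-> ->]; tauto.
- have : perm_eq [:: c'; b; c] [:: c'; a'; b'].
    by rewrite (permPl p) (perm_catC [:: a'; b'] [:: c']).
  by rewrite perm_cons => /p2[] [-> ->]; tauto.
Qed.

Section TitsForm.
Variables (d : nat) (x y z : seq nat).
Local Notation N := (d + (sumn x + (sumn y + sumn z))).
Local Notation nz := (fun k : nat => k != 0).

Lemma arm_profile (w : seq nat) (a : nat) (inj : 'I_(sumn w) -> 'I_N) (C : {set 'I_N}) :
    injective inj -> (forall i, index_type (inj i) = (a, level w i)) ->
    (forall s : 'I_N, index_arm s = a -> exists i, s = inj i) ->
  exists e, [/\ all2 leq e [seq k <- w | k != 0], sumn e = #|[set s in C | index_arm s == a]| &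
    2 * (\sum_(s in [set s in C | index_arm s == a]) \sum_(t in C) index_le s t)
      = sumn e * sumn e + sumsq e].
Proof.
move=> inj_inj injE surj; set A := [set s in C | _].
pose f s := (@index_type d x y z s).2.
have fA s : s \in A -> exists2 i, s = inj i & f s = level w i.
  by rewrite inE => /andP[_ /eqP /surj[i ->]]; exists i; rewrite // /f injE.
have [|j|e [h1 h2 h3]] := @level_profile _ A f w.
- by move=> s /fA[i _ ->]; apply: level_size.
- rewrite -(card_level w j) -(card_imset _ inj_inj) subset_leq_card //.
  apply/fintype.subsetP => s; rewrite inE => /andP[/fA[i -> fi] /eqP fj].
  by apply/imsetP; exists i; rewrite // inE -fj fi.
exists e; split=> //; rewrite h2 -h3; congr (2 * _).
apply: eq_bigr => s sA; rewrite big_mkcond [RHS]big_mkcond /=; apply: eq_bigr => t _.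
have as_ : index_arm s = a by move: sA; rewrite inE => /andP[_ /eqP].
rewrite /A !inE /index_le as_ eq_sym /f; case: (t \in C) => //=.
by case: (_ == a).
Qed.

(** Each flag arm contributes the dimension of a parabolic, by [level_profile]. On arm 0 any two
    indices are comparable in both directions, which gives a full square. Doubling avoids halves. *)
Lemma tits_form (C : {set 'I_N}) :
  exists e1 e2 e3, [/\ [/\ all2 leq e1 (filter nz x), all2 leq e2 (filter nz y) & all2 leq e3 (filter nz z)],
    #|C :\: @index_U d x y z| = sumn e1 + sumn e2 + sumn e3 &
    2 * #|le_pairs (@index_le d x y z) C| =
      2 * (#|C :&: @index_U d x y z| * #|C :&: @index_U d x y z|)
      + (sumn e1 * sumn e1 + sumsq e1) + (sumn e2 * sumn e2 + sumsq e2)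
      + (sumn e3 * sumn e3 + sumsq e3)].
Proof.
pose r1 i : 'I_N := rshift d (lshift _ i); pose r2 i : 'I_N := rshift d (rshift _ (lshift _ i)).
pose r3 i : 'I_N := rshift d (rshift _ (rshift _ i)).
have [|s|e1 [h1 s1 q1]] := @arm_profile x 1 r1 C _ (@index_type1 d x y z).
- by move=> i j /rshift_inj/lshift_inj.
- by elim/index_ind: s => i; rewrite /index_arm index_typeE // => _; exists i.
have [|s|e2 [h2 s2 q2]] := @arm_profile y 2 r2 C _ (@index_type2 d x y z).
- by move=> i j /rshift_inj/rshift_inj/lshift_inj.
- by elim/index_ind: s => i; rewrite /index_arm index_typeE // => _; exists i.
have [|s|e3 [h3 s3 q3]] := @arm_profile z 3 r3 C _ (@index_type3 d x y z).
- by move=> i j /rshift_inj/rshift_inj/rshift_inj.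
- by elim/index_ind: s => i; rewrite /index_arm index_typeE // => _; exists i.
exists e1, e2, e3.
have mk (F : 'I_N -> nat) (A : {set 'I_N}) : \sum_(s in A) F s = \sum_s if s \in A then F s else 0.
  by rewrite big_mkcond.
have splitC (F : 'I_N -> nat) : \sum_(s in C) F s = \sum_(s in C :&: @index_U d x y z) F s +
    \sum_(s in [set s in C | index_arm s == 1]) F s + \sum_(s in [set s in C | index_arm s == 2]) F s
    + \sum_(s in [set s in C | index_arm s == 3]) F s.
  rewrite !mk -!big_split /=; apply: eq_bigr => s _.
  rewrite !inE; elim/index_ind: s => i; rewrite /index_arm !index_typeE; case: (_ \in C) => //=;
    by rewrite ?addn0.
split=> //.
  rewrite s1 s2 s3 -!sum1_card !mk -!big_split /=.
  apply: eq_bigr => s _; rewrite !inE.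
  by elim/index_ind: s => i; rewrite /index_arm !index_typeE; case: (_ \in C).
have -> : #|le_pairs (@index_le d x y z) C| = \sum_(s in C) \sum_(t in C) index_le s t.
  by rewrite -card_pairs; apply: eq_card => p; rewrite !inE.
rewrite splitC !mulnDr q1 q2 q3; congr (_ + _ + _ + _); congr (2 * _).
rewrite -sum_nat_const; apply: eq_bigr => s; rewrite !inE => /andP[sC /eqP s0].
rewrite -sum1_card [LHS]big_mkcond [RHS]big_mkcond /=; apply: eq_bigr => t _.
rewrite !inE; case: (t \in C) => //=; move: s0; rewrite /index_le /index_arm.
elim/index_ind: s sC => i _; rewrite !index_typeE // => _.
by elim/index_ind: t => j; rewrite !index_typeE.
Qed.

(* The Tits form of [C] is [#|le_pairs C| - #|C :&: U| * #|C :\: U|]. *)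
Lemma tits_index (d2 : nat) (x' y' z' : seq nat) : perm_eq [:: x'; y'; z'] [:: x; y; z] ->
    tits_list (filter nz x') (filter nz y') (filter nz z') (minn d d2) ->
  forall C : {set 'I_N}, C != finset.set0 ->
    #|C :\: @index_U d x y z| <= #|C :&: @index_U d x y z| + d2 ->
    #|C :&: @index_U d x y z| * #|C :\: @index_U d x y z| < #|le_pairs (@index_le d x y z) C|.
Proof.
move=> pxyz tl C C0; have [e1 [e2 [e3 [[h1 h2 h3] nE q]]]] := tits_form C.
have hd : #|C :&: @index_U d x y z| <= d.
  apply: (@leq_trans #|[set lshift (sumn x + (sumn y + sumn z)) i | i in 'I_d]|).
    apply: subset_leq_card; apply/fintype.subsetP => s; rewrite !inE => /andP[_].
    by elim/index_ind: s => i; rewrite /index_arm index_typeE // => _; apply: imset_f.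
  by apply: leq_trans (leq_imset_card _ _) _; rewrite card_ord.
have pos : 0 < #|C :&: @index_U d x y z| + (sumn e1 + sumn e2 + sumn e3).
  rewrite lt0n addn_eq0; apply/negP => /andP[/eqP u0 /eqP n0].
  have : #|C| = 0 by rewrite -(cardsID (@index_U d x y z)) u0 nE n0.
  by move/eqP; rewrite cards_eq0 (negPf C0).
rewrite nE => hn; move: hd pos hn q; set h := #|_ :&: _|; set B := #|le_pairs _ _|.
move: h B => h B hd pos hn q.
suff : 2 * h * (sumn e1 + sumn e2 + sumn e3) < 2 * (h * h) + (sumn e1 * sumn e1 + sumsq e1)
    + (sumn e2 * sumn e2 + sumsq e2) + (sumn e3 * sumn e3 + sumsq e3).
  by rewrite -q -mulnA ltn_pmul2l.
have T := @tits_of_list _ _ _ _ _ _ d d2 h.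
case: (perm_eq3 pxyz) => [|[|[|[|[|]]]]] [ex ey ez]; subst x' y' z';
  [have := T _ _ _ e1 e2 e3 h1 h2 h3 | have := T _ _ _ e1 e3 e2 h1 h3 h2
  |have := T _ _ _ e2 e1 e3 h2 h1 h3 | have := T _ _ _ e2 e3 e1 h2 h3 h1
  |have := T _ _ _ e3 e1 e2 h3 h1 h2 | have := T _ _ _ e3 e2 e1 h3 h2 h1] => /= TT;
  have := TT hd ltac:(lia) ltac:(lia) tl; lia.
Qed.

End TitsForm.

(** * The list of cases and the minimal quadruples *)

Local Notation nz := (fun k : nat => k != 0).

Lemma trunc_rcons (x : seq nat) k : trunc (rcons x k) = x.
Proof. by rewrite /trunc size_rcons /= -cats1 take_size_cat. Qed.

Lemma remove0_rcons (x : seq nat) k : remove0 (rcons x k) = rcons (filter nz x) k.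
Proof. by rewrite /remove0 trunc_rcons size_rcons /= -!cats1 drop_size_cat. Qed.

(** Lengths drop by one with the last entry. The list reads [a_1] only when [l_1 = 2] and [b_1, b_2]
    only when [l_2 = 3], hence never the last entry. *)
Lemma in_list_tits (a b c : seq nat) (u v w : nat) (d : nat * nat) :
  in_list (reduce (Quadruple (rcons a u) (rcons b v) (rcons c w) d)) <->
  tits_list (filter nz a) (filter nz b) (filter nz c) (minn d.1 d.2).
Proof.
rewrite /in_list /reduce /= !remove0_rcons !size_rcons /tits_list.
move: (filter nz a) (filter nz b) (filter nz c) (minn d.1 d.2) => r1 r2 r3 m.
have S1 (r : seq nat) k : (size r).+1 = k.+1 <-> size r = k by split=> [[]|->].
rewrite !S1 ltnS.
have n0 : size r1 = 1 -> nth 0 (rcons r1 u) 0 = nth 0 r1 0 by rewrite nth_rcons => ->.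
have n1 i : size r2 = 2 -> i < 2 -> nth 0 (rcons r2 v) i = nth 0 r2 i by rewrite nth_rcons => -> ->.
have [s1|s1] := eqVneq (size r1) 1; last first.
  by have ns1 : size r1 <> 1 := elimN eqP s1; tauto.
rewrite n0 //; have [s2|s2] := eqVneq (size r2) 2; last first.
  by have ns2 : size r2 <> 2 := elimN eqP s2; tauto.
by rewrite !n1.
Qed.

Section Cards.
Variables (d : nat) (x y z : seq nat).

Lemma card_index_U : #|@index_U d x y z| = d.
Proof.
have -> : @index_U d x y z = [set lshift (sumn x + (sumn y + sumn z)) i | i in 'I_d].
  apply/setP => s; apply/idP/imsetP => [|[i _ ->]]; last by rewrite inE /index_arm index_typeE.
  by elim/index_ind: s => i; rewrite inE /index_arm index_typeE // => _; exists i.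
by rewrite card_imset ?card_ord //; apply: lshift_inj.
Qed.

Lemma card_index_UC : #|~: @index_U d x y z| = sumn x + (sumn y + sumn z).
Proof. by have := cardsC (@index_U d x y z); rewrite card_index_U card_ord; lia. Qed.

End Cards.

Lemma finite_type_of_list (K : closedFieldType) (l m : quadruple) :
    perm_eq [:: trunc (seqa m); trunc (seqb m); trunc (seqc m)]
      [:: trunc (seqa l); trunc (seqb l); trunc (seqc l)] ->
    (paird l).1 + (paird l).2 = weight l ->
    tits_list (filter nz (trunc (seqa m))) (filter nz (trunc (seqb m)))
      (filter nz (trunc (seqc m))) (minn (paird l).1 (paird l).2) ->
  finite_type K l.
Proof.
move=> p dw tl; apply: finite_type_of_classes.
apply: (finite_classes K (@index_le_refl _ _ _ _) (@index_le_trans _ _ _ _)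
  (@index_le_arm _ _ _ _) (@index_armU _ _ _ _) (@index_arm_le _ _ _ _) (tits_index p tl)).
by rewrite finset.setTI finset.setTD card_index_U card_index_UC dw.
Qed.

(** Membership in [Lambda] forces the last entry of each sequence to be the weight carried by the
    other two. *)
Definition completed (a b c : seq nat) (d : nat * nat) : quadruple :=
  Quadruple (rcons a (sumn b + sumn c)) (rcons b (sumn a + sumn c)) (rcons c (sumn a + sumn b)) d.

Lemma completedP (l1 l2 l3 : nat) (l : quadruple) : 0 < l1 -> 0 < l2 -> 0 < l3 -> Lambda l1 l2 l3 l ->
  exists a b c, [/\ l = completed a b c (paird l), a = trunc (seqa l), b = trunc (seqb l),
    c = trunc (seqc l) & (paird l).1 + (paird l).2 = weight l].
Proof.
have rc (x : seq nat) k : size x = k -> 0 < k -> exists y w, x = rcons y w.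
  by case/lastP: x => [<-|y w] //; exists y, w.
case: l => xa xb xc d h1 h2 h3 [[/= sa sb sc] _ [/= ea eb ec ed]].
have [a [u xaE]] := rc _ _ sa h1; have [b [v xbE]] := rc _ _ sb h2.
have [c [w xcE]] := rc _ _ sc h3; subst xa xb xc.
rewrite /weight /= !trunc_rcons ?sumn_rcons in ea eb ec ed.
exists a, b, c; split; rewrite ?trunc_rcons ?/weight ?/= ?trunc_rcons //.
by congr Quadruple; congr rcons; lia.
Qed.

Lemma permuted_completed a b c d m : permuted m (completed a b c d) ->
  exists a' b' c', m = completed a' b' c' d /\ perm_eq [:: a'; b'; c'] [:: a; b; c].
Proof.
case: m => xa xb xc dm [/= /perm_eq3 p ->].
by case: p => [|[|[|[|[|]]]]] [-> -> ->];
  [exists a, b, c | exists a, c, b | exists b, a, c | exists b, c, a | exists c, a, b | exists c, b, a];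
  (split; [congr (Quadruple (rcons _ _) (rcons _ _) (rcons _ _) _); lia | apply/permP => P /=; lia]).
Qed.

Lemma dominated_rcons e s k x w : subseq s (filter nz x) -> all2 leq e s -> k <= w ->
  dominated (rcons e k) (rcons x w).
Proof.
move=> sx es kw; exists (rcons s w).
  by rewrite -!cats1 cat_subseq // (subseq_trans sx) // filter_subseq.
move: es; rewrite !all2E !size_rcons eqSS => /andP[/eqP sz h].
by rewrite sz eqxx zip_rcons // all_rcons h andbT.
Qed.

Lemma all2_ones j x : j <= size (filter nz x) -> all2 leq (nseq j 1) (take j (filter nz x)).
Proof.
elim: x j => [|k x IH] j /=; first by rewrite leqn0 => /eqP ->.
case: k => [|k] /=; first exact: IH.
by case: j => [|j] //= /IH.
Qed.

Lemma size_filter_sumn x : size (filter nz x) <= sumn x.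
Proof. by elim: x => //= [[|k] x] IH //=; rewrite addSn ltnS (leq_trans IH) // leq_addl. Qed.

(** Each failure of the list supplies one forbidden quadruple: two levels in the shortest arm give
    [lambda1]; three levels in the second arm give [lambda2]; entries at least 2 in the second arm
    and five levels in the third give [lambda3]. The last entries follow, being sums over the other
    two arms. *)
Lemma in_list_of_not_le a b c d :
    size (filter nz a) <= size (filter nz b) <= size (filter nz c) ->
    ~ quadruple_le lambda1 (completed a b c d) -> ~ quadruple_le lambda2 (completed a b c d) ->
    ~ quadruple_le lambda3 (completed a b c d) ->
  in_list (reduce (completed a b c d)).
Proof.
move=> /andP[ab bc] n1 n2 n3; apply/in_list_tits.
have fa := size_filter_sumn a; have fb := size_filter_sumn b; have fc := size_filter_sumn c.
have ones k j x w : j <= size (filter nz x) -> k <= w -> dominated (rcons (nseq j 1) k) (rcons x w).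
  by move=> jx; apply: dominated_rcons (all2_ones jx); apply: take_subseq.
have [s0|s0] := eqVneq (size (filter nz a)) 0; first by left.
right; have [m2|m2] := leqP (minn d.1 d.2) 2; first by left.
right; have [s1|s1] := leqP 2 (size (filter nz a)).
  case: n1; split; rewrite /=; [lia|lia|].
  by split; [apply: (ones 4 2)|apply: (ones 4 2)|apply: (ones 4 2)]; lia.
have {s0 s1} s1 : size (filter nz a) = 1 by lia.
have [m3|m3] := eqVneq (minn d.1 d.2) 3; first by left.
right; have [s22|s22] := eqVneq (size (filter nz b)) 1; first by right; split; tauto.
have nzf x k : k \in filter nz x -> 0 < k by rewrite mem_filter lt0n => /andP[].
have sumf x : sumn (filter nz x) = sumn x by elim: x => //= [[|k] x] IH //=; rewrite IH.
have [k fA] : exists k, filter nz a = [:: k].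
  by move: s1; case: (filter nz a) => [|k []] // _; exists k.
have a1 : 0 < k by apply: (nzf a); rewrite fA mem_head.
have ageq : k = sumn a by rewrite -(sumf a) fA /= addn0.
rewrite fA /=; have [a11|a11] := eqVneq k 1; first by right; tauto.
have [s3|s3] := leqP 3 (size (filter nz b)).
  case: n2; split; rewrite /=; [lia|lia|].
  split; last first.
  - by apply: (ones 5 3); lia.
  - by apply: (ones 5 3); lia.
  - apply: (@dominated_rcons [:: 2] [:: k]); [by rewrite fA|rewrite /= andbT|]; lia.
have {s3 s22} s2 : size (filter nz b) = 2 by lia.
have [m5|m5] := leqP (minn d.1 d.2) 5; first by left; split=> //; lia.
right; split=> //.
have [a12|a12] := eqVneq k 2; first by tauto.
have [c4|c4] := leqP (size (filter nz c)) 4; first by do 3!right.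
have [k1 [k2 fB]] : exists k1 k2, filter nz b = [:: k1; k2].
  by move: s2; case: (filter nz b) => [|k1 [|k2 []]] // _; exists k1, k2.
have b10 : 0 < k1 by apply: (nzf b); rewrite fB mem_head.
have b11 : 0 < k2 by apply: (nzf b); rewrite fB !inE eqxx orbT.
have bgeq : k1 + k2 = sumn b by rewrite -(sumf b) fB /= addn0.
rewrite fB /=; have [b1|b1] := eqVneq (minn k1 k2) 1; first by tauto.
case: n3; split; rewrite /=; [lia|lia|].
have [b2 b2'] : 2 <= k1 /\ 2 <= k2 by lia.
split.
- apply: (@dominated_rcons [:: 3] [:: k]); [by rewrite fA|rewrite /= andbT|]; lia.
- by apply: (@dominated_rcons [:: 2; 2] [:: k1; k2]); [rewrite fB|rewrite /= b2 b2'|lia].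
- by apply: (ones 7 5); lia.
Qed.

Lemma sort3 (T : eqType) (f : T -> nat) (a b c : T) :
  exists a' b' c', perm_eq [:: a'; b'; c'] [:: a; b; c] /\ f a' <= f b' <= f c'.
Proof.
pose r := relpre f leq; have p := permEl (perm_sort r [:: a; b; c]).
have tot : total r by move=> s t; apply: leq_total.
have := sort_sorted tot [:: a; b; c]; have := perm_size p; move: p.
case: (sort r _) => [|a' [|b' [|c' []]]] //= p _; rewrite andbT => h.
by exists a', b', c'.
Qed.

(** * Infinitely many orbits from a family of Hom-orthogonal objects *)

Section InfiniteFamilies.
Local Open Scope ring_scope.

Lemma rank_orthogonal_idempotents (F : fieldType) n (e f : 'M[F]_n) :
  e *m e = e -> f *m f = f -> e *m f = 0 -> f *m e = 0 ->
  (\rank e + \rank f <= \rank (e + f)%R)%N.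
Proof.
move=> ee ff ef fe.
have cap0 : (e :&: f)%MS = 0.
  apply/eqP/rowV0P => v; rewrite sub_capmx => /andP[/submxP[a va] /submxP[b vb]].
  have ve : v *m e = v by rewrite va -mulmxA ee.
  by rewrite -ve vb -mulmxA fe mulmx0.
rewrite -[leqLHS]mxrank_sum_cap cap0 mxrank0 addn0 mxrankS // addsmx_sub; apply/andP; split.
  have {1}-> : e = e *m (e + f) by rewrite mulmxDr ee ef addr0.
  exact: submxMl.
have {1}-> : f = f *m (e + f) by rewrite mulmxDr ff fe add0r.
exact: submxMl.
Qed.

Lemma size_orthogonal_idempotents (F : fieldType) n (T : eqType) (e : T -> 'M[F]_n) (ts : seq T) :
  uniq ts -> (forall t, t \in ts -> e t *m e t = e t) -> (forall t, t \in ts -> e t != 0) ->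
  (forall s t, s \in ts -> t \in ts -> s != t -> e s *m e t = 0) -> (size ts <= n)%N.
Proof.
move=> uts idem nz orth; pose S (us : seq T) : 'M[F]_n := \sum_(t <- us) e t.
suff h us : uniq us -> {subset us <= ts} -> S us *m S us = S us /\ (size us <= \rank (S us))%N.
  by have [_ h1] := h ts uts (fun _ st => st); apply: leq_trans h1 (rank_leq_row _).
elim: us => [|t us IH] /= => [_ _|/andP[tus uus] sub].
  by rewrite /S big_nil mulmx0.
have tts : t \in ts by apply: sub; rewrite mem_head.
have sub' : {subset us <= ts} by move=> s sus; apply: sub; rewrite inE sus orbT.
have [SS rS] := IH uus sub'.
have neq s : s \in us -> s != t by move=> sus; apply: contraNneq tus => <-.
have eS : e t *m S us = 0.
  by rewrite mulmx_sumr big_seq big1 // => s sus; apply: (orth _ _ tts (sub' _ sus)); rewrite eq_sym neq.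
have Se : S us *m e t = 0.
  by rewrite mulmx_suml big_seq big1 // => s sus; apply: (orth _ _ (sub' _ sus) tts); rewrite neq.
have -> : S (t :: us) = e t + S us by rewrite /S big_cons.
rewrite !mulmxDr !mulmxDl idem // SS eS Se add0r addr0; split=> //.
apply: leq_trans (rank_orthogonal_idempotents (idem _ tts) SS eS Se).
by rewrite -add1n leq_add // lt0n mxrank_eq0 nz.
Qed.

Section Embedding.
Variables (K : closedFieldType) (N' N : nat) (le' : rel 'I_N') (le : rel 'I_N).
Variables (U' : {set 'I_N'}) (U : {set 'I_N}) (J : 'I_N' -> 'I_N).
Hypotheses (J_inj : injective J) (J_le : forall s t, le (J s) (J t) = le' s t).
Hypothesis J_U : forall s, (J s \in U) = (s \in U').

Definition embed_mx : 'M[K]_(N', N) := \matrix_(s, t) (J s == t)%:R.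
Local Notation Jm := embed_mx.

Lemma mul_embed_mx n (x : 'M[K]_(N, n)) s t : (Jm *m x) s t = x (J s) t.
Proof.
rewrite mxE (bigD1 (J s)) //= mxE eqxx mul1r big1 ?addr0 // => k /negPf nk.
by rewrite mxE eq_sym nk mul0r.
Qed.

Lemma mul_mx_embedT n (x : 'M[K]_(n, N)) s t : (x *m Jm^T) s t = x s (J t).
Proof. by rewrite -[x *m _]trmxK trmx_mul trmxK mxE mul_embed_mx mxE. Qed.

Lemma embed_mxK : Jm *m Jm^T = 1%:M.
Proof. by apply/matrixP => s t; rewrite mul_embed_mx !mxE (inj_eq J_inj) eq_sym. Qed.

Lemma embed_mx_U : coord_mx K U *m Jm^T = Jm^T *m coord_mx K U' /\
  Jm *m coord_mx K (~: U) = coord_mx K (~: U') *m Jm.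
Proof.
split; apply/matrixP => i j.
  rewrite mul_coord_mx mul_mx_coord !mxE -J_U; case: eqP => [->//|_]; by rewrite !if_same.
rewrite mul_coord_mx mul_mx_coord !mxE !inE -J_U; case: eqP => [<-//|_]; by rewrite !if_same.
Qed.

(** [n0] is the matrix of an injection from the rows outside the image of [J] to the columns outside
    it. It completes each member of the family to a matrix of full row rank. *)
Lemma embed_complement : (#|U :\: [set J s | s in 'I_N']| <= #|~: U :\: [set J s | s in 'I_N']|)%N ->
  exists n0 : 'M[K]_N, [/\ n0 = coord_mx K U *m n0 *m coord_mx K (~: U),
    Jm *m n0 = 0, n0 *m Jm^T = 0 &
    forall u : 'rV[K]_N, u *m n0 = 0 -> forall i, i \in U -> i \notin [set J s | s in 'I_N'] -> u 0 i = 0].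
Proof.
set A := U :\: _; set B := ~: U :\: _ => AB.
have Jn s : J s \notin A /\ J s \notin B.
  by rewrite !inE negb_and negbK negb_and negbK imset_f.
pose iota i := nth i (enum B) (index i (enum A)).
have idx i : i \in A -> (index i (enum A) < size (enum B))%N.
  by move=> iA; rewrite -cardE; apply: leq_trans AB; rewrite cardE index_mem mem_enum.
have iotaB i : i \in A -> iota i \in B by move=> iA; rewrite -mem_enum mem_nth ?idx.
have iota_inj i j : i \in A -> j \in A -> iota i = iota j -> i = j.
  move=> iA jA e; have ei : index i (enum A) = index j (enum A).
    apply/eqP; rewrite -(nth_uniq i _ _ (enum_uniq B)) ?idx // -/(iota i) e.
    by rewrite (set_nth_default j) ?idx.
  by rewrite -[LHS](nth_index i (s := enum A)) ?mem_enum // ei nth_index ?mem_enum.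
pose n0 : 'M[K]_N := \matrix_(i, j) ((i \in A) && (iota i == j))%:R.
exists n0; split.
- apply/matrixP => i j; rewrite mul_mx_coord mul_coord_mx mxE.
  case: (boolP (i \in A)) => iA /=; last by rewrite !if_same.
  have iU : i \in U by move: iA; rewrite inE => /andP[].
  rewrite iU; case: eqP => [<-|_]; last by rewrite if_same.
  by have := iotaB _ iA; rewrite inE => /andP[_ ->].
- by apply/matrixP => s j; rewrite mul_embed_mx !mxE (negPf (Jn s).1).
- apply/matrixP => i s; rewrite mul_mx_embedT !mxE.
  case: (boolP (i \in A)) => //= iA; case: eqP => // e.
  by have := iotaB _ iA; rewrite e (negPf (Jn s).2).
- move=> u un i iU niJ; have iA : i \in A by rewrite inE niJ.
  have := congr1 (fun v : 'rV_N => v 0 (iota i)) un; rewrite !mxE (bigD1 i) //= mxE iA eqxx mulr1.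
  rewrite big1 ?addr0 // => k nk; rewrite mxE; case: (boolP (k \in A)) => kA; last by rewrite mulr0.
  by case: eqP => [e|_]; rewrite ?mulr0 //; case/eqP: nk; apply: iota_inj.
Qed.

Section Family.
Variables (n0 : 'M[K]_N) (c : K -> 'M[K]_N').
Hypothesis n0E : n0 = coord_mx K U *m n0 *m coord_mx K (~: U).
Hypotheses (Jn0 : Jm *m n0 = 0) (n0J : n0 *m Jm^T = 0).
Hypothesis n0_inj : forall u : 'rV[K]_N, u *m n0 = 0 ->
  forall i, i \in U -> i \notin [set J s | s in 'I_N'] -> u 0 i = 0.
Hypothesis c_obj : forall t, mx_object U' finset.setT (c t).
Hypothesis c_hom : forall s t, s != t ->
  forall h, incidence le' h -> c t *m h = h *m c s -> h = 0.

Definition extended (t : K) : 'M[K]_N := Jm^T *m c t *m Jm + n0.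

Lemma extended_object t : mx_object U finset.setT (extended t).
Proof.
have [UJ JU] := embed_mx_U; have [cE inj] := c_obj t.
rewrite /mx_object !finset.setTI !finset.setTD in cE inj *; split.
  rewrite /extended mulmxDr mulmxDl -n0E; congr (_ + _).
  by rewrite {1}cE !mulmxA UJ -!mulmxA JU.
move=> u uU um; pose w := u *m Jm^T.
have wm : w *m c t = 0.
  move/(congr1 (mulmx^~ Jm^T)): um; rewrite mul0mx mulmxDr mulmxDl -(mulmxA u n0) n0J mulmx0 addr0.
  by rewrite !mulmxA -(mulmxA _ Jm) embed_mxK mulmx1.
have w0 : w = 0 by apply: inj => //; rewrite -mulmxA -UJ mulmxA uU.
have un : u *m n0 = 0 by move: um; rewrite mulmxDr !mulmxA -/w w0 !mul0mx add0r.
apply/rowP => i; rewrite mxE; have [iU|niU] := boolP (i \in U); last first.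
  by rewrite -uU mul_mx_coord (negPf niU).
have [/imsetP[s _ ->]|niJ] := boolP (i \in [set J s | s in 'I_N']); last exact: n0_inj.
by rewrite -(mul_mx_embedT u) -/w w0 mxE.
Qed.

Lemma embed_incidence (g : 'M[K]_N) : incidence le g -> incidence le' (Jm *m g *m Jm^T).
Proof. by move=> hg s t st; rewrite mul_mx_embedT mul_embed_mx hg // J_le. Qed.

(** Each isomorphism to the common object [X] carries the projection [D] onto the family part to a
    nonzero idempotent [e t]. The product [e s *m e t] passes through the compression of an
    isomorphism between two extended members. *)
Lemma isomorphic_family_bound (X : 'M[K]_N) (ts : seq K) : (0 < N')%N -> transitive le ->
    uniq ts -> (forall t, t \in ts -> exists b b', [/\ incidence le b, incidence le b',
      b *m b' = 1%:M, b' *m b = 1%:M & b *m extended t = X *m b]) ->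
  (size ts <= N)%N.
Proof.
move=> N'0 le_tr uts iso.
have [B BP] : exists B : K -> 'M[K]_N * 'M[K]_N, forall t, t \in ts ->
    [/\ incidence le (B t).1, incidence le (B t).2, (B t).1 *m (B t).2 = 1%:M,
      (B t).2 *m (B t).1 = 1%:M & (B t).1 *m extended t = X *m (B t).1].
  have /choice[B BP] : forall t, exists B : 'M[K]_N * 'M[K]_N, t \in ts ->
    [/\ incidence le B.1, incidence le B.2, B.1 *m B.2 = 1%:M,
      B.2 *m B.1 = 1%:M & B.1 *m extended t = X *m B.1].
    move=> t; have [/iso[b [b' h]]|] := boolP (t \in ts); last by exists (0, 0).
    by exists (b, b').
  by exists B.
pose D := Jm^T *m Jm.
have DD : D *m D = D by rewrite !mulmxA -(mulmxA Jm^T) embed_mxK mulmx1.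
have DE : D = Jm^T *m Jm by [].
clearbody D; pose e t := (B t).1 *m D *m (B t).2.
apply: (@size_orthogonal_idempotents _ _ _ e) => //.
- move=> t /BP[_ _ _ b'b _]; rewrite /e -!mulmxA (mulmxA (B t).2) b'b mul1mx.
  by rewrite (mulmxA D) DD.
- move=> t /BP[_ _ _ b'b _]; apply/eqP => e0.
  have : D = 0.
    move/(congr1 (fun x => (B t).2 *m x *m (B t).1)): e0; rewrite /e !mulmxA b'b mul1mx.
    by rewrite -mulmxA b'b mulmx1 mulmx0 mul0mx.
  move/(congr1 (fun x => Jm *m x *m Jm^T)); rewrite mulmx0 mul0mx DE !mulmxA embed_mxK mul1mx embed_mxK.
  move/matrixP/(_ (Ordinal N'0) (Ordinal N'0))/eqP; rewrite !mxE eqxx.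
  by rewrite oner_eq0.
- move=> s t /BP[is1 is2 ss' s's sm] /BP[it1 it2 tt' t't tm] st.
  pose g := (B s).2 *m (B t).1.
  have gm : g *m extended t = extended s *m g.
    rewrite -mulmxA tm mulmxA.
    have -> : (B s).2 *m X = extended s *m (B s).2.
      by rewrite -[X]mulmx1 -ss' !mulmxA -(mulmxA _ X) -sm !mulmxA s's mul1mx.
    by rewrite mulmxA.
  have ig : incidence le g by apply: incM.
  have gE : (B s).2 *m (B t).1 = g by [].
  clearbody g.
  (* Since [n0] vanishes against the embedded part on both sides, the compression of [g] is a
     homomorphism between two distinct members of the family. *)
  have h0 : Jm *m g *m Jm^T = 0.
    apply: (c_hom (s := t) (t := s)); first by rewrite eq_sym.
      exact: embed_incidence.
    have Jex r : Jm *m extended r = c r *m Jm.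
      by rewrite mulmxDr Jn0 addr0 !mulmxA embed_mxK mul1mx.
    have exJ r : extended r *m Jm^T = Jm^T *m c r.
      by rewrite mulmxDl n0J addr0 -!mulmxA embed_mxK mulmx1.
    by rewrite !mulmxA -Jex -(mulmxA Jm) -gm -!mulmxA exJ.
  rewrite /e -!mulmxA (mulmxA (B s).2) gE DE -!mulmxA.
  by rewrite (mulmxA Jm g) (mulmxA _ Jm^T) h0 mul0mx !mulmx0.
Qed.

End Family.
End Embedding.

Lemma pigeonhole_fiber (T : Type) (S : set T) (f : nat -> T) (n : nat) :
  finite_set S -> (forall k, S (f k)) ->
  exists ks : seq nat, [/\ uniq ks, (n <= size ks)%N & exists y, forall k, k \in ks -> f k = y].
Proof.
move=> fS fk.
have [y iy] : exists y, infinite_set [set k | f k = y]%classic.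
  apply: contrapT => no; apply: infinite_nat.
  apply: (@sub_finite_set _ _ (\bigcup_(y in S) [set k | f k = y])%classic).
    by move=> k _; exists (f k).
  apply: bigcup_finite => // y _; apply: contrapT => iy; apply: no.
  by exists y.
have [B BA Bn] := @infinite_set_fset _ _ n iy.
by exists (enum_fset B); split; [exact: fset_uniq | exact: Bn | exists y => k kB; apply: BA].
Qed.

Section Infinite.
Variables (K : closedFieldType) (charK : [pchar K] =i pred0) (l : quadruple).
Let x := trunc (seqa l).
Let y := trunc (seqb l).
Let z := trunc (seqc l).
Let d := (paird l).1.
Variables (h : nat) (e1 e2 e3 : seq nat).
Local Notation N' := (h + (sumn e1 + (sumn e2 + sumn e3)))%N.
Local Notation N := (d + (sumn x + (sumn y + sumn z)))%N.
Variable F : K -> 'M[K]_(h, sumn e1 + (sumn e2 + sumn e3)).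
Hypothesis F_free : forall t, row_free (F t).
Hypothesis F_hom : forall s t, s != t -> forall q (p : 'M[K]_(sumn e1) * 'M[K]_(sumn e2) * 'M[K]_(sumn e3)),
  flag_tri p.1.1 -> flag_tri p.1.2 -> flag_tri p.2 ->
  F t *m diag3 p = q *m F s -> q = 0 /\ p = (0, 0, 0).
Hypothesis h0 : (0 < h)%N.
Variable J : 'I_N' -> 'I_N.
Hypothesis J_inj : injective J.
Hypothesis J_le : forall s t, @index_le d x y z (J s) (J t) = @index_le h e1 e2 e3 s t.
Hypothesis J_U : forall s, (J s \in @index_U d x y z) = (s \in @index_U h e1 e2 e3).
Hypothesis d2_le : (sumn e1 + (sumn e2 + sumn e3) <= h + (paird l).2)%N.
Hypothesis lw : ((paird l).1 + (paird l).2 = weight l)%N.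
Hypothesis hd : (h <= d)%N.

Lemma infinite_type : ~ finite_type K l.
Proof.
pose U := @index_U d x y z; pose U' := @index_U h e1 e2 e3; pose im := [set J s | s in 'I_N'].
have imE (A : {set 'I_N}) (A' : {set 'I_N'}) : (forall s, (J s \in A) = (s \in A')) ->
    (#|A :\: im| = #|A| - #|A'|)%N.
  move=> AA'; rewrite cardsD; congr (_ - _)%N.
  rewrite -(card_imset _ J_inj); apply: eq_card => i; rewrite !inE.
  apply/andP/imsetP => [[iA /imsetP[s _ e]]|[s sA ->]]; last by rewrite AA' sA imset_f.
  by exists s; rewrite // -AA' -e.
have [|n0 [n0E Jn0 n0J n0_inj]] := @embed_complement K N' N U J.
  rewrite (imE U U') // (imE (~: U) (~: U')); last by move=> s; rewrite !finset.in_setC J_U.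
  by rewrite !card_index_U !card_index_UC; move: lw; rewrite /weight -/x -/y -/z -/d; lia.
pose c t := row_block (F t) : 'M[K]_N'.
have c_obj t : mx_object U' finset.setT (c t) by apply/row_block_object; exists (F t).
have c_hom s t : s != t -> forall g, incidence (@index_le h e1 e2 e3) g -> c t *m g = g *m c s -> g = 0.
  move=> st g /index_incidence[q [p [-> t1 t2 t3]]].
  rewrite /c /row_block !mulmx_block !(mul0mx, mulmx0, addr0, add0r) => /eq_block_mx[_ e _ _].
  have [-> ->] := F_hom st t1 t2 t3 e.
  by rewrite /diag3 /= !block_mx0.
pose m t := extended J n0 c t.
have m_obj t : mx_object U finset.setT (m t) := extended_object J_inj J_U n0E n0J n0_inj c_obj t.
have mM t : exists2 M, row_free M & m t = row_block M by apply/row_block_object.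
have /choice[M MP] : forall t, exists M : 'M[K]_(d, sumn x + (sumn y + sumn z)), row_free M /\ m t = row_block M.
  by move=> t; have [M] := mM t; exists M.
(* The natural numbers serve as parameters; characteristic zero keeps them distinct in [K]. With
   finitely many orbits, [N.+1] of them share one. *)
move=> fin; pose f k := levi_orbit (flag_point (M (k%:R))).
have [|ks [uks sks [o oP]]] := @pigeonhole_fiber _ _ f N.+1 fin.
  move=> k; exists (flag_point (M k%:R)) => //; apply: flag_point_variety.
  by have [] := MP k%:R.
have : (0 < size ks)%N by apply: leq_trans sks.
case: ks uks sks oP => // k0 ks uks sks oP _.
have : (size [seq k%:R : K | k <- k0 :: ks] <= N)%N.
  apply: (isomorphic_family_bound J_inj J_le Jn0 n0J c_hom (X := m k0%:R)).
  - by rewrite addn_gt0 h0.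
  - exact: index_le_trans.
  - rewrite map_inj_uniq // => i j ij; apply: contrapT => /eqP ne.
    wlog lt : i j ij ne / (i < j)%N.
      by move=> wl; case: (ltngtP i j) => [|/wl-/(_ (esym ij))|/eqP]; [exact: wl|rewrite eq_sym; apply|rewrite (negPf ne)].
    have := (pcharf0P K).1 charK (j - i)%N; rewrite natrB 1?ltnW // ij subrr eqxx => /esym/eqP; lia.
  - move=> _ /mapP[k kks ->].
    have [Mf mE] := MP k%:R; have [Mf0 mE0] := MP k0%:R.
    have eo : levi_orbit (flag_point (M k%:R)) = levi_orbit (flag_point (M k0%:R)).
      by rewrite -/(f k) -/(f k0) !oP ?mem_head.
    have [b [b' hb]] := orbit_equiv Mf Mf0 eo.
    by exists b, b'; rewrite -/(m k%:R) mE mE0.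
by rewrite size_map leqNgt sks.
Qed.

End Infinite.

End InfiniteFamilies.

(** Each block of [e] goes to an initial segment of the block of [x] that dominates it; skipped
    blocks of [x] shift the levels without reordering them. *)
Lemma level_embedding (e s x : seq nat) : subseq s x -> all2 leq e s ->
  exists iota : nat -> nat, [/\ forall i, i < sumn e -> iota i < sumn x,
    forall i j, i < sumn e -> j < sumn e -> iota i = iota j -> i = j &
    forall i j, i < sumn e -> j < sumn e ->
      (level x (iota i) <= level x (iota j)) = (level e i <= level e j)].
Proof.
elim: x s e => [|k x IH] s e.
  by rewrite subseq0 => /eqP ->; case: e => // _; exists id.
case: s => [|m s] /=; first by case: e => // _ _; exists id.
have lk u : (if k + u < k then 0 else (level x (k + u - k)).+1) = (level x u).+1.
  by rewrite ltnNge leq_addr addKn.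
case: eqP => [->|_] sx; last first.
  case/(IH _ e sx) => iota [h1 h2 h3]; exists (fun i => k + iota i); split.
  - by move=> i ie; rewrite /= ltn_add2l h1.
  - by move=> i j ie je /addnI; apply: h2.
  - by move=> i j ie je; rewrite !lk ltnS h3.
case: e => // a e /= /andP[ak /(IH _ e sx)[iota [h1 h2 h3]]].
exists (fun i => if i < a then i else k + iota (i - a)); split.
- move=> i ie; have [ia|ia] := ltnP i a; first lia.
  by rewrite ltn_add2l h1 //; lia.
- move=> i j ie je; have [ia|ia] := ltnP i a; have [ja|ja] := ltnP j a; [by []|lia|lia|].
  by move/addnI/h2 => h; have := h ltac:(lia) ltac:(lia); lia.
- move=> i j ie je; have ka u : u < a -> (u < k) = true by lia.
  case: (ltnP i a) => ia; case: (ltnP j a) => ja.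
  + by rewrite !ka.
  + by rewrite (ka _ ia).
  + by rewrite (ka _ ja) ltnNge leq_addr.
  + by rewrite !ltnNge !leq_addr /= !addKn !ltnS h3 //; lia.
Qed.

Section IndexEmbedding.
Variables (d : nat) (x y z : seq nat).
Local Notation N := (d + (sumn x + (sumn y + sumn z))).

Definition arm_embedding (a : nat) (e : seq nat) (rho : 'I_(sumn e) -> 'I_N) : Prop :=
  [/\ injective rho, forall i, index_arm (rho i) = a &
    forall i j, index_le (rho i) (rho j) = (level e j <= level e i)].

Lemma arm_embedding_exists (w : seq nat) (a : nat) (r : 'I_(sumn w) -> 'I_N) (e s : seq nat) :
    injective r -> (forall i, index_type (r i) = (a, level w i)) ->
    subseq s w -> all2 leq e s ->
  exists rho : 'I_(sumn e) -> 'I_N, arm_embedding a rho.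
Proof.
move=> r_inj rE sw es; have [iota [h1 h2 h3]] := level_embedding sw es.
exists (fun i : 'I_(sumn e) => r (Ordinal (h1 i (ltn_ord i)))); split.
- by move=> i j /r_inj[] /h2 e0; apply: val_inj; apply: e0.
- by move=> i; rewrite /index_arm rE.
- by move=> i j; rewrite /index_le /index_arm !rE eqxx /= h3.
Qed.

Lemma glue_embeddings (h : nat) (e1 e2 e3 : seq nat) (a1 a2 a3 : nat)
    (rho1 : 'I_(sumn e1) -> 'I_N) (rho2 : 'I_(sumn e2) -> 'I_N) (rho3 : 'I_(sumn e3) -> 'I_N) :
    h <= d -> arm_embedding a1 rho1 -> arm_embedding a2 rho2 -> arm_embedding a3 rho3 ->
    uniq [:: 0; a1; a2; a3] ->
  exists J : 'I_(h + (sumn e1 + (sumn e2 + sumn e3))) -> 'I_N,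
    [/\ injective J, forall s t, index_le (J s) (J t) = index_le s t &
      forall s, (J s \in @index_U d x y z) = (s \in @index_U h e1 e2 e3)].
Proof.
move=> hd [i1 A1 L1] [i2 A2 L2] [i3 A3 L3]; rewrite /= !inE !negb_or !andbT.
move=> /and3P[/and3P[n1 n2 n3] /andP[n12 n13] n23].
pose J (s : 'I_(h + (sumn e1 + (sumn e2 + sumn e3)))) : 'I_N :=
  match split s with
  | inl i => lshift _ (widen_ord hd i)
  | inr t => match split t with
    | inl i => rho1 i
    | inr t' => match split t' with inl i => rho2 i | inr i => rho3 i end
    end
  end.
have J0 i : J (lshift _ i) = lshift _ (widen_ord hd i) by rewrite /J (unsplitK (inl i)).
have J1 i : J (rshift _ (lshift _ i)) = rho1 i.
  by rewrite /J (unsplitK (inr _)) (unsplitK (inl i)).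
have J2 i : J (rshift _ (rshift _ (lshift _ i))) = rho2 i.
  by rewrite /J (unsplitK (inr _)) (unsplitK (inr _)) (unsplitK (inl i)).
have J3 i : J (rshift _ (rshift _ (rshift _ i))) = rho3 i.
  by rewrite /J (unsplitK (inr _)) (unsplitK (inr _)) (unsplitK (inr i)).
have arm0 i : @index_arm d x y z (lshift _ i) = 0 by rewrite /index_arm index_type0.
have cong s t : s = t -> @index_arm d x y z s = index_arm t by move=> ->.
exists J; split.
- move=> s t; elim/index_ind: s => i; elim/index_ind: t => j; rewrite ?J0 ?J1 ?J2 ?J3 => e;
    have := cong _ _ e; rewrite ?arm0 ?A1 ?A2 ?A3 => ea;
    try by move: n1 n2 n3 n12 n13 n23; rewrite ea eqxx.
  + by move/lshift_inj: e => /(congr1 val) /= /val_inj ->.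
  + by rewrite (i1 _ _ e).
  + by rewrite (i2 _ _ e).
  + by rewrite (i3 _ _ e).
- move=> s t; elim/index_ind: s => i; elim/index_ind: t => j; rewrite ?J0 ?J1 ?J2 ?J3
    ?L1 ?L2 ?L3 /index_le ?arm0 ?A1 ?A2 ?A3 /index_arm ?index_typeE ?eqxx //=;
    rewrite ?(negPf n1) ?(negPf n2) ?(negPf n3) ?(negPf n12) ?(negPf n13) ?(negPf n23) //;
    by rewrite eq_sym ?(negPf n1) ?(negPf n2) ?(negPf n3) ?(negPf n12) ?(negPf n13) ?(negPf n23).
- move=> s; elim/index_ind: s => i; rewrite ?J0 ?J1 ?J2 ?J3 !inE ?arm0 ?A1 ?A2 ?A3 /index_arm
    ?index_typeE // eq_sym; by rewrite ?(negPf n1) ?(negPf n2) ?(negPf n3).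
Qed.

(** [index_le] compares arms only for equality, so the arms of the small problem may be sent to
    those of the large one in any order. *)
Lemma index_embedding (h : nat) (e1 e2 e3 s1 s2 s3 x' y' z' : seq nat) :
    h <= d -> perm_eq [:: x'; y'; z'] [:: x; y; z] ->
    subseq s1 x' -> subseq s2 y' -> subseq s3 z' ->
    all2 leq e1 s1 -> all2 leq e2 s2 -> all2 leq e3 s3 ->
  exists J : 'I_(h + (sumn e1 + (sumn e2 + sumn e3))) -> 'I_N,
    [/\ injective J, forall s t, index_le (J s) (J t) = index_le s t &
      forall s, (J s \in @index_U d x y z) = (s \in @index_U h e1 e2 e3)].
Proof.
move=> hd pxyz S1 S2 S3 E1 E2 E3.
have ex e s : subseq s x -> all2 leq e s -> exists rho : 'I_(sumn e) -> 'I_N, arm_embedding 1 rho.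
  apply: (arm_embedding_exists _ (@index_type1 d x y z)).
  by move=> i j /rshift_inj/lshift_inj.
have ey e s : subseq s y -> all2 leq e s -> exists rho : 'I_(sumn e) -> 'I_N, arm_embedding 2 rho.
  apply: (arm_embedding_exists _ (@index_type2 d x y z)).
  by move=> i j /rshift_inj/rshift_inj/lshift_inj.
have ez e s : subseq s z -> all2 leq e s -> exists rho : 'I_(sumn e) -> 'I_N, arm_embedding 3 rho.
  apply: (arm_embedding_exists _ (@index_type3 d x y z)).
  by move=> i j /rshift_inj/rshift_inj/rshift_inj.
case: (perm_eq3 pxyz) => [|[|[|[|[|]]]]] [e1' e2' e3']; subst x' y' z';
  [have [r1 h1] := ex _ _ S1 E1; have [r2 h2] := ey _ _ S2 E2; have [r3 h3] := ez _ _ S3 E3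
  |have [r1 h1] := ex _ _ S1 E1; have [r2 h2] := ez _ _ S2 E2; have [r3 h3] := ey _ _ S3 E3
  |have [r1 h1] := ey _ _ S1 E1; have [r2 h2] := ex _ _ S2 E2; have [r3 h3] := ez _ _ S3 E3
  |have [r1 h1] := ey _ _ S1 E1; have [r2 h2] := ez _ _ S2 E2; have [r3 h3] := ex _ _ S3 E3
  |have [r1 h1] := ez _ _ S1 E1; have [r2 h2] := ex _ _ S2 E2; have [r3 h3] := ey _ _ S3 E3
  |have [r1 h1] := ez _ _ S1 E1; have [r2 h2] := ey _ _ S2 E2; have [r3 h3] := ex _ _ S3 E3];
  exact: (glue_embeddings hd h1 h2 h3).
Qed.

End IndexEmbedding.

(** * One-parameter families of extended types E6, E7, E8 *)

Section ExceptionalFamilies.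
Local Open Scope ring_scope.

Section Tables.
Variable K : closedFieldType.

(** Missing entries are read as 0, so the one-sided inverses given below can be written as ragged
    tables. *)
Definition table_mx m n (a : seq (seq K)) : 'M[K]_(m, n) :=
  \matrix_(i, j) nth 0 (nth [::] a i) j.

Definition entry m n (M : 'M[K]_(m, n)) (i j : nat) : K :=
  if insub i is Some i' then if insub j is Some j' then M i' j' else 0 else 0.

Lemma entryE m n (M : 'M[K]_(m, n)) i j : entry M (val i) (val j) = M i j.
Proof. by rewrite /entry !valK. Qed.

Lemma table_mul_eq m n p (a b : seq (seq K)) (P : 'M_(n, p)) (Q : 'M_(m, m)) :
  table_mx m n a *m P = Q *m table_mx m p b -> forall i j, (i < m)%N -> (j < p)%N ->
  \sum_(u <- iota 0 n) nth 0 (nth [::] a i) u * entry P u j =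
  \sum_(u <- iota 0 m) entry Q i u * nth 0 (nth [::] b u) j.
Proof.
move=> e i j im jp; have := congr1 (fun M : 'M_(m, p) => M (Ordinal im) (Ordinal jp)) e.
have it k : iota 0 k = index_iota 0 k by rewrite /index_iota subn0.
rewrite !mxE !it !big_mkord => h; transitivity (\sum_j0 table_mx m n a (Ordinal im) j0 * P j0 (Ordinal jp)).
  by apply: eq_bigr => u _; rewrite mxE -(entryE P).
by rewrite h; apply: eq_bigr => u _; rewrite mxE -(entryE Q).
Qed.

Lemma foldr_and_allpairs (P : nat -> nat -> Prop) m n :
  foldr and True [seq P i j | i <- iota 0 m, j <- iota 0 n] ->
  forall i j, (i < m)%N -> (j < n)%N -> P i j.
Proof.
move=> h i j im jn.
have all_in (T : Type) (f : T -> Prop) (l : seq T) : foldr and True (map f l) ->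
    forall k, (k < size l)%N -> forall x0, f (nth x0 l k).
  by elim: l => [|x l IH] //= [fx fl] [|k] //= kl x0; apply: IH.
have cat_and (l1 l2 : seq Prop) : foldr and True (l1 ++ l2) -> foldr and True l1 /\ foldr and True l2.
  by elim: l1 => [|p l1 IH] //= [hp /IH[]].
have row_in (l : seq nat) : foldr and True [seq P i j | i <- l, j <- iota 0 n] ->
    forall i, i \in l -> foldr and True [seq P i j | j <- iota 0 n].
  elim: l => [|i' l IH] //= /cat_and[h1 h2] i'' ; rewrite inE => /orP[/eqP ->//|]; exact: IH.
have hi : i \in iota 0 m by rewrite mem_iota.
have := all_in _ _ _ (row_in _ h i hi) j; rewrite size_iota => /(_ jn 0%N).
by rewrite nth_iota.
Qed.

Lemma entries_eq0 m n (M : 'M[K]_(m, n)) :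
  foldr and True [seq entry M i j = 0 | i <- iota 0 m, j <- iota 0 n] -> M = 0.
Proof.
move/foldr_and_allpairs=> h; apply/matrixP=> i j; rewrite mxE -(entryE M).
exact: h (ltn_ord i) (ltn_ord j).
Qed.

Lemma table_mulE m n p a b (i : 'I_m) (j : 'I_p) :
  (table_mx m n a *m table_mx n p b) i j =
  \sum_(u <- iota 0 n) nth 0 (nth [::] a i) u * nth 0 (nth [::] b u) j.
Proof.
rewrite -[n in iota 0 n]subn0 big_mkord mxE.
by apply: eq_bigr => u _; rewrite !mxE.
Qed.

Lemma table_row_full x h n a :
  foldr and True [seq \sum_(u <- iota 0 h) nth 0 (nth [::] x i) u * nth 0 (nth [::] a u) j
                      = (i == j)%:R | i <- iota 0 n, j <- iota 0 n] ->
  row_full (table_mx h n a).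
Proof.
move/foldr_and_allpairs=> e; apply/row_fullP; exists (table_mx n h x).
by apply/matrixP=> i j; rewrite table_mulE mxE; apply: e (ltn_ord i) (ltn_ord j).
Qed.

Lemma table_row_free x y z h m1 m2 m3 a b c :
  foldr and True
    [seq \sum_(u <- iota 0 m1) nth 0 (nth [::] a i) u * nth 0 (nth [::] x u) j
       + (\sum_(u <- iota 0 m2) nth 0 (nth [::] b i) u * nth 0 (nth [::] y u) j
       + \sum_(u <- iota 0 m3) nth 0 (nth [::] c i) u * nth 0 (nth [::] z u) j)
       = (i == j)%:R | i <- iota 0 h, j <- iota 0 h] ->
  row_free (row_mx (table_mx h m1 a) (row_mx (table_mx h m2 b) (table_mx h m3 c))).
Proof.
move/foldr_and_allpairs=> e; apply/row_freeP.
exists (col_mx (table_mx m1 h x) (col_mx (table_mx m2 h y) (table_mx m3 h z))).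
rewrite !mul_row_col; apply/matrixP=> i j; rewrite [LHS]mxE [in X in _ + X = _]mxE !table_mulE mxE.
exact: e (ltn_ord i) (ltn_ord j).
Qed.

Lemma entry_tri w (p : 'M[K]_(sumn w)) i j : flag_tri p ->
  (level w i < level w j)%N -> entry p i j = 0.
Proof.
move=> tri ij; rewrite /entry; case: insubP => // i' _ ei; case: insubP => // j' _ ej.
by apply: tri; rewrite ei ej.
Qed.

End Tables.

(* Explicit matrix equations are expanded entrywise; each one then determines a variable, and substitution solves the system. *)
Ltac table_eq E i j :=
  let H := fresh "H" in
  have H := E i j isT isT; rewrite /= !big_cons !big_nil /= in H;
  rewrite ?(mul0r, mulr0, mul1r, mulr1, add0r, addr0) in H.

Ltac solve_entries :=
  repeat match goal with
  | H : context [@entry ?k ?m ?n ?M ?i ?j] |- _ =>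
    let v := fresh "v" in set (v := @entry k m n M i j) in *; clearbody v
  end;
  repeat match goal with
  | H : context [0 + ?x] |- _ => rewrite (add0r x) in H
  | H : context [?x + 0] |- _ => rewrite (addr0 x) in H
  | H : context [0 * ?x] |- _ => rewrite (mul0r x) in H
  | H : context [?x * 0] |- _ => rewrite (mulr0 x) in H
  | H : ?x = ?x |- _ => clear H
  | H : 0 = ?x |- _ => is_var x; subst x
  | H : ?x = _ |- _ => is_var x; subst x
  | H : _ = ?x |- _ => is_var x; subst x
  end.

Section Families.
Variable K : closedFieldType.

Definition hom_orthogonal (h : nat) (e1 e2 e3 : seq nat)
    (F : K -> 'M[K]_(h, sumn e1 + (sumn e2 + sumn e3))) : Prop :=
  forall s t, s != t -> forall q (p : 'M[K]_(sumn e1) * 'M[K]_(sumn e2) * 'M[K]_(sumn e3)),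
  flag_tri p.1.1 -> flag_tri p.1.2 -> flag_tri p.2 ->
  F t *m diag3 p = q *m F s -> q = 0 /\ p = (0, 0, 0).

(** Since every block has full column rank, [q = 0] forces the three column factors to vanish, and
    only [q] has to be computed. *)
Lemma hom_orthogonal_row (h : nat) (e1 e2 e3 : seq nat) (A : K -> 'M[K]_(h, sumn e1))
    (B : K -> 'M[K]_(h, sumn e2)) (C : K -> 'M[K]_(h, sumn e3)) :
    (forall t, row_full (A t)) -> (forall t, row_full (B t)) -> (forall t, row_full (C t)) ->
    (forall s t, s != t -> forall q (p1 : 'M[K]_(sumn e1)) (p2 : 'M[K]_(sumn e2)) (p3 : 'M[K]_(sumn e3)),
       flag_tri p1 -> flag_tri p2 -> flag_tri p3 ->
       A t *m p1 = q *m A s -> B t *m p2 = q *m B s -> C t *m p3 = q *m C s -> q = 0) ->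
  hom_orthogonal (fun t => row_mx (A t) (row_mx (B t) (C t))).
Proof.
move=> fA fB fC hom s t st q [[p1 p2] p3] /= t1 t2 t3.
rewrite /diag3 /= !mul_row_block !(mulmx0, addr0, add0r) !mul_mx_row => /eq_row_mx[eA /eq_row_mx[eB eC]].
have q0 := hom s t st q p1 p2 p3 t1 t2 t3 eA eB eC.
have z n (X : 'M[K]_(h, n)) (p : 'M[K]_n) Y : row_full X -> X *m p = q *m Y -> p = 0.
  by case/row_fullP=> X' XX; rewrite q0 mul0mx => /(congr1 (mulmx X')); rewrite mulmxA XX mul1mx mulmx0.
by rewrite (z _ _ _ _ (fA t) eA) (z _ _ _ _ (fB t) eB) (z _ _ _ _ (fC t) eC).
Qed.

(** The equation left after elimination: a scalar that intertwines the parameters of two members. *)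
Lemma cross_eq0 (s t v : K) : s != t -> t * v = v * s -> v = 0.
Proof.
move=> st /eqP; rewrite mulrC -subr_eq0 -mulrBr mulf_eq0 subr_eq0 [t == s]eq_sym (negPf st) orbF.
by move/eqP.
Qed.

(** Three complete flags in the space of columns of height 3: the last column spans the line, both
    columns the plane. The lines are the coordinate axes and, up to sign, [t] is the triple ratio of
    the flags. *)
Definition E6_A : seq (seq K) := [:: [:: 0; 1]; [:: 1; 0]; [:: 1; 0]].
Definition E6_B : seq (seq K) := [:: [:: 1; 0]; [:: 0; 1]; [:: 1; 0]].
Definition E6_C (t : K) : seq (seq K) := [:: [:: 1; 0]; [:: t; 0]; [:: 0; 1]].

Lemma E6_hom (s t : K) : s != t -> forall (q : 'M_3) (p1 p2 p3 : 'M[K]_(sumn [:: 1; 1]%N)),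
  flag_tri p1 -> flag_tri p2 -> flag_tri p3 ->
  table_mx 3 _ E6_A *m p1 = q *m table_mx 3 _ E6_A ->
  table_mx 3 _ E6_B *m p2 = q *m table_mx 3 _ E6_B ->
  table_mx 3 _ (E6_C t) *m p3 = q *m table_mx 3 _ (E6_C s) -> q = 0.
Proof.
move=> st q p1 p2 p3 t1 t2 t3 /table_mul_eq EA /table_mul_eq EB /table_mul_eq EC.
have z1 := entry_tri (i := 0) (j := 1) t1 isT; have z2 := entry_tri (i := 0) (j := 1) t2 isT.
have z3 := entry_tri (i := 0) (j := 1) t3 isT; rewrite /= in z1 z2 z3.
table_eq EA 0%N 0%N; table_eq EA 0%N 1%N; table_eq EA 1%N 0%N; table_eq EA 1%N 1%N; table_eq EA 2%N 0%N; table_eq EA 2%N 1%N.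
table_eq EB 0%N 0%N; table_eq EB 0%N 1%N; table_eq EB 1%N 0%N; table_eq EB 1%N 1%N; table_eq EB 2%N 0%N; table_eq EB 2%N 1%N.
table_eq EC 0%N 0%N; table_eq EC 0%N 1%N; table_eq EC 1%N 0%N; table_eq EC 1%N 1%N; table_eq EC 2%N 0%N; table_eq EC 2%N 1%N.
apply: entries_eq0 => /=; clear EA EB EC; solve_entries.
match goal with H : t * _ = _ |- _ => rewrite (cross_eq0 st H) ?(add0r, addr0) end.
by do !split.
Qed.

(** A plane in 4-space together with two opposite complete flags, [E7_B] and [E7_C], which force [q]
    to be diagonal. Four parameters for the plane minus three for the torus modulo scalars leave
    [t]. *)
Definition E7_A (t : K) : seq (seq K) := [:: [:: 1; 0]; [:: 0; 1]; [:: 1; 1]; [:: 1; t]].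
Definition E7_B : seq (seq K) := [:: [:: 0; 0; 1]; [:: 0; 1; 0]; [:: 1; 0; 0]; [:: 0; 0; 0]].
Definition E7_C : seq (seq K) := [:: [:: 0; 0; 0]; [:: 1; 0; 0]; [:: 0; 1; 0]; [:: 0; 0; 1]].

Lemma E7_hom (s t : K) : s != t ->
  forall (q : 'M_4) (p1 : 'M[K]_(sumn [:: 2]%N)) (p2 p3 : 'M[K]_(sumn [:: 1; 1; 1]%N)),
  flag_tri p1 -> flag_tri p2 -> flag_tri p3 ->
  table_mx 4 _ (E7_A t) *m p1 = q *m table_mx 4 _ (E7_A s) ->
  table_mx 4 _ E7_B *m p2 = q *m table_mx 4 _ E7_B ->
  table_mx 4 _ E7_C *m p3 = q *m table_mx 4 _ E7_C -> q = 0.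
Proof.
move=> st q p1 p2 p3 _ t2 t3 /table_mul_eq EA /table_mul_eq EB /table_mul_eq EC.
have z201 := entry_tri (i := 0) (j := 1) t2 isT; have z202 := entry_tri (i := 0) (j := 2) t2 isT.
have z212 := entry_tri (i := 1) (j := 2) t2 isT; have z301 := entry_tri (i := 0) (j := 1) t3 isT.
have z302 := entry_tri (i := 0) (j := 2) t3 isT; have z312 := entry_tri (i := 1) (j := 2) t3 isT.
rewrite /= in z201 z202 z212 z301 z302 z312.
table_eq EB 0%N 0%N; table_eq EB 0%N 1%N; table_eq EB 0%N 2%N; table_eq EB 1%N 0%N; table_eq EB 1%N 1%N; table_eq EB 1%N 2%N.
table_eq EB 2%N 0%N; table_eq EB 2%N 1%N; table_eq EB 2%N 2%N; table_eq EB 3%N 0%N; table_eq EB 3%N 1%N; table_eq EB 3%N 2%N.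
table_eq EC 0%N 0%N; table_eq EC 0%N 1%N; table_eq EC 0%N 2%N; table_eq EC 1%N 0%N; table_eq EC 1%N 1%N; table_eq EC 1%N 2%N.
table_eq EC 2%N 0%N; table_eq EC 2%N 1%N; table_eq EC 2%N 2%N; table_eq EC 3%N 0%N; table_eq EC 3%N 1%N; table_eq EC 3%N 2%N.
table_eq EA 0%N 0%N; table_eq EA 0%N 1%N; table_eq EA 1%N 0%N; table_eq EA 1%N 1%N.
table_eq EA 2%N 0%N; table_eq EA 2%N 1%N; table_eq EA 3%N 0%N; table_eq EA 3%N 1%N.
apply: entries_eq0 => /=; clear EA EB EC; solve_entries.
match goal with H : t * _ = _ |- _ => rewrite (cross_eq0 st H) ?(add0r, addr0) end.
by do !split.
Qed.

(** A 3-space in 6-space, a flag [E8_B] of type (2,2,2) and an opposite complete flag [E8_C]. The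
    two flags make [q] block diagonal with three lower triangular blocks of size 2: nine parameters,
    of which the scalars act trivially on the 9-dimensional Grassmannian. *)
Definition E8_A (t : K) : seq (seq K) :=
  [:: [:: 1; 1; 0]; [:: 0; 1; 0]; [:: 1; 0; 1]; [:: 0; 0; 1]; [:: 0; 1; t]; [:: 0; 0; 1]].
Definition E8_B : seq (seq K) :=
  [:: [:: 0; 0; 1; 0]; [:: 0; 0; 0; 1]; [:: 1; 0; 0; 0]; [:: 0; 1; 0; 0]; [:: 0; 0; 0; 0]; [:: 0; 0; 0; 0]].
Definition E8_C : seq (seq K) :=
  [:: [:: 0; 0; 0; 0; 0]; [:: 1; 0; 0; 0; 0]; [:: 0; 1; 0; 0; 0]; [:: 0; 0; 1; 0; 0];
      [:: 0; 0; 0; 1; 0]; [:: 0; 0; 0; 0; 1]].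

Lemma E8_hom (s t : K) : s != t ->
  forall (q : 'M_6) (p1 : 'M[K]_(sumn [:: 3]%N)) (p2 : 'M[K]_(sumn [:: 2; 2]%N)) (p3 : 'M[K]_(sumn [:: 1; 1; 1; 1; 1]%N)),
  flag_tri p1 -> flag_tri p2 -> flag_tri p3 ->
  table_mx 6 _ (E8_A t) *m p1 = q *m table_mx 6 _ (E8_A s) ->
  table_mx 6 _ E8_B *m p2 = q *m table_mx 6 _ E8_B ->
  table_mx 6 _ E8_C *m p3 = q *m table_mx 6 _ E8_C -> q = 0.
Proof.
move=> st q p1 p2 p3 _ t2 t3 /table_mul_eq EA /table_mul_eq EB /table_mul_eq EC.
have z02 := entry_tri (i := 0) (j := 2) t2 isT; have z03 := entry_tri (i := 0) (j := 3) t2 isT.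
have z12 := entry_tri (i := 1) (j := 2) t2 isT; have z13 := entry_tri (i := 1) (j := 3) t2 isT.
have y01 := entry_tri (i := 0) (j := 1) t3 isT; have y02 := entry_tri (i := 0) (j := 2) t3 isT.
have y03 := entry_tri (i := 0) (j := 3) t3 isT; have y04 := entry_tri (i := 0) (j := 4) t3 isT.
have y12 := entry_tri (i := 1) (j := 2) t3 isT; have y13 := entry_tri (i := 1) (j := 3) t3 isT.
have y14 := entry_tri (i := 1) (j := 4) t3 isT; have y23 := entry_tri (i := 2) (j := 3) t3 isT.
have y24 := entry_tri (i := 2) (j := 4) t3 isT; have y34 := entry_tri (i := 3) (j := 4) t3 isT.
rewrite /= in z02 z03 z12 z13 y01 y02 y03 y04 y12 y13 y14 y23 y24 y34.
table_eq EC 0%N 0%N; table_eq EC 0%N 1%N; table_eq EC 0%N 2%N; table_eq EC 0%N 3%N; table_eq EC 0%N 4%N.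
table_eq EC 1%N 1%N; table_eq EC 1%N 2%N; table_eq EC 1%N 3%N; table_eq EC 1%N 4%N.
table_eq EC 2%N 2%N; table_eq EC 2%N 3%N; table_eq EC 2%N 4%N; table_eq EC 3%N 3%N; table_eq EC 3%N 4%N; table_eq EC 4%N 4%N.
table_eq EB 2%N 2%N; table_eq EB 2%N 3%N; table_eq EB 3%N 2%N; table_eq EB 3%N 3%N.
table_eq EB 4%N 0%N; table_eq EB 4%N 1%N; table_eq EB 4%N 2%N; table_eq EB 4%N 3%N.
table_eq EB 5%N 0%N; table_eq EB 5%N 1%N; table_eq EB 5%N 2%N; table_eq EB 5%N 3%N.
table_eq EA 0%N 0%N; table_eq EA 1%N 0%N; table_eq EA 2%N 0%N; table_eq EA 3%N 0%N; table_eq EA 4%N 0%N; table_eq EA 5%N 0%N.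
table_eq EA 0%N 1%N; table_eq EA 1%N 1%N; table_eq EA 2%N 1%N; table_eq EA 3%N 1%N; table_eq EA 4%N 1%N; table_eq EA 5%N 1%N.
table_eq EA 0%N 2%N; table_eq EA 1%N 2%N; table_eq EA 2%N 2%N; table_eq EA 3%N 2%N; table_eq EA 4%N 2%N; table_eq EA 5%N 2%N.
apply: entries_eq0 => /=; clear EA EB EC; solve_entries.
match goal with H : t * _ = _ |- _ => rewrite (cross_eq0 st H) ?(add0r, addr0) end.
by do !split.
Qed.

Ltac table_check :=
  rewrite /=; do !split; rewrite ?big_cons ?big_nil /=;
  repeat match goal with
  | |- context [0 + ?x] => rewrite (add0r x)
  | |- context [?x + 0] => rewrite (addr0 x)
  | |- context [0 * ?x] => rewrite (mul0r x)
  | |- context [?x * 0] => rewrite (mulr0 x)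
  | |- context [1 * ?x] => rewrite (mul1r x)
  | |- context [?x * 1] => rewrite (mulr1 x)
  end; rewrite ?subrr; try reflexivity.

Lemma E6_family : exists F : K -> 'M[K]_(3, sumn [:: 1; 1]%N + (sumn [:: 1; 1]%N + sumn [:: 1; 1]%N)),
  (forall t, row_free (F t)) /\ hom_orthogonal F.
Proof.
exists (fun t => row_mx (table_mx 3 _ E6_A) (row_mx (table_mx 3 _ E6_B) (table_mx 3 _ (E6_C t)))).
split=> [t|].
  by apply: (table_row_free (x := [:: [::]; [:: 1]]) (y := [:: [::]; [:: 0; 1]]) (z := [:: [::]; [:: 0; 0; 1]])); table_check.
apply: hom_orthogonal_row => [t|t|t|]; last exact: E6_hom.
- by apply: (table_row_full (x := [:: [:: 0; 1; 0]; [:: 1; 0; 0]])); table_check.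
- by apply: (table_row_full (x := [:: [:: 1; 0; 0]; [:: 0; 1; 0]])); table_check.
- by apply: (table_row_full (x := [:: [:: 1; 0; 0]; [:: 0; 0; 1]])); table_check.
Qed.

Lemma E7_family : exists F : K -> 'M[K]_(4, sumn [:: 2]%N + (sumn [:: 1; 1; 1]%N + sumn [:: 1; 1; 1]%N)),
  (forall t, row_free (F t)) /\ hom_orthogonal F.
Proof.
exists (fun t => row_mx (table_mx 4 _ (E7_A t)) (row_mx (table_mx 4 _ E7_B) (table_mx 4 _ E7_C))).
split=> [t|].
  by apply: (table_row_free (x := [::]) (y := [:: [:: 0; 0; 1]; [:: 0; 1]; [:: 1]])
                            (z := [:: [::]; [::]; [:: 0; 0; 0; 1]])); table_check.
apply: hom_orthogonal_row => [t|t|t|]; last exact: E7_hom.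
- by apply: (table_row_full (x := [:: [:: 1]; [:: 0; 1]])); table_check.
- by apply: (table_row_full (x := [:: [:: 0; 0; 1]; [:: 0; 1]; [:: 1]])); table_check.
- by apply: (table_row_full (x := [:: [:: 0; 1]; [:: 0; 0; 1]; [:: 0; 0; 0; 1]])); table_check.
Qed.

Lemma E8_family : exists F : K -> 'M[K]_(6, sumn [:: 3]%N + (sumn [:: 2; 2]%N + sumn [:: 1; 1; 1; 1; 1]%N)),
  (forall t, row_free (F t)) /\ hom_orthogonal F.
Proof.
exists (fun t => row_mx (table_mx 6 _ (E8_A t)) (row_mx (table_mx 6 _ E8_B) (table_mx 6 _ E8_C))).
split=> [t|].
  by apply: (table_row_free (x := [::]) (y := [:: [::]; [::]; [:: 1]])
    (z := [:: [:: 0; 1]; [:: 0; 0; 1]; [:: 0; 0; 0; 1]; [:: 0; 0; 0; 0; 1]; [:: 0; 0; 0; 0; 0; 1]])); table_check.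
apply: hom_orthogonal_row => [t|t|t|]; last exact: E8_hom.
- by apply: (table_row_full (x := [:: [:: 1; -1]; [:: 0; 1]; [:: 0; 0; 0; 1]])); table_check.
- by apply: (table_row_full (x := [:: [:: 0; 0; 1]; [:: 0; 0; 0; 1]; [:: 1]; [:: 0; 1]])); table_check.
- by apply: (table_row_full (x := [:: [:: 0; 1]; [:: 0; 0; 1]; [:: 0; 0; 0; 1]; [:: 0; 0; 0; 0; 1]; [:: 0; 0; 0; 0; 0; 1]])); table_check.
Qed.

End Families.

End ExceptionalFamilies.

(** * The equivalence of the three conditions *)

Lemma dominated_rcons_inv e k x w : dominated (rcons e k) (rcons x w) ->
  exists2 s, subseq s x & all2 leq e s.
Proof.
case=> s; case/lastP: s => [|s u]; first by move=> _; case: e.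
move=> sx es; exists s; last first.
  elim: e s es {sx} => [|i e IH] [|j s] //=; [by case: s => [|? ?] /=; rewrite andbF|by case: (e) => [|? ?] /=; rewrite andbF|].
  by case/andP=> -> /IH.
move: sx; rewrite -subseq_rev !rev_rcons /= -(subseq_rev s x); case: eqP => // _.
exact/subseq_trans/subseq_cons.
Qed.

Lemma infinite_type_of_le (K : closedFieldType) (l : quadruple) (a b c : seq nat)
    (h h2 : nat) (e1 e2 e3 : seq nat) (k1 k2 k3 : nat)
    (F : K -> 'M[K]_(h, sumn e1 + (sumn e2 + sumn e3))) :
    ([pchar K] =i pred0)%R -> (paird l).1 + (paird l).2 = weight l ->
    perm_eq [:: a; b; c] [:: trunc (seqa l); trunc (seqb l); trunc (seqc l)] ->
    (forall t, row_free (F t)) -> hom_orthogonal F ->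
    0 < h -> sumn e1 + (sumn e2 + sumn e3) <= h + h2 ->
    quadruple_le (Quadruple (rcons e1 k1) (rcons e2 k2) (rcons e3 k3) (h, h2))
      (completed a b c (paird l)) ->
  ~ finite_type K l.
Proof.
move=> charK lw p F_free F_hom h0 eh [/= hd h2d].
case=> /dominated_rcons_inv[s1 s1a e1s] /dominated_rcons_inv[s2 s2b e2s] /dominated_rcons_inv[s3 s3c e3s].
have [J [J_inj J_le J_U]] := index_embedding hd p s1a s2b s3c e1s e2s e3s.
apply: (infinite_type charK F_free F_hom h0 J_inj J_le J_U _ lw hd).
exact: leq_trans eh (leq_add (leqnn _) h2d).
Qed.

Theorem theorem3p3 (K : closedFieldType) (charK : [pchar K]%R =i pred0)
    (l1 l2 l3 : nat) (l1_gt0 : 1 <= l1) (l2_gt0 : 1 <= l2) (l3_gt0 : 1 <= l3)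
    (lam : quadruple) (lam_Lambda : Lambda l1 l2 l3 lam) :
  (finite_type K lam <->
     (forall m, permuted m lam ->
        [/\ ~ quadruple_le lambda1 m, ~ quadruple_le lambda2 m
          & ~ quadruple_le lambda3 m]))
  /\ ((forall m, permuted m lam ->
        [/\ ~ quadruple_le lambda1 m, ~ quadruple_le lambda2 m
          & ~ quadruple_le lambda3 m]) <->
     (exists m, permuted m lam /\ in_list (reduce m))).
Proof.
have [a [b [c [lamE aE bE cE lw]]]] := completedP l1_gt0 l2_gt0 l3_gt0 lam_Lambda.
set P1 := finite_type K lam; set P2 := (X in P1 <-> X); set P3 := (X in P2 <-> X).
have P12 : P1 -> P2.
  move=> fin m; rewrite lamE => /permuted_completed[a' [b' [c' [-> p]]]].
  rewrite aE bE cE in p.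
  have [F6 [f6 o6]] := E6_family K; have [F7 [f7 o7]] := E7_family K; have [F8 [f8 o8]] := E8_family K.
  split.
  - by move=> le; apply: (@infinite_type_of_le K lam a' b' c' 3 3 _ _ _ 4 4 4 F6) fin.
  - by move=> le; apply: (@infinite_type_of_le K lam a' b' c' 4 4 _ _ _ 6 5 5 F7) fin.
  - by move=> le; apply: (@infinite_type_of_le K lam a' b' c' 6 6 _ _ _ 9 8 7 F8) fin.
have P23 : P2 -> P3.
  (* Sorting by the number of nonzero entries selects the permutation of the three sequences to
     which the list is applied. *)
  move=> no; have [a' [b' [c' [p s]]]] := sort3 (fun x => size [seq k <- x | k != 0]) a b c.
  have perm : permuted (completed a' b' c' (paird lam)) lam.
    rewrite {2}lamE; split=> //=.
    case: (perm_eq3 p) => [|[|[|[|[|]]]]] [-> -> ->];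
      rewrite ?[sumn a + sumn b]addnC ?[sumn a + sumn c]addnC ?[sumn b + sumn c]addnC; apply/permP => P /=; lia.
  by exists (completed a' b' c' (paird lam)); have [n1 n2 n3] := no _ perm; split=> //; apply: in_list_of_not_le.
have P31 : P3 -> P1.
  case=> m [perm lst]; move: perm lst; rewrite lamE => /permuted_completed[a' [b' [c' [-> p]]]].
  move/in_list_tits=> tl; apply: (@finite_type_of_list K lam (completed a' b' c' (paird lam))) lw _.
    by rewrite /= !trunc_rcons -aE -bE -cE.
  by rewrite /= !trunc_rcons.
by split; split=> p; [apply: P12|apply: P31; apply: P23|apply: P23|apply: P12; apply: P31].
Qed.
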